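(* Let $m,n\in\mathbb{N}$ with $m<n$, let $U\subset\mathbb{R}^n$ be open, and let $\Sigma\subset U$ be a purely $m$-unrectifiable set with $\mathcal{H}^m(\Sigma)<\infty$. Let $$\mathcal{A}(\Sigma)=\left\{ f\in \mathcal{C}^1(U,\mathbb{R}^n) \;:\; \dim \operatorname{im} Df(x)=m \text{ for all } x\in U,\ \ \mathcal{H}^m(f(\Sigma))>0\right\}.$$ Then the interior of $\mathcal{A}(\Sigma)$, as a subset of $\mathcal{C}^1_{=m}(U,\mathbb{R}^n)$ with the $\mathcal{C}^1$ topology, is empty.
   Context: $\mathcal{H}^m$ denotes the $m$-dimensional Hausdorff measure on $\mathbb{R}^n$. A set $E\subset\mathbb{R}^n$ is $m$-rectifiable if there is a countable family of Lipschitz maps $f_i:\mathbb{R}^m\to\mathbb{R}^n$, $i\in\mathbb{N}$, with $\mathcal{H}^m(E\setminus\bigcup_i f_i(\mathbb{R}^m))=0$. A set $\Sigma\subset\mathbb{R}^n$ is purely $m$-unrectifiable if $\mathcal{H}^m(\Sigma\cap E)=0$ for every $m$-rectifiable set $E$. For an open set $U\subset\mathbb{R}^n$, $\mathcal{C}^1_{=m}(U,\mathbb{R}^n)=\{f\in\mathcal{C}^1(U,\mathbb{R}^n) : \dim\operatorname{im}Df(x)=m \text{ for all } x\in U\}$ is the class of $\mathcal{C}^1$ maps whose Jacobian matrix has constant rank $m$. The $\mathcal{C}^1$ topology is the one in which a basis of neighbourhoods of $f$ is given by the sets $\{g : \|g-f\|_{\mathcal{C}^1(U)}<\varepsilon\}$,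 $\varepsilon>0$, where $\|h\|_{\mathcal{C}^1(U)}=\sup_{U}|h|+\sup_{U}\|Dh\|$ (possibly $+\infty$). *)

(* Defs.v *)
From HB Require Import structures.
From mathcomp Require Import all_boot all_order all_algebra.
From mathcomp Require Import all_classical all_reals all_analysis.
From mathcomp Require Import ring lra.
Set Implicit Arguments.
Unset Strict Implicit.
Unset Printing Implicit Defensive.
Import Order.TTheory GRing.Theory Num.Theory.
Import numFieldNormedType.Exports.
Local Open Scope classical_set_scope.
Local Open Scope ring_scope.

(* The library norm on 'rV[R]_n is the sup norm; metric notions below
   (diameter, Lipschitz, operator norm) use the Euclidean norm instead.
   Topology and differentiability are the library's, as they do not depend on
   the choice of the norm. *)
Definition enorm (R : realType) (n : nat) (x : 'rV[R]_n) : R :=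
  Num.sqrt (\sum_(i < n) x ord0 i ^+ 2).

Section hausdorff_measure.
Context {R : realType} {n : nat}.
Implicit Types (E : set 'rV[R]_n) (F : (set 'rV[R]_n)^nat).

Definition diam E : \bar R :=
  ereal_sup [set (enorm (z.1 - z.2))%:E | z in E `*` E].

(* (diam E)^m, with the empty set contributing 0 even when m = 0, so that the
   measure of dimension 0 is the counting measure. *)
Definition hausdorff_weight (m : nat) E : \bar R :=
  if E == set0 then 0%E else (diam E ^+ m)%E.

Definition hausdorff_delta (m : nat) (delta : R) E : \bar R :=
  ereal_inf [set (\sum_(0 <= i <oo) hausdorff_weight m (F i))%E | F in
    [set F | E `<=` \bigcup_i F i /\ forall i, (diam (F i) <= delta%:E)%E]].

(* The limit as delta -> 0 is a supremum, by monotonicity. No normalizing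
   constant: only finiteness and vanishing of the measure are ever used. *)
Definition hausdorff (m : nat) E : \bar R :=
  ereal_sup [set hausdorff_delta m delta E | delta in [set d : R | 0 < d]].

Definition elipschitz (m : nat) (f : 'rV[R]_m -> 'rV[R]_n) : Prop :=
  exists K : R, forall x y, enorm (f x - f y) <= K * enorm (x - y).

Definition rectifiable (m : nat) E : Prop :=
  exists f : nat -> 'rV[R]_m -> 'rV[R]_n,
    (forall i, elipschitz (f i)) /\
    hausdorff m (E `\` \bigcup_i range (f i)) = 0%E.

Definition purely_unrectifiable (m : nat) (S : set 'rV[R]_n) : Prop :=
  forall E, rectifiable m E -> hausdorff m (S `&` E) = 0%E.

End hausdorff_measure.

Section C1_norm.
Context {R : realType} {n : nat}.
Implicit Types (U : set 'rV[R]_n) (f g h : 'rV[R]_n -> 'rV[R]_n).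

(* Finite; taken in \bar R for convenience. The library's Jacobian acts on row
   vectors: 'd h x v = v *m 'J h x. *)
Definition opnorm (A : 'M[R]_n) : \bar R :=
  ereal_sup [set (enorm (v *m A))%:E | v in [set v | enorm v <= 1]].

(* Supremum in [0, +oo], so that it is 0 on the empty set. *)
Definition sup_on U (u : 'rV[R]_n -> \bar R) : \bar R :=
  maxe 0%E (ereal_sup [set u x | x in U]).

Definition C1norm U h : \bar R :=
  (sup_on U (fun x => (enorm (h x))%:E) +
   sup_on U (fun x => opnorm ('J h x)))%E.

Definition C1_on U f : Prop :=
  (forall x, U x -> differentiable f x) /\
  {within U, continuous (fun x => 'J f x)}.

End C1_norm.

(* Maps U -> R^n are represented by their extension by 0 to R^n, so that two
   elements are equal as soon as they agree on U. *)
Record C1rank (R : realType) (n m : nat) (U : set 'rV[R]_n) := MkC1rank {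
  C1rank_fun :> 'rV[R]_n -> 'rV[R]_n;
  C1rank_C1 : C1_on U C1rank_fun;
  C1rank_rank : forall x, U x -> \rank ('J C1rank_fun x) = m;
  C1rank_out : forall x, ~ U x -> C1rank_fun x = 0 }.

Section C1_norm_theory.
Context {R : realType} {n : nat}.
Implicit Types (U : set 'rV[R]_n) (f g h : 'rV[R]_n -> 'rV[R]_n).

Lemma enorm0 k : enorm (0 : 'rV[R]_k) = 0.
Proof.
by rewrite /enorm big1 ?sqrtr0// => i _; rewrite mxE expr0n.
Qed.

Lemma enorm_sqr k (x : 'rV[R]_k) : enorm x ^+ 2 = \sum_(i < k) x ord0 i ^+ 2.
Proof. by rewrite sqr_sqrtr// sumr_ge0// => i _; exact: sqr_ge0. Qed.

Lemma dot_le_enorm k (x y : 'rV[R]_k) :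
  \sum_(i < k) x ord0 i * y ord0 i <= enorm x * enorm y.
Proof.
have [x0|x0] := eqVneq (enorm x * enorm y) 0.
  have {}x0 : (enorm x == 0) || (enorm y == 0) by rewrite -mulf_eq0 x0.
  suff z (u : 'rV[R]_k) : enorm u = 0 -> forall i, u ord0 i = 0.
    rewrite big1 ?mulr_ge0 ?sqrtr_ge0// => i _.
    by case/orP: x0 => /eqP/z ->; rewrite ?mul0r ?mulr0.
  move=> /(congr1 (fun t => t ^+ 2)); rewrite enorm_sqr expr0n/= => /eqP.
  rewrite psumr_eq0 => [/allP u0 i|i _]; last exact: sqr_ge0.
  by apply/eqP; rewrite -sqrf_eq0; apply: u0; rewrite mem_index_enum.
have p : 0 < enorm x * enorm y by rewrite lt0r x0 mulr_ge0 ?sqrtr_ge0.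
have : 0 <= \sum_(i < k) (enorm y * x ord0 i - enorm x * y ord0 i) ^+ 2.
  by rewrite sumr_ge0// => i _; exact: sqr_ge0.
rewrite (eq_bigr (fun i => enorm y ^+ 2 * x ord0 i ^+ 2
    + enorm x ^+ 2 * y ord0 i ^+ 2
    - 2 * (enorm x * enorm y) * (x ord0 i * y ord0 i))); last first.
  by move=> i _; ring.
rewrite sumrB big_split/= -!mulr_sumr -!enorm_sqr => H.
rewrite -(ler_pM2l p); move: H.
set s := \sum_(i < k) _; set a := enorm x; set b := enorm y; nra.
Qed.

Lemma enormD k (x y : 'rV[R]_k) : enorm (x + y) <= enorm x + enorm y.
Proof.
rewrite -(@ler_pXn2r _ 2)// ?nnegrE ?addr_ge0 ?sqrtr_ge0//.
rewrite enorm_sqr sqrrD !enorm_sqr.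
rewrite (eq_bigr (fun i => x ord0 i ^+ 2 + 2 * (x ord0 i * y ord0 i)
    + y ord0 i ^+ 2)); last by move=> i _; rewrite mxE; ring.
rewrite !big_split/= lerD2r lerD2l -mulr_sumr -[leRHS]mulr_natl ler_pM2l ?ltr0n//.
exact: dot_le_enorm.
Qed.

Lemma opnormD (A B : 'M[R]_n) : (opnorm (A + B) <= opnorm A + opnorm B)%E.
Proof.
apply: ge_ereal_sup => _ [v /= v1 <-]; rewrite mulmxDr.
apply: (@le_trans _ _ ((enorm (v *m A))%:E + (enorm (v *m B))%:E)%E).
  by rewrite -EFinD lee_fin enormD.
by apply: leeD; apply: ereal_sup_ubound; exists v.
Qed.

Lemma opnorm0 : opnorm (0 : 'M[R]_n) = 0%E.
Proof.
apply/le_anti/andP; split.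
  by apply: ge_ereal_sup => _ [v _ <-]; rewrite mulmx0 enorm0.
by apply: ereal_sup_ubound; exists 0; rewrite /= ?enorm0// mul0mx enorm0.
Qed.

Lemma sup_on_ge0 U u : (0 <= sup_on U u)%E.
Proof. by rewrite le_max lexx. Qed.

Lemma sup_onD U u1 u2 u3 : (forall x, U x -> (u1 x <= u2 x + u3 x)%E) ->
  (sup_on U u1 <= sup_on U u2 + sup_on U u3)%E.
Proof.
move=> u123; rewrite ge_max adde_ge0 ?sup_on_ge0//=.
apply: ge_ereal_sup => _ [x Ux <-]; apply: (le_trans (u123 _ Ux)).
by apply: leeD; rewrite le_max; apply/orP; right;
  apply: ereal_sup_ubound; exists x.
Qed.

Lemma jacobianD f g x : differentiable f x -> differentiable g x ->
  'J (f + g) x = 'J f x + 'J g x.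
Proof.
move=> df dg.
have e v : 'D_v (f + g) x = 'D_v f x + 'D_v g x.
  by apply: deriveD; apply: diff_derivable.
have dfg : differentiable (f + g) x by exact: differentiableD.
apply/row_matrixP => i; rewrite !rowE mulmxDr.
have := e (delta_mx 0 i).
have e1 := @deriveEjacobian R n n f x (delta_mx 0 i) df.
have e2 := @deriveEjacobian R n n g x (delta_mx 0 i) dg.
have e3 := @deriveEjacobian R n n (f + g) x (delta_mx 0 i) dfg.
by rewrite e1 e2 e3.
Qed.

Lemma jacobian_cst0 x : 'J (0 : 'rV[R]_n -> 'rV[R]_n) x = 0.
Proof.
apply/row_matrixP => i; rewrite !rowE mulmx0 -deriveEjacobian.
  exact: derive_cst.
exact: differentiable_cst.
Qed.

Lemma C1norm0 U : C1norm U 0 = 0%E.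
Proof.
rewrite /C1norm /sup_on !max_l ?adde0//; apply: ge_ereal_sup => _ [x _ <-].
  by rewrite jacobian_cst0 opnorm0.
by rewrite /= enorm0.
Qed.

Lemma C1normD U f g : (forall x, U x -> differentiable f x) ->
  (forall x, U x -> differentiable g x) ->
  (C1norm U (f + g)%R <= C1norm U f + C1norm U g)%E.
Proof.
move=> df dg; rewrite /C1norm addeACA; apply: leeD; apply: sup_onD => x Ux.
  by rewrite -EFinD lee_fin enormD.
by rewrite jacobianD; [exact: opnormD|exact: df|exact: dg].
Qed.

End C1_norm_theory.

Section C1_topology.
Context {R : realType} {n m : nat} {U : set 'rV[R]_n}.
Local Notation T := (C1rank m U).

HB.instance Definition _ := gen_eqMixin T.
HB.instance Definition _ := gen_choiceMixin T.

Definition C1ball (f : T) (e : R) : set T :=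
  [set g : T | (C1norm U ((g : _ -> _) - (f : _ -> _))%R < e%:E)%E].

Definition C1nbhs (f : T) : set_system T :=
  filter_from [set e : R | 0 < e] (C1ball f).

HB.instance Definition _ := hasNbhs.Build T C1nbhs.

Lemma C1ball_center (f : T) (e : R) : 0 < e -> C1ball f e f.
Proof. by move=> e0; rewrite /C1ball /= subrr C1norm0 lte_fin. Qed.

Let C1nbhs_filter (f : T) : ProperFilter (C1nbhs f).
Proof.
apply: filter_from_proper; last by move=> e /C1ball_center; exists f.
apply: filter_from_filter; first by exists 1 => /=.
move=> e1 e2 /= e10 e20; exists (Num.min e1 e2); rewrite /= ?lt_min ?e10//.
move=> g gf; split; apply: lt_le_trans gf _; rewrite lee_fin.
  by rewrite ge_min lexx.
by rewrite ge_min lexx orbT.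
Qed.

Let C1nbhs_singleton (f : T) (A : set T) : C1nbhs f A -> A f.
Proof. by case=> e /= e0; apply; exact: C1ball_center. Qed.

Let C1nbhs_nbhs (f : T) (A : set T) : C1nbhs f A -> C1nbhs f (C1nbhs^~ A).
Proof.
case=> e /= e0 eA; exists (e / 2); rewrite /= ?divr_gt0// => g gf.
exists (e / 2); rewrite /= ?divr_gt0// => k kg; apply: eA.
have dB (a b : T) x : U x -> differentiable ((a : _ -> _) - (b : _ -> _)) x.
  by move=> Ux; apply: differentiableB;
    [exact: (C1rank_C1 a).1|exact: (C1rank_C1 b).1].
have := C1normD (@dB k g) (@dB g f); rewrite addrA subrK => kgf.
have : (C1norm U ((k : _ -> _) - (g : _ -> _))%R +
        C1norm U ((g : _ -> _) - (f : _ -> _))%R < (e / 2)%:E + (e / 2)%:E)%E.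
  exact: lteD kg gf.
by rewrite -EFinD -splitr; exact: le_lt_trans.
Qed.

HB.instance Definition _ := Nbhs_isNbhsTopological.Build T
  C1nbhs_filter C1nbhs_singleton C1nbhs_nbhs.

End C1_topology.

(* Main.v *)
Require Import Defs.
From HB Require Import structures.
From mathcomp Require Import all_boot all_order all_algebra.
From mathcomp Require Import all_classical all_reals all_analysis.
From mathcomp Require Import measurable_realfun.
From mathcomp Require Import ring lra zify.
Import Order.TTheory GRing.Theory Num.Theory.
Import numFieldNormedType.Exports.
Set Implicit Arguments.
Unset Strict Implicit.
Unset Printing Implicit Defensive.
Local Open Scope classical_set_scope.
Local Open Scope ring_scope.

(* Every f of constant rank m is the limit of maps g of constant rank m with
   H^m (g(Sigma)) = 0.  Locally f factors through a map F into R^m, and f can be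
   composed with a small deformation X of the identity such that F o X = F + w for a
   prescribed small w; the rank of f o X is still m, and f (X x) is a Lipschitz function
   of F x + w x.  So it is enough that F + w maps Sigma to a null set of R^m.  Taking
   w = - \sum_j q_j b_j with q = (u, u x), where u is a bump function, this holds for
   suitable arbitrarily small vectors b_j, by a Besicovitch-Federer theorem for shears.
   Values of infinite multiplicity or infinite density form a null set.  Fix a point a
   whose value is neither, and all the b_i but b_j: by Lebesgue density, for almost every
   b_j the narrow cones at a along q_j are thin.  By Fubini one choice of b works for
   almost every a, and a set with thin narrow cones at every point has measure 0.
   The local perturbations are glued along disjoint regions, cut out by countably many
   spheres which meet Sigma in null sets.

   All of this is done on a sigma-compact set carrying Sigma, on which pure
   unrectifiability amounts to graphs over R^m being null. *)

(** * Hausdorff measure *)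

(** An additive perturbation of f can raise the rank, while precomposition with a local
    diffeomorphism keeps it: the only freedom is where F o X goes. A narrow cone around a fibre of F
    + w splits into finitely many cones, each along one coordinate of q and governed by one vector
    b_j. The direction argument fixes the point a before b, while one b must serve almost every a.
    Fubini exchanges the two, but H^m is not sigma-finite on R^n for m < n, and isolation in a fibre
    is not visibly measurable. Hence the countable unions of compact sets of finite measure, the
    scales 2^-i, and the replacement of conditions on fibres by nullity of thin strips. On R^m the
    measure H^m takes the place of Lebesgue measure, through Caratheodory measurability and
    comparability with r^m on cubes; constants are therefore generous. As u degenerates at the edge
    of its support, nullity is obtained on each {u >= 1/(l+1)} and summed. The spheres are not moved
    at all, but a differentiable map sends null sets to null sets. *)

Section euclidean_vs_sup.
Context {R : realType}.

Lemma enorm_ge0 n (x : 'rV[R]_n) : 0 <= enorm x.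
Proof. exact: sqrtr_ge0. Qed.

Lemma coord_le_enorm n (x : 'rV[R]_n) i : `|x ord0 i| <= enorm x.
Proof.
rewrite -sqrtr_sqr ler_wsqrtr// (bigD1 i)//= lerDl sumr_ge0// => j _.
exact: sqr_ge0.
Qed.

Lemma row_norm_le n (x : 'rV[R]_n) (c : R) :
  0 <= c -> (forall i, `|x ord0 i| <= c) -> `|x| <= c.
Proof.
move=> c0 xc; rewrite /Num.norm/= mx_normrE; apply: bigmax_le => // -[i j] _ /=.
by rewrite ord1.
Qed.

Lemma coord_le_norm n (x : 'rV[R]_n) i : `|x ord0 i| <= `|x|.
Proof.
by rewrite [leRHS]/Num.norm/= mx_normrE (le_bigmax _ (fun j : 'I_1 * 'I_n => `|x j.1 j.2|) (ord0, i)).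
Qed.

Lemma norm_le_enorm n (x : 'rV[R]_n) : `|x| <= enorm x.
Proof. by apply: row_norm_le; [exact: enorm_ge0|exact: coord_le_enorm]. Qed.

Lemma enorm_le_norm n (x : 'rV[R]_n) : enorm x <= n%:R * `|x|.
Proof.
rewrite -(@ler_pXn2r _ 2)// ?nnegrE ?mulr_ge0 ?enorm_ge0//.
rewrite enorm_sqr (@le_trans _ _ (\sum_(i < n) `|x| ^+ 2))//.
  by apply: ler_sum => i _; rewrite -real_normK ?num_real// lerXn2r ?nnegrE// coord_le_norm.
rewrite sumr_const card_ord exprMn -[leLHS]mulr_natl ler_wpM2r ?exprn_ge0//.
by rewrite -natrX ler_nat; case: n x => // k _; rewrite expnS expn1 leq_pmulr.
Qed.

End euclidean_vs_sup.

(** * Outer measure and numerical covers *)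

Section hausdorff_cover.
Context {R : realType} {n : nat}.
Implicit Types (A B E : set 'rV[R]_n) (F : (set 'rV[R]_n)^nat).

Lemma diam_le E (d : R) : (forall x y, E x -> E y -> enorm (x - y) <= d) ->
  (diam E <= d%:E)%E.
Proof.
move=> Ed; apply: ge_ereal_sup => _ [[x y] [/= Ex Ey] <-].
by rewrite lee_fin Ed.
Qed.

Lemma enorm_le_diam E x y : E x -> E y -> ((enorm (x - y))%:E <= diam E)%E.
Proof. by move=> Ex Ey; apply: ereal_sup_ubound; exists (x, y). Qed.

Lemma diam_ge0 E : E !=set0 -> (0 <= diam E)%E.
Proof.
by move=> [x Ex]; rewrite (le_trans _ (enorm_le_diam Ex Ex))// lee_fin enorm_ge0.
Qed.

Lemma hausdorff_weight_ge0 m E : (0 <= hausdorff_weight m E)%E.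
Proof.
rewrite /hausdorff_weight; case: eqP => // /eqP /set0P E0.
by rewrite expe_ge0// diam_ge0.
Qed.

Lemma hausdorff_weight_le m E (d : R) : 0 <= d ->
  (forall x y, E x -> E y -> enorm (x - y) <= d) ->
  (hausdorff_weight m E <= (d ^+ m)%:E)%E.
Proof.
move=> d0 Ed; rewrite /hausdorff_weight; case: eqP => [_|/eqP /set0P E0].
  by rewrite lee_fin exprn_ge0.
have := diam_le Ed; have := diam_ge0 E0.
case: (diam E) => // r; rewrite !lee_fin => r0 rd.
by rewrite -EFin_expe lee_fin lerXn2r.
Qed.

(** The bound on diameters is moved into the weight, which is +oo on sets that are too large. This
    turns [hausdorff_delta] into the outer measure [mu_ext] of a weight, with monotonicity and
    sigma-subadditivity at hand; every set is measurable in [discrete], so arbitrary covers are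
    allowed. *)
Let weight_cut m (d : R) E : \bar R :=
  if (diam E <= d%:E)%E then hausdorff_weight m E else +oo%E.

Let discrete := g_sigma_algebraType [set: set 'rV[R]_n].

Let hausdorff_deltaE m (d : R) : 0 < d ->
  hausdorff_delta m d = @mu_ext _ discrete R (weight_cut m d).
Proof.
move=> d0; apply/funext => E; apply/le_anti/andP; split.
  apply: le_ereal_inf_tmp => _ [F [_ EF] <-].
  have [Fd|] := pselect (forall i, (diam (F i) <= d%:E)%E).
    apply: ereal_inf_lbound; exists F => //.
    by apply: eq_eseriesr => i _; rewrite /weight_cut Fd.
  move=> /existsNP[i /negP Fi]; rewrite (@eseries_pinfty _ _ _ i) ?leey//.
    by move=> j _; rewrite /weight_cut; case: ifP => // _;
      rewrite gt_eqF// (lt_le_trans _ (hausdorff_weight_ge0 _ _)).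
  by rewrite /weight_cut (negbTE Fi).
apply: le_ereal_inf_tmp => _ [F [EF Fd] <-].
apply: ereal_inf_lbound; exists F.
  by split=> // i; exact: sub_gen_smallest.
by apply: eq_eseriesr => i _; rewrite /weight_cut Fd.
Qed.

Let weight_cut0 m (d : R) : weight_cut m d set0 = 0%E.
Proof.
rewrite /weight_cut /hausdorff_weight eqxx.
suff -> : diam (@set0 'rV[R]_n) = -oo%E by rewrite leNye.
by rewrite /diam setX0 image_set0 ereal_sup0.
Qed.

Let weight_cut_ge0 m (d : R) E : (0 <= weight_cut m d E)%E.
Proof. by rewrite /weight_cut; case: ifP => // _; exact: hausdorff_weight_ge0. Qed.

Lemma hausdorff_delta_le m (d : R) E : 0 < d ->
  (hausdorff_delta m d E <= hausdorff m E)%E.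
Proof. by move=> d0; apply: ereal_sup_ubound; exists d. Qed.

Let hausdorff0 m : hausdorff m (@set0 'rV[R]_n) = 0%E.
Proof.
apply/le_anti/andP; split; last first.
  apply: le_trans (@hausdorff_delta_le m 1 _ ltr01).
  by rewrite hausdorff_deltaE// mu_ext_ge0.
apply: ge_ereal_sup => _ [d /= d0 <-]; rewrite hausdorff_deltaE//.
by rewrite (mu_ext0 (weight_cut0 _ _)).
Qed.

Let hausdorff_ge0 m E : (0 <= hausdorff m E)%E.
Proof.
apply: le_trans (@hausdorff_delta_le m 1 _ ltr01).
by rewrite hausdorff_deltaE// mu_ext_ge0.
Qed.

Let hausdorff_homo m : {homo @hausdorff R n m : A B / A `<=` B >-> (A <= B)%E}.
Proof.
move=> A B AB; apply: ge_ereal_sup => _ [d /= d0 <-].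
apply: le_trans (hausdorff_delta_le _ _ d0).
by rewrite hausdorff_deltaE// le_mu_ext.
Qed.

Let hausdorff_sigma_subadditive m : sigma_subadditive (@hausdorff R n m).
Proof.
move=> F; apply: ge_ereal_sup => _ [d /= d0 <-].
rewrite hausdorff_deltaE//.
have := @mu_ext_sigma_subadditive _ discrete R (weight_cut m d)
  (@weight_cut_ge0 _ _) F.
move=> /le_trans; apply.
apply: lee_nneseries => [i _ _|i _]; first exact: mu_ext_ge0.
by rewrite -hausdorff_deltaE// hausdorff_delta_le.
Qed.

HB.instance Definition _ m := isOuterMeasure.Build R 'rV[R]_n (hausdorff m)
  (hausdorff0 m) (@hausdorff_ge0 m) (@hausdorff_homo m) (@hausdorff_sigma_subadditive m).

(** Numerical bounds [r i] on diameters avoid the diameter -oo of the empty set and powers in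
    [\bar R]. In the converse [hausdorff_coverP], empty sets get [r i = 0], which costs nothing
    because 0 < m. *)
Lemma hausdorff_leP m E (v : \bar R) :
  (forall d, 0 < d -> exists F (r : nat -> R),
    [/\ E `<=` \bigcup_i F i, forall i, 0 <= r i <= d,
        forall i x y, F i x -> F i y -> enorm (x - y) <= r i &
        (\sum_(0 <= i <oo) ((r i) ^+ m)%:E <= v)%E]) ->
  (hausdorff m E <= v)%E.
Proof.
move=> Ev; apply: ge_ereal_sup => _ [d /= d0 <-].
have [F [r [EF rd Fr rv]]] := Ev d d0.
apply: le_trans rv; apply: (@le_trans _ _ (\sum_(0 <= i <oo) hausdorff_weight m (F i))%E).
  apply: ereal_inf_lbound; exists F => //; split=> // i.
  apply: (@le_trans _ _ (r i)%:E); first exact/diam_le/Fr.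
  by rewrite lee_fin; case/andP: (rd i).
apply: lee_nneseries => [i _ _|i _]; first exact: hausdorff_weight_ge0.
by apply: hausdorff_weight_le; [case/andP: (rd i)|exact: Fr].
Qed.

Lemma hausdorff_coverP m E (d e : R) : (0 < m)%N ->
  (hausdorff m E < +oo)%E -> 0 < d -> 0 < e ->
  exists F (r : nat -> R),
    [/\ E `<=` \bigcup_i F i, forall i, 0 <= r i <= d,
        forall i x y, F i x -> F i y -> enorm (x - y) <= r i &
        (\sum_(0 <= i <oo) ((r i) ^+ m)%:E <= hausdorff m E + e%:E)%E].
Proof.
move=> m0 Eoo d0 e0.
have hE := hausdorff_delta_le m E d0.
have dfin : hausdorff_delta m d E \is a fin_num.
  rewrite ge0_fin_numE ?(le_lt_trans hE)//.
  by rewrite hausdorff_deltaE// mu_ext_ge0.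
have [_ [F [EF Fd] <-] /ltW Fe] := lb_ereal_inf_adherent e0 dfin.
exists F, (fun i => if F i == set0 then 0 else fine (diam (F i))).
have Ffin i : F i !=set0 -> diam (F i) = (fine (diam (F i)))%:E.
  move=> Fi; rewrite fineK// ge0_fin_numE ?diam_ge0//.
  exact: le_lt_trans (Fd i) (ltry _).
split=> //.
- move=> i; case: eqP => [_|/eqP/set0P Fi]; first by rewrite lexx ltW.
  by rewrite -!lee_fin -Ffin// diam_ge0// Fd.
- move=> i x y Fx Fy; have F0 : F i !=set0 by exists x.
  rewrite ifF; last by apply/negbTE/set0P.
  by rewrite -lee_fin -Ffin// enorm_le_diam.
- rewrite (@eq_eseriesr _ _ (fun i => hausdorff_weight m (F i))) => [|i _].
    by apply: (le_trans Fe); rewrite leeD2r.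
  rewrite /hausdorff_weight; case: eqP => [_|/eqP/set0P Fi].
    by rewrite expr0n eqn0Ngt m0.
  by rewrite [in RHS]Ffin// -EFin_expe.
Qed.

End hausdorff_cover.

(** * Lipschitz images and separated sets *)

Section hausdorff_maps.
Context {R : realType} (m : nat) (m_gt0 : (0 < m)%N).

(** The hypothesis is in the sup norm and diameters are Euclidean: the factor [p] is the price of
    the change of norm in the target. *)
Lemma hausdorff_image_le n p (A : set 'rV[R]_n) (f : 'rV[R]_n -> 'rV[R]_p) (C : R) :
  0 <= C -> (forall x y, A x -> A y -> `|f x - f y| <= C * `|x - y|) ->
  (hausdorff m (f @` A) <= ((p%:R * C) ^+ m)%:E * hausdorff m A)%E.
Proof.
move=> C0 fA; have pC0 : 0 <= p%:R * C by rewrite mulr_ge0.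
have fE x y : A x -> A y -> enorm (f x - f y) <= p%:R * C * enorm (x - y).
  move=> Ax Ay; apply: (le_trans (enorm_le_norm _)).
  rewrite -mulrA ler_wpM2l//; apply: (le_trans (fA _ _ Ax Ay)).
  by rewrite ler_wpM2l// norm_le_enorm.
have [Aoo|] := ltP (hausdorff m A) +oo%E; last first.
  rewrite leye_eq => /eqP Aoo.
  have [pC|pC] := eqVneq (p%:R * C) 0; last first.
    by rewrite Aoo gt0_muley ?leey// lte_fin exprn_gt0// lt_neqAle eq_sym pC.
  rewrite pC expr0n eqn0Ngt m_gt0 mul0e.
  apply: hausdorff_leP => d d0; exists (fun=> f @` A), (fun=> 0); split.
  - by move=> y fy; exists 0%N.
  - by move=> _; rewrite lexx ltW.
  - move=> _ _ _ [x Ax <-] [y Ay <-].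
    by rewrite (le_trans (fE _ _ Ax Ay))// pC mul0r.
  - by rewrite eseries0// => i _ _; rewrite expr0n eqn0Ngt m_gt0.
(* As [p * C] may vanish, scale and error are divided by powers of [p * C + 1] instead. *)
have K0 : 0 < p%:R * C + 1 by lra.
apply/lee_addgt0Pr => e e0.
apply: hausdorff_leP => d d0.
have KX : 0 < (p%:R * C + 1) ^+ m by rewrite exprn_gt0.
have [F [r [AF rd Fr Fe]]] := @hausdorff_coverP R n m A (d / (p%:R * C + 1))
  (e / (p%:R * C + 1) ^+ m) m_gt0 Aoo (divr_gt0 d0 K0) (divr_gt0 e0 KX).
exists (fun i => f @` (A `&` F i)), (fun i => p%:R * C * r i); split.
- move=> _ [x Ax <-]; have [i _ Fi] := AF x Ax.
  by exists i => //; exists x.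
- move=> i; have /andP[r0 rle] := rd i; rewrite mulr_ge0//=.
  have : (p%:R * C + 1) * r i <= d by rewrite mulrC -ler_pdivlMr.
  by nra.
- move=> i _ _ [x [Ax Fx] <-] [y [Ay Fy] <-].
  by rewrite (le_trans (fE _ _ Ax Ay))// ler_wpM2l// Fr.
- under eq_eseriesr do rewrite exprMn EFinM.
  have r0 i : (0 <= (r i ^+ m)%:E)%E.
    by rewrite lee_fin exprn_ge0//; case/andP: (rd i).
  rewrite nneseriesZl//.
  apply: (@le_trans _ _ (((p%:R * C) ^+ m)%:E * (hausdorff m A + (e / (p%:R * C + 1) ^+ m)%:E))%E).
    by rewrite lee_wpmul2l// lee_fin exprn_ge0.
  rewrite ge0_muleDr ?outer_measure_ge0 ?lee_fin ?divr_ge0 ?(ltW e0) ?(ltW KX)//.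
  rewrite leeD2l// -EFinM lee_fin mulrA ler_pdivrMr// mulrC ler_wpM2l ?(ltW e0)//.
  by rewrite lerXn2r ?nnegrE ?(ltW K0)// lerDl.
Qed.

Lemma hausdorff_image0 n p (A : set 'rV[R]_n) (f : 'rV[R]_n -> 'rV[R]_p) (C : R) :
  (forall x y, A x -> A y -> `|f x - f y| <= C * `|x - y|) ->
  hausdorff m A = 0%E -> hausdorff m (f @` A) = 0%E.
Proof.
move=> fA A0; apply/le_anti; rewrite outer_measure_ge0 andbT.
have := @hausdorff_image_le n p A f `|C| (normr_ge0 _) _.
rewrite A0 mule0; apply => x y Ax Ay.
by apply: (le_trans (fA _ _ Ax Ay)); rewrite ler_wpM2r// ler_norm.
Qed.

(** A set of diameter less than [c] cannot meet both sets, so a fine cover of the union splits into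
    a cover of each. This is the metric property behind Caratheodory's criterion. *)
Lemma hausdorff_separated n (A B : set 'rV[R]_n) (c : R) : 0 < c ->
  (forall a b, A a -> B b -> c <= `|a - b|) ->
  (hausdorff m A + hausdorff m B <= hausdorff m (A `|` B))%E.
Proof.
move=> c0 ABc; have [ABoo|] := ltP (hausdorff m (A `|` B)) +oo%E; last first.
  by rewrite leye_eq => /eqP ->; rewrite leey.
have cover (d e : R) : 0 < d -> 0 < e -> exists F (r : nat -> R),
    [/\ A `|` B `<=` \bigcup_i F i, forall i, 0 <= r i <= d,
        forall i x y, F i x -> F i y -> enorm (x - y) <= r i &
        (\sum_(0 <= i <oo) ((r i) ^+ m)%:E <= hausdorff m (A `|` B) + e%:E)%E].
  by move=> d0 e0; exact: hausdorff_coverP.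
have delta_le E (d : R) F (r : nat -> R) : 0 < d -> E `<=` \bigcup_i F i ->
    (forall i, 0 <= r i <= d) ->
    (forall i x y, F i x -> F i y -> enorm (x - y) <= r i) ->
    (@hausdorff_delta R n m d E <= \sum_(0 <= i <oo) ((r i) ^+ m)%:E)%E.
  move=> d0 EF rd Fr.
  apply: (@le_trans _ _ (\sum_(0 <= i <oo) hausdorff_weight m (F i))%E).
    apply: ereal_inf_lbound; exists F => //; split=> // i.
    apply: (@le_trans _ _ (r i)%:E); first exact/diam_le/Fr.
    by rewrite lee_fin; case/andP: (rd i).
  apply: lee_nneseries => [i _ _|i _]; first exact: hausdorff_weight_ge0.
  by apply: hausdorff_weight_le; [case/andP: (rd i)|exact: Fr].
have key (d : R) : 0 < d -> d < c ->
    (hausdorff_delta m d A + hausdorff_delta m d B <= hausdorff m (A `|` B))%E.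
  move=> d0 dc; apply/lee_addgt0Pr => e e0.
  have [F [r [ABF rd Fr Fe]]] := cover d e d0 e0.
  apply: le_trans Fe.
  (* Cover sets that meet [A] are charged to [A], the others to [B]; a radius 0 left behind
     contributes 0 as 0 < m. *)
  pose rA i := if pselect (F i `&` A !=set0) then r i else 0.
  pose rB i := if pselect (F i `&` A !=set0) then 0 else r i.
  have -> : (\sum_(0 <= i <oo) ((r i) ^+ m)%:E =
      \sum_(0 <= i <oo) ((rA i) ^+ m)%:E + \sum_(0 <= i <oo) ((rB i) ^+ m)%:E)%E.
    rewrite -nneseriesD.
    - apply: eq_eseriesr => i _; rewrite /rA /rB -EFinD.
      by case: pselect => /= _; rewrite expr0n eqn0Ngt m_gt0 ?addr0 ?add0r.
    - move=> i _ _; rewrite lee_fin exprn_ge0// /rA.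
      by case: pselect => //= _; case/andP: (rd i).
    - move=> i _ _; rewrite lee_fin exprn_ge0// /rB.
      by case: pselect => //= _; case/andP: (rd i).
  apply: leeD.
  - apply: (@delta_le A d (fun i => F i `&` [set x | F i `&` A !=set0]) rA d0).
    + move=> x Ax; have [i _ Fi] := ABF x (or_introl Ax).
      by exists i => //; split=> //; exists x.
    + move=> i; rewrite /rA; case: pselect => [_|_] /=; first exact: rd.
      by rewrite lexx ltW.
    + move=> i x y [Fx /= FA] [Fy _]; rewrite /rA; case: pselect => //= _.
      exact: Fr.
  - apply: (@delta_le B d (fun i => F i `&` [set x | ~ (F i `&` A !=set0)]) rB d0).
    + move=> x Bx; have [i _ Fi] := ABF x (or_intror Bx).
      exists i => //; split=> // -[a [Fa Aa]].
      have := Fr i _ _ Fa Fi; have := norm_le_enorm (a - x).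
      have := ABc _ _ Aa Bx; case/andP: (rd i) => _.
      by lra.
    + move=> i; rewrite /rB; case: pselect => [_|_] /=; last exact: rd.
      by rewrite lexx ltW.
    + move=> i x y [Fx /= FA] [Fy _]; rewrite /rB; case: pselect => //= _.
      exact: Fr.
have mono E (d d' : R) : d <= d' -> (@hausdorff_delta R n m d' E <= hausdorff_delta m d E)%E.
  move=> dd; apply: ereal_inf_le_tmp => _ [F [EF Fd] <-]; exists F => //.
  by split=> // i; rewrite (le_trans (Fd i))// lee_fin.
have h0 E : (0 <= @hausdorff R n m E)%E by exact: outer_measure_ge0.
have hABoo : hausdorff m (A `|` B) \is a fin_num by rewrite ge0_fin_numE.
have hd0 E (d : R) : (0 <= @hausdorff_delta R n m d E)%E.
  by apply: le_ereal_inf_tmp => _ [F _ <-]; apply: nneseries_ge0 => i _ _;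
    exact: hausdorff_weight_ge0.
(* The suprema over the two scales are taken one after the other; [mono] replaces both scales by the
   smaller one. *)
have B_le (d : R) : 0 < d -> d < c ->
    (hausdorff_delta m d A + hausdorff m B <= hausdorff m (A `|` B))%E.
  move=> d0 dc.
  have dAfin : hausdorff_delta m d A \is a fin_num.
    rewrite ge0_fin_numE//; apply: le_lt_trans ABoo; apply: le_trans (key d d0 dc).
    by rewrite leeDl.
  rewrite -leeBrDl//; apply: ge_ereal_sup => _ [d' /= d'0 <-].
  rewrite leeBrDl//; have [dd'|/ltW dd'] := leP d d'.
    by apply: le_trans (key d d0 dc); rewrite leeD2l// mono.
  apply: (le_trans _ (key d' d'0 (le_lt_trans dd' dc))).
  by rewrite leeD2r// mono.
have Bfin : hausdorff m B \is a fin_num.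
  by rewrite ge0_fin_numE//; apply: le_lt_trans ABoo; apply: le_outer_measure => x; right.
rewrite -leeBrDr//; apply: ge_ereal_sup => _ [d /= d0 <-].
rewrite leeBrDr//; have [dc|cd] := ltP d c; first exact: B_le.
apply: (le_trans _ (B_le (c / 2) _ _)); rewrite ?divr_gt0//; last by lra.
by rewrite leeD2r// mono//; lra.
Qed.

End hausdorff_maps.

(** * Balls, compactness and distance in row spaces *)

Section row_topology.
Context {R : realType} {n : nat}.
Implicit Types (A B C : set 'rV[R]_n) (x y : 'rV[R]_n).

Definition nball x (r : R) : set 'rV[R]_n := [set y | `|y - x| < r].

Lemma open_nballP A :
  open A <-> forall x, A x -> exists2 e, 0 < e & nball x e `<=` A.
Proof.
rewrite openE; split=> [oA x /oA|oA x /oA[e e0 eA]].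
  rewrite /interior => /nbhs_ballP[e /= e0 eA]; exists e => // y xy; apply: eA.
  by rewrite mx_norm_ball /ball_/= distrC.
apply/nbhs_ballP; exists e => // y; rewrite mx_norm_ball /ball_/= distrC.
exact: eA.
Qed.

Lemma closed_nballP A :
  closed A <-> forall x, (forall e, 0 < e -> exists2 y, A y & `|y - x| < e) -> A x.
Proof.
rewrite -openC open_nballP; split=> [cA x xA|cA x nAx].
  apply: contrapT => /cA[e e0 eA]; have [y Ay yx] := xA e e0.
  exact: eA Ay.
apply: contrapT => nA; apply/nAx/cA => e e0; apply: contrapT => ne; apply: nA.
by exists e => // y yx Ay; apply: ne; exists y.
Qed.

Lemma compact_row A (M : R) :
  closed A -> (forall x, A x -> `|x| <= M) -> compact A.
Proof.
move=> cA AM; apply: bounded_closed_compact => //.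
exists M; split; first exact: num_real.
by move=> N MN x /AM /le_trans; apply; exact: ltW.
Qed.

Lemma compact_row_closed A : compact A -> closed A.
Proof. by apply: compact_closed; exact: norm_hausdorff. Qed.

Lemma compact_row_bounded A : compact A -> exists2 M : R, 0 < M & forall x, A x -> `|x| <= M.
Proof.
move=> /compact_bounded[M [_ AM]].
exists (`|M| + 1); first by rewrite ltr_pwDr.
by move=> x Ax; apply: AM => //; rewrite ltr_pwDr// ler_norm.
Qed.

Lemma open_nball x (r : R) : open (nball x r).
Proof.
apply/open_nballP => y; rewrite /nball/= => yx.
exists (r - `|y - x|) => [|z]; first by rewrite subr_gt0.
rewrite /nball/= ltrBrDr; apply: le_lt_trans.
by rewrite (le_trans _ (ler_normD _ _))// addrA subrK.
Qed.

Lemma nball_center x (r : R) : 0 < r -> nball x r x.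
Proof. by move=> r0; rewrite /nball/= subrr normr0. Qed.

Lemma closed_norm_le x (r : R) : closed [set y | `|y - x| <= r].
Proof.
apply/closed_nballP => y yr; apply/ler_addgt0Pr => e e0.
have [z /= zr zy] := yr e e0.
by rewrite (le_trans (ler_distD z _ _))// addrC lerD// distrC ltW.
Qed.

Lemma finite_open_cover A (F : nat -> set 'rV[R]_n) : compact A ->
  (forall i, open (F i)) -> A `<=` \bigcup_i F i ->
  exists N, A `<=` \bigcup_(i in [set i | (i < N)%N]) F i.
Proof.
rewrite compact_cover => cA oF AF.
have [D _ AD] := cA nat setT F (fun i _ => oF i) AF.
exists (\max_(i <- finmap.enum_fset D) i).+1 => x /AD[i /= iD Fi]; exists i => //=.
by rewrite ltnS (@leq_bigmax_seq _ _ xpredT id)//.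
Qed.

Definition dist A x : R := inf [set `|x - c| | c in A].

Lemma dist_le A x c : A c -> dist A x <= `|x - c|.
Proof. by move=> Ac; apply: ge_inf; [exists 0 => _ [? _ <-]|exists c]. Qed.

Lemma le_dist A x (t : R) : A !=set0 -> (forall c, A c -> t <= `|x - c|) -> t <= dist A x.
Proof.
move=> [c Ac] At; apply: lb_le_inf; first by exists `|x - c|, c.
by move=> _ [d Ad <-]; exact: At.
Qed.

Lemma dist_lt A x (t : R) : A !=set0 -> dist A x < t -> exists2 c, A c & `|x - c| < t.
Proof.
move=> [c Ac] At; have hi : has_inf [set `|x - c| | c in A].
  by split; [exists `|x - c|, c|exists 0 => _ [? _ <-]].
have e0 : 0 < t - dist A x by rewrite subr_gt0.
have [_ [d Ad <-] dt] := @inf_adherent _ _ (t - dist A x) e0 hi.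
by exists d => //; apply: (lt_le_trans dt); rewrite /dist addrC subrK.
Qed.

Lemma dist_ge0 A x : 0 <= dist A x.
Proof.
have [[c Ac]|A0] := pselect (A !=set0); first by apply: le_dist => //; exists c.
suff -> : A = set0 by rewrite /dist image_set0 inf0.
by apply/seteqP; split=> // y Ay; apply: A0; exists y.
Qed.

Lemma dist_lip A x y : dist A x - dist A y <= `|x - y|.
Proof.
have [A0|A0] := pselect (A !=set0); last first.
  suff -> : A = set0 by rewrite /dist !image_set0 inf0 subrr.
  by apply/seteqP; split=> // z Az; apply: A0; exists z.
rewrite lerBlDr -lerBlDl; apply: le_dist => // c Ac.
rewrite lerBlDl; apply: (le_trans (dist_le _ Ac)).
by apply: (le_trans _ (ler_normD _ _)); rewrite addrA subrK.
Qed.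

Lemma dist_gt0 A x : closed A -> A !=set0 -> ~ A x -> 0 < dist A x.
Proof.
move=> cA A0 Ax; rewrite lt_neqAle dist_ge0 andbT eq_sym.
apply/eqP => d0; apply: Ax; move/closed_nballP : cA; apply => e e0.
have [|c Ac cx] := @dist_lt A x e A0; first by rewrite d0.
by exists c => //; rewrite distrC.
Qed.

End row_topology.

Lemma pow_near {R : realType} (m : nat) (r e d : R) : 0 < e -> 0 < d ->
  exists2 t, 0 < t <= d & (r + t) ^+ m <= r ^+ m + e.
Proof.
move=> e0 d0; have /cvgrPdist_le /(_ e e0) := @exprn_continuous R m r.
move=> [k /= k0 kP]; pose t := Num.min d (k / 2).
have t0 : 0 < t by rewrite lt_min d0 divr_gt0.
exists t; first by rewrite t0 ge_min lexx.
have := kP (r + t); rewrite /ball_/= opprD addNKr normrN gtr0_norm//.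
have -> : t < k by rewrite gt_min (ltr_pdivrMr _ _ _) // ltr_pMr// ltr1n orbT.
by move=> /(_ isT); rewrite ler_norml => /andP[+ _]; lra.
Qed.

Lemma cvge0_le {R : realType} (u : (\bar R)^nat) (e : R) :
  u n @[n --> \oo] --> 0%E -> 0 < e -> exists N, forall n, (N <= n)%N -> (u n <= e%:E)%E.
Proof.
move=> u0 e0; have [|N _ Nu] := u0 [set x | (x < e%:E)%E].
  by exists e => //= y /=; rewrite sub0r normrN lte_fin => /ltr_normlW.
by exists N => n Nn; apply/ltW/Nu.
Qed.

(** * Measurability and regularity of the Hausdorff measure *)

Section hausdorff_measurable.
Context {R : realType} (n m : nat) (m_gt0 : (0 < m)%N).
Local Notation H := (@hausdorff R n m).

Let shell_lt (i j : nat) : (i < j)%N -> (j.+1%:R^-1 : R) < i.+1%:R^-1.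
Proof. by move=> ij; rewrite ltf_pV2 ?posrE ?ltr0n// ltr_nat ltnS. Qed.

(** Caratheodory's shell argument. Shells [S i] of equal parity are separated because [phi] is
    1-Lipschitz, so their measures add up to at most [H X]. Hence the series over all shells
    converges, and the part of [X] where 0 < phi < 1/(N+1) has small measure. *)
Lemma sublevel_caratheodory (phi : 'rV[R]_n -> R) :
  (forall x y, phi x - phi y <= `|x - y|) ->
  H.-caratheodory [set x | phi x <= 0].
Proof.
move=> phi_lip; apply: le_caratheodory_measurable => X.
have [Xoo|] := ltP (H X) +oo%E; last by rewrite leye_eq => /eqP Xoo; rewrite [leRHS]Xoo leey.
have Xfin : H X \is a fin_num by rewrite ge0_fin_numE ?outer_measure_ge0.
pose S i := X `&` [set x | i.+2%:R^-1 <= phi x < i.+1%:R^-1].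
have Sparity p N : (\sum_(i < N) H (S (i.*2 + p)%N) <= H X)%E.
  have sep k A : A `<=` X `&` [set x | (k.+2)%:R^-1 <= phi x] ->
      (H A + H (S k.+2)%N <= H (A `|` S k.+2))%E.
    move=> AX; apply: (@hausdorff_separated _ _ m_gt0 _ _ _ (k.+2%:R^-1 - k.+3%:R^-1)).
      by rewrite subr_gt0 shell_lt.
    move=> a b /AX[_ /= ak] [_ /= /andP[_ bk]].
    by apply: (le_trans _ (phi_lip a b)); rewrite lerB// ltW.
  suff [] : (\sum_(i < N) H (S (i.*2 + p)%N) <=
      H (\big[setU/set0]_(i < N) S (i.*2 + p)%N))%E /\
      \big[setU/set0]_(i < N) S (i.*2 + p)%N `<=` X `&` [set x | ((N.*2 + p))%:R^-1 <= phi x].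
    by move=> /le_trans + h; apply; apply: le_outer_measure => x /h[].
  elim: N => [|N [IH1 IH2]].
    by rewrite !big_ord0; split=> //; rewrite outer_measure_ge0.
  rewrite !big_ord_recr /=; split.
    apply: (@le_trans _ _ (H (\big[setU/set0]_(i < N) S (i.*2 + p)%N) + H (S (N.*2 + p)%N))%E).
      by rewrite leeD2r.
    case: N IH1 IH2 => [|N] IH1 IH2; first by rewrite big_ord0 outer_measure0 add0e set0U.
    by rewrite (_ : N.+1.*2 + p = (N.*2 + p).+2)%N ?sep//; lia.
  move=> x [/[dup] xS /IH2[Xx /= Nx]|[Xx /= /andP[Nx _]]]; split=> //=.
  case: N {IH1 IH2} xS Nx => [|N] xS Nx; last first.
    by apply: le_trans Nx; rewrite lef_pV2 ?posrE ?ltr0n ?ler_nat//; lia.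
  by move: xS; rewrite big_ord0.
have Ssum : (\sum_(0 <= i <oo) H (S i) <= H X + H X)%E.
  apply: lime_le.
    by apply: is_cvg_nneseries => i _ _; exact: outer_measure_ge0.
  near=> N.
  apply: (@le_trans _ _ (\sum_(0 <= i < N.*2) H (S i))%E).
    rewrite [leRHS](@big_cat_nat _ _ _ N) //=; last lia.
    by rewrite leeDl// sume_ge0// => i _; exact: outer_measure_ge0.
  apply: (@le_trans _ _ (\sum_(i < N) H (S (i.*2 + 0)%N) + \sum_(i < N) H (S (i.*2 + 1)%N))%E);
    last exact: leeD.
  elim: (N) => [|k IH]; first by rewrite big_geq// !big_ord0 adde0.
  rewrite doubleS 2?big_nat_recr//= !big_ord_recr/= addn0 addn1.
  by rewrite -addeA (addeACA (\sum_(i < k) H (S (i.*2 + 0)%N))%E) leeD2r.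
have tail := @nneseries_tail_cvg R (fun i => H (S i)) xpredT _ (fun _ _ => outer_measure_ge0 _ _).
have {}tail := tail (le_lt_trans Ssum (lte_add_pinfty Xoo Xoo)).
apply/lee_addgt0Pr => e e0.
have [N /(_ N (leqnn N)) Ne] := cvge0_le tail e0.
have XN : X `&` ~` [set x | phi x <= 0] `<=`
    (X `&` [set x | N.+1%:R^-1 <= phi x]) `|` \bigcup_(i in ~` `I_N) S i.
  move=> x [Xx /= /negP]; rewrite -ltNge => px.
  have ex : exists i, i.+1%:R^-1 <= phi x.
    by have [k] := ltr_add_invr px; rewrite add0r => /ltW kx; exists k.
  have [i ix imin] := ex_minnP ex.
  have [iN|Ni] := leqP i N.
    left; split=> //=; apply: le_trans ix.
    by rewrite lef_pV2 ?posrE ?ltr0n// ler_nat ltnS.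
  right; case: i Ni ix imin => // i Ni ix imin.
  exists i => /=; first by apply/negP; rewrite -leqNgt.
  by split=> //=; rewrite ix ltNge; apply/negP => /imin; rewrite ltnn.
pose XE := X `&` [set x | phi x <= 0]; pose XF := X `&` [set x | N.+1%:R^-1 <= phi x].
have sep : (H XE + H XF <= H X)%E.
  apply: (@le_trans _ _ (H (XE `|` XF))).
    apply: (@hausdorff_separated _ _ m_gt0 _ _ _ N.+1%:R^-1); first by rewrite invr_gt0.
    move=> a b [_ /= a0] [_ /= b0]; rewrite distrC.
    by apply: (le_trans _ (phi_lip b a)); rewrite -[leLHS]subr0 lerB.
  by apply: le_outer_measure => x [[]|[]].
apply: (@le_trans _ _ (H XE + (H XF + e%:E))%E).
  rewrite leeD2l//; apply: (le_trans (le_outer_measure H _ _ XN)).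
  apply: (le_trans (outer_measureU2 _ _ _)); rewrite leeD2l//.
  by apply: le_trans Ne; exact: outer_measure_sigma_subadditive_tail.
by rewrite addeA leeD2r.
Unshelve. all: by end_near.
Qed.

Lemma closed_caratheodory (C : set 'rV[R]_n) : closed C -> H.-caratheodory C.
Proof.
move=> cC; have [C0|C0] := pselect (C !=set0); last first.
  suff -> : C = set0 by exact: caratheodory_measurable_set0.
  by apply/seteqP; split=> // x Cx; apply: C0; exists x.
suff -> : C = [set x | dist C x <= 0] by apply: sublevel_caratheodory; exact: dist_lip.
apply/seteqP; split=> x /= Cx.
  by apply: (le_trans (dist_le _ Cx)); rewrite subrr normr0.
by apply: contrapT => /(dist_gt0 cC C0); rewrite ltNge Cx.
Qed.

Lemma open_caratheodory (C : set 'rV[R]_n) : open C -> H.-caratheodory C.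
Proof.
rewrite -closedC => /closed_caratheodory/caratheodory_measurable_setC.
by rewrite setCK.
Qed.

Lemma caratheodory_bigcap (F : (set 'rV[R]_n)^nat) :
  (forall i, H.-caratheodory (F i)) -> H.-caratheodory (\bigcap_i F i).
Proof.
move=> mF; rewrite -[X in _ X]setCK setC_bigcap; apply: caratheodory_measurable_setC.
by apply: caratheodory_measurable_bigcup => i; exact: caratheodory_measurable_setC.
Qed.

Lemma hausdorff_disjoint_le (F : (set 'rV[R]_n)^nat) X :
  (forall i, H.-caratheodory (F i)) -> trivIset setT F ->
  (\sum_(0 <= i <oo) H (X `&` F i) <= H X)%E.
Proof.
move=> mF tF; apply: le_trans (caratheodory_lime_le mF tF X).
by rewrite leeDl// outer_measure_ge0.
Qed.

Definition hausdorff_outer : {outer_measure set 'rV[R]_n -> \bar R} := H.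

Definition hausdorff_measure :
  {measure set (caratheodory_type hausdorff_outer) -> \bar R} :=
  (hausdorff_outer : set (caratheodory_type hausdorff_outer) -> \bar R).

Lemma hausdorff_vanish (F : (set 'rV[R]_n)^nat) (e : R) :
  (forall i, H.-caratheodory (F i)) -> (H (F 0%N) < +oo)%E ->
  (forall i j, (i <= j)%N -> F j `<=` F i) -> \bigcap_i F i = set0 -> 0 < e ->
  exists N, forall i, (N <= i)%N -> (H (F i) <= e%:E)%E.
Proof.
move=> mF F0 dF F00 e0.
have := @nonincreasing_cvg_mu _ _ _ hausdorff_measure F F0 mF.
rewrite F00 measure0 => /(_ measurable0) h.
apply: cvge0_le e0; apply: h => i j ij.
by apply/subsetPset; exact: dF.
Qed.

(** The sets [E l i] (norm at most i, distance at least 1/(i+1) from the complement of [G l]) are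
    closed and increase to [G l]. Giving up measure e / 2^(l+1) at each level l leaves a compact set
    that misses at most e. *)
Lemma Gdelta_sigma_compact (C : set 'rV[R]_n) (G : (set 'rV[R]_n)^nat) :
  closed C -> (forall l, open (G l)) -> (H (C `&` \bigcap_l G l) < +oo)%E ->
  exists K : (set 'rV[R]_n)^nat,
    [/\ forall i, compact (K i), forall i j, (i <= j)%N -> K i `<=` K j,
        forall i, K i `<=` C `&` \bigcap_l G l &
        H ((C `&` \bigcap_l G l) `\` \bigcup_i K i) = 0%E].
Proof.
move=> cC oG; set B := C `&` _ => Boo.
have mB : H.-caratheodory B.
  apply: caratheodory_measurable_setI; first exact: closed_caratheodory.
  by apply: caratheodory_bigcap => l; exact: open_caratheodory.
pose E l i : set 'rV[R]_n :=
  [set x | `|x - 0| <= i%:R] `&` [set x | forall c, ~ G l c -> i.+1%:R^-1 <= `|x - c|].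
have cE l i : closed (E l i).
  apply: closedI; first exact: closed_norm_le.
  apply/closed_nballP => x xE c Gc /=; apply/ler_addgt0Pr => e e0.
  have [y yE yx] := xE e e0; apply: (le_trans (yE c Gc)).
  by rewrite (le_trans (ler_distD x _ _))// addrC lerD// ltW.
have small l (e : R) : 0 < e -> exists i, (H (B `\` E l i) <= e%:E)%E.
  move=> e0; have [||||N] := @hausdorff_vanish (fun i => B `\` E l i) e _ _ _ _ e0.
  - move=> i; apply: caratheodory_measurable_setD => //; exact: closed_caratheodory.
  - by apply: le_lt_trans Boo; apply: le_outer_measure => x [].
  - move=> i j ij x [Bx nE]; split=> // -[/= xi xG]; apply: nE; split => /=.
      by apply: (le_trans xi); rewrite ler_nat.
    move=> c Gc; apply: le_trans (xG c Gc).
    by rewrite lef_pV2 ?posrE ?ltr0n// ler_nat ltnS.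
  - apply/seteqP; split=> // x h.
    have Bx : B x by have [] := h 0%N I.
    have [e1 e10 eG] := (open_nballP (G l)).1 (oG l) x (Bx.2 l I).
    have [k] := ltr_add_invr e10; rewrite add0r => ke.
    have [N xN] : exists N : nat, `|x - 0| <= N%:R.
      by exists (Num.bound `|x - 0|); apply/ltW/archi_boundP.
    have [_] := h (maxn k N) I; apply; split=> /=.
      by apply: (le_trans xN); rewrite ler_nat leq_maxr.
    move=> c Gc; rewrite leNgt; apply/negP => xc; apply/Gc/eG.
    rewrite /nball/= distrC; apply: (lt_trans xc); apply: le_lt_trans ke.
    by rewrite lef_pV2 ?posrE ?ltr0n// ler_nat ltnS leq_maxl.
  - by move=> /(_ N (leqnn N)); exists N.
have K0 (e : R) : 0 < e -> exists K, [/\ compact K, K `<=` B & (H (B `\` K) <= e%:E)%E].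
  move=> e0; have e2 l : 0 < e / (2 ^ l.+1)%:R :> R by rewrite divr_gt0.
  have [i ie] := choice (fun l => small l _ (e2 l)).
  exists (C `&` \bigcap_l E l (i l)); split.
  - apply: (@compact_row _ _ _ (i 0%N)%:R).
      by apply: closedI => //; apply: closed_bigI => l _.
    by move=> x [_ /(_ 0%N I)[/=]]; rewrite subr0.
  - move=> x [Cx Ex]; split=> // l _; apply: contrapT => Gx.
    by have [_ /(_ x Gx)] := Ex l I; rewrite subrr normr0 leNgt invr_gt0 ltr0n.
  - apply: (@le_trans _ _ (\sum_(0 <= l <oo) H (B `\` E l (i l)))%E).
      apply: (le_trans _ (outer_measure_sigma_subadditive H _)).
      apply: le_outer_measure => x [Bx nK]; apply: contrapT => nU; apply: nK.
      split; first by case: Bx.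
      by move=> l _; apply: contrapT => nE; apply: nU; exists l.
    apply: (le_trans _ (epsilon_trick0 xpredT (ltW e0))).
    by apply: lee_nneseries => [l _ _|l _]; [exact: outer_measure_ge0|exact: ie].
have inv0 i : 0 < i.+1%:R^-1 :> R by rewrite invr_gt0.
have [K' K'P] := choice (fun i => K0 _ (inv0 i)).
exists (fun j => \big[setU/set0]_(i < j.+1) K' i); split.
- by move=> j; apply: bigsetU_compact => i _; case: (K'P i).
- by move=> i j ij; apply: subset_bigsetU.
- by move=> j x; rewrite -bigcup_mkord => -[i _]; case: (K'P i) => _ + _; apply.
- apply/le_anti; rewrite outer_measure_ge0 andbT; apply/lee_addgt0Pr => e e0.
  have [k] := ltr_add_invr e0; rewrite !add0r => /ltW ke.
  have [_ _ /le_trans h] := K'P k; apply: (le_trans _ (h e%:E _)); last by rewrite lee_fin.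
  apply: le_outer_measure => x [Bx nK]; split=> // Kx; apply: nK.
  by exists k => //; rewrite -bigcup_mkord; exists k => /=.
Qed.

Lemma open_coverP (E : set 'rV[R]_n) (d e : R) :
  (H E < +oo)%E -> 0 < d -> 0 < e ->
  exists F (r : nat -> R),
    [/\ E `<=` \bigcup_i F i, forall i, open (F i), forall i, 0 < r i <= d,
        forall i x y, F i x -> F i y -> enorm (x - y) <= r i &
        (\sum_(0 <= i <oo) ((r i) ^+ m)%:E <= H E + e%:E)%E].
Proof.
move=> Eoo d0 e0; have d2 : 0 < d / 2 by rewrite divr_gt0.
have e2 : 0 < e / 2 by rewrite divr_gt0.
have [F [r [EF rd Fr Fe]]] := hausdorff_coverP m_gt0 Eoo d2 e2.
have e2i i : 0 < (e / 2) / (2 ^ i.+1)%:R :> R by rewrite divr_gt0.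
have [t tP] : {t : nat -> R & forall i, 0 < t i <= d / 2 /\
    (r i + t i) ^+ m <= r i ^+ m + e / 2 / (2 ^ i.+1)%:R}.
  apply: (@choice _ _ (fun i s => 0 < s <= d / 2 /\
    (r i + s) ^+ m <= r i ^+ m + e / 2 / (2 ^ i.+1)%:R)) => i.
  by have [s] := pow_near m (r i) (e2i i) d2; exists s.
(* Fattening by [k i] in the sup norm adds at most [2 * n * k i] to a Euclidean diameter; [n + 1]
   keeps the denominator positive. *)
pose k i : R := t i / ((n%:R + 1) * 2).
have t0 i : 0 < t i by case: (tP i) => /andP[].
have N0 : 0 <= n%:R :> R by [].
have k0 i : 0 < k i by rewrite divr_gt0// mulr_gt0//; lra.
have kt i : n%:R * k i * 2 <= t i.
  have -> : t i = (n%:R + 1) * k i * 2 by rewrite /k; field; apply: lt0r_neq0; rewrite ltr_pwDr.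
  by have := k0 i; nra.
exists (fun i => [set x | exists2 y, F i y & nball y (k i) x]), (fun i => r i + t i); split.
- by move=> x /EF[i _ Fx]; exists i => //; exists x => //; exact: nball_center.
- move=> i; apply/open_nballP => x [y Fy /= yx].
  have [e1 e10 eb] := (open_nballP _).1 (@open_nball _ _ y (k i)) x yx.
  by exists e1 => // z /eb zy; exists y.
- move=> i; have /andP[r0 rd2] := rd i; have [/andP[_ td] _] := tP i.
  by apply/andP; split; have := t0 i; lra.
- move=> i x y [x' Fx xx'] [y' Fy yy'].
  have /= := xx'; have /= := yy'; move=> yk xk.
  have := Fr i _ _ Fx Fy; have := enormD (x - x') (x' - y').
  have := enormD (x - y') (y' - y).
  rewrite !addrA !subrK.
  have := enorm_le_norm (x - x'); have := enorm_le_norm (y' - y).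
  rewrite (distrC y') => h1 h2.
  have : n%:R * `|x - x'| <= n%:R * k i by rewrite ler_wpM2l// ltW.
  have : n%:R * `|y - y'| <= n%:R * k i by rewrite ler_wpM2l// ltW.
  by have := kt i; lra.
- apply: (@le_trans _ _ (\sum_(0 <= i <oo) ((r i ^+ m)%:E + (e / 2 / (2 ^ i.+1)%:R)%:E))%E).
    apply: lee_nneseries => [i _ _|i _].
      by rewrite lee_fin exprn_ge0// addr_ge0 ?(ltW (t0 _))//; case/andP: (rd i).
    by rewrite -EFinD lee_fin; case: (tP i).
  apply: (le_trans (epsilon_trick _ _ (ltW e2))).
    by move=> i; rewrite lee_fin exprn_ge0//; case/andP: (rd i).
  by rewrite {2}(splitr e) EFinD addeA leeD2r.
Qed.

(** [G l] is the union of an open cover of [E] of scale and excess 1/(l+1); each of these covers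
    also covers the intersection, which bounds its measure. *)
Lemma hausdorff_hull (E : set 'rV[R]_n) : (H E < +oo)%E ->
  exists G : (set 'rV[R]_n)^nat,
    [/\ forall l, open (G l), E `<=` \bigcap_l G l & H (\bigcap_l G l) = H E].
Proof.
move=> Eoo.
have inv0 i : 0 < i.+1%:R^-1 :> R by rewrite invr_gt0.
have [F FP] := choice (fun l => open_coverP Eoo (inv0 l) (inv0 l)).
exists (fun l => \bigcup_i F l i); split.
- by move=> l; apply: bigcup_open => i _; have [r []] := FP l.
- by move=> x Ex l _; have [r [EF _ _ _ _]] := FP l; exact: EF.
apply/le_anti/andP; split; last first.
  apply: le_outer_measure => x Ex l _; have [r [EF _ _ _ _]] := FP l; exact: EF.
apply/lee_addgt0Pr => e e0; apply: hausdorff_leP => d d0.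
have de0 : 0 < Num.min d e by rewrite lt_min d0.
have [l] := ltr_add_invr de0; rewrite add0r lt_min => /andP[ld le].
have [r [_ _ rl Fr rs]] := FP l.
exists (F l), r; split=> //.
- by move=> x /(_ l I).
- by move=> i; have /andP[r0 rd] := rl i; rewrite ltW//= (le_trans rd)// ltW.
- by apply: (le_trans rs); rewrite leeD2l// lee_fin ltW.
Qed.

End hausdorff_measurable.

(** * Measure of cubes up to constants *)

Section cube_measure.
Context {R : realType} (m : nat) (m_gt0 : (0 < m)%N).
Local Notation L := (@hausdorff R m m).

Lemma grid_cell (w l : R) (N : nat) : (0 < N)%N -> 0 < l -> 0 <= w <= l ->
  exists k : 'I_N, k%:R * (l / N%:R) <= w <= (k%:R + 1) * (l / N%:R).
Proof.
move=> N0 l0 /andP[w0 wl]; have NR : 0 < N%:R :> R by rewrite ltr0n.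
have lN : 0 < l / N%:R by rewrite divr_gt0.
have v0 : 0 <= w / (l / N%:R) by rewrite divr_ge0// ltW.
have /andP[kv vk] := Num.Theory.truncn_itv v0.
set k := Num.truncn _ in kv vk.
have kw : k%:R * (l / N%:R) <= w by rewrite -ler_pdivlMr.
have wk : w <= (k%:R + 1) * (l / N%:R) by rewrite -ler_pdivrMr// -natr1 in vk *; exact: ltW.
have [kN|Nk] := ltnP k N; first by exists (Ordinal kN); rewrite kw wk.
have N1 : (N.-1 < N)%N by rewrite prednK.
exists (Ordinal N1) => /=; apply/andP; split.
  apply: le_trans kw; rewrite ler_wpM2r ?(ltW lN)// ler_nat.
  by rewrite (leq_trans (leq_pred _)).
by rewrite natr1 prednK// mulrC divfK ?gt_eqF.
Qed.

(** N^m cells of side 2r/N have Euclidean diameter at most m * 2r/N, and N cancels in the sum of the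
    m-th powers. *)
Lemma cube_ub (x : 'rV[R]_m) (r : R) : 0 < r ->
  (L [set y | (`|y - x| <= r)%R] <= ((2 * m%:R * r) ^+ m)%:E)%E.
Proof.
move=> r0; apply: hausdorff_leP => d d0.
have mR : 0 < m%:R :> R by rewrite ltr0n.
have [N N0 Nd] : exists2 N, (0 < N)%N & m%:R * (2 * r / N%:R) <= d.
  exists (Num.bound (m%:R * 2 * r / d)).+1 => //.
  have : m%:R * 2 * r / d < (Num.bound (m%:R * 2 * r / d)).+1%:R.
    rewrite (lt_trans (archi_boundP _))// ?ltr_nat//.
    by rewrite !mulr_ge0 ?invr_ge0 ?(ltW d0) ?(ltW r0).
  set B : R := _.+1%:R; rewrite ltr_pdivrMr// => h.
  have B0 : 0 < B by rewrite ltr0n.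
  by rewrite !mulrA ler_pdivrMr// (mulrC d); exact: ltW.
pose T := {ffun 'I_m -> 'I_N}.
pose l := 2 * r / N%:R.
have l0 : 0 < l by rewrite divr_gt0 ?mulr_gt0 ?ltr0n.
pose cell (g : T) := [set y : 'rV[R]_m |
  forall j, (g j)%:R * l <= y ord0 j - x ord0 j + r <= ((g j)%:R + 1) * l].
exists (fun i => if (insub i : option 'I_#|T|) is Some k then cell (enum_val k) else set0).
exists (fun i => if (i < #|T|)%N then m%:R * l else 0); split.
- move=> y /= yr.
  have H j : exists k : 'I_N, k%:R * l <= y ord0 j - x ord0 j + r <= (k%:R + 1) * l.
    apply: grid_cell => //; first by rewrite mulr_gt0.
    have := coord_le_norm (y - x) j; rewrite !mxE => /le_trans/(_ yr).
    by rewrite ler_norml => /andP[]; lra.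
  have [g gP] := choice H; pose G : T := [ffun j => g j].
  exists (enum_rank G) => //=; rewrite valK enum_rankK => j; rewrite ffunE.
  exact: gP.
- by move=> i; case: ifP => _; rewrite ?lexx ?(ltW d0)// mulr_ge0 ?(ltW l0).
- move=> i y z; case: insubP => //= k ik _; rewrite ik => yc zc.
  apply: (le_trans (enorm_le_norm _)); rewrite ler_wpM2l//.
  apply: row_norm_le; first exact: ltW.
  move=> j; rewrite !mxE ler_norml; have := yc j; have := zc j.
  by move=> /andP[? ?] /andP[? ?]; lra.
- rewrite (nneseries_split _ #|T|) => [|i _]; last first.
    by rewrite lee_fin exprn_ge0//; case: ifP => _ //; rewrite mulr_ge0 ?(ltW l0).
  rewrite [X in (_ + X)%E]eseries0 => [|i iT _]; last first.
    by rewrite add0n in iT; rewrite ltnNge iT/= expr0n eqn0Ngt m_gt0.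
  rewrite adde0 add0n sumEFin lee_fin.
  rewrite (@eq_big_nat _ _ _ _ _ _ (fun=> (m%:R * l) ^+ m)); last first.
    by move=> i /andP[_ ->].
  rewrite big_const_nat subn0 iter_addr addr0 card_ffun !card_ord.
  rewrite -[leLHS]mulr_natl natrX -exprMn le_eqVlt; apply/orP; left; apply/eqP; congr (_ ^+ _).
  by rewrite /l; field; rewrite pnatr_eq0 -lt0n.
Qed.

Let count_near (N : nat) (h : nat) (b : nat) (A : {pred 'I_N}) :
  (forall k, k \in A -> (k <= h + b)%N /\ (h <= k + b)%N) -> (#|A| <= (2 * b).+1)%N.
Proof.
move=> Ah; rewrite cardE -(size_map val).
rewrite -(size_iota (h - b) (2 * b).+1); apply: uniq_leq_size.
  by rewrite map_inj_uniq ?enum_uniq//; exact: val_inj.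
move=> _ /mapP[k kA ->]; rewrite mem_enum in kA; have [kh hk] := Ah _ kA.
rewrite mem_iota /=.
by apply/andP; split; lia.
Qed.

(** Positivity by counting. By compactness finitely many sets of a cover suffice; take a grid of
    step l = 2r/N below all their diameters. A set of diameter rho contains at most (2b+1)^m grid
    points with b the integer part of rho/l, and 2b+1 <= 3 rho/l because rho/l >= 1. All N^m points
    must be reached. *)
Lemma cube_lb (x : 'rV[R]_m) (r : R) : 0 < r ->
  (((2 * r / 3) ^+ m)%:E <= L [set y | (`|y - x| <= r)%R])%E.
Proof.
move=> r0; set Q := [set y | _].
have Qoo : (L Q < +oo)%E := le_lt_trans (cube_ub x r0) (ltry _).
apply/lee_addgt0Pr => e e0.
have [F [rho [QF oF rho1 Fr Fe]]] := open_coverP m_gt0 Qoo ltr01 e0.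
have cQ : compact Q.
  apply: (@compact_row _ _ _ (`|x| + r)); first exact: closed_norm_le.
  move=> y yr; have := ler_normD (y - x) x; rewrite subrK => /le_trans; apply.
  by rewrite addrC lerD2l.
have [n0 QF0] := finite_open_cover cQ oF QF.
have rho0 i : 0 < rho i by case/andP: (rho1 i).
have [N N0 Nrho] : exists2 N, (0 < N)%N & forall i, (i < n0)%N -> 2 * r / N%:R <= rho i.
  elim: n0 {QF0} => [|k [N N0 IH]]; first by exists 1%N.
  pose M := (Num.bound (2 * r / rho k)).+1.
  exists (maxn N M); first by rewrite leq_max N0.
  have mono a b c : (0 < a)%N -> (a <= b)%N -> 2 * r / a%:R <= c -> 2 * r / b%:R <= c.
    move=> a0 ab; apply: le_trans; rewrite ler_wpM2l ?mulr_ge0 ?(ltW r0)//.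
    by rewrite lef_pV2 ?posrE ?ltr0n ?ler_nat// (leq_trans a0).
  move=> i; rewrite ltnS leq_eqVlt => /predU1P[->|ik].
    apply: (@mono M) => //; first exact: leq_maxr.
    have : 2 * r / rho k < M%:R.
      rewrite (lt_trans (archi_boundP _))// ?ltr_nat//.
      by rewrite divr_ge0 ?mulr_ge0 ?(ltW r0) ?(ltW (rho0 _)).
    rewrite ltr_pdivrMr// => h; rewrite ler_pdivrMr ?ltr0n//.
    by rewrite (mulrC (rho k)); exact: ltW.
  by apply: (@mono N) => //; [exact: leq_maxl|exact: IH].
pose T := {ffun 'I_m -> 'I_N}.
pose l := 2 * r / N%:R.
have l0 : 0 < l by rewrite divr_gt0 ?mulr_gt0 ?ltr0n.
pose pt (g : T) : 'rV[R]_m := \row_j (x ord0 j - r + (g j)%:R * l).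
have ptQ g : Q (pt g).
  apply: row_norm_le; first exact: ltW.
  move=> j; rewrite !mxE.
  have : (g j)%:R * l <= 2 * r.
    rewrite /l mulrCA ler_piMr ?mulr_ge0 ?(ltW r0)//.
    by rewrite ler_pdivrMr ?ltr0n// mul1r ler_nat ltnW.
  have : 0 <= (g j)%:R * l by rewrite mulr_ge0 ?(ltW l0).
  by rewrite ler_norml => ? ?; apply/andP; split; lra.
pose S i := [set g : T | pt g \in F i]%SET.
have TS : [set: T]%SET \subset (\bigcup_(i < n0) S i)%SET.
  apply/fintype.subsetP => g _; have [i /= i0 Fi] := QF0 _ (ptQ g).
  by apply/finset.bigcupP; exists (Ordinal i0) => //; rewrite inE/= mem_set.
have Scard i : (i < n0)%N -> (#|S i|)%:R <= (3 * (rho i / l)) ^+ m :> R.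
  move=> i0; have [S0|[h hS]] := finset.set_0Vmem (S i).
    by rewrite S0 cards0 exprn_ge0// mulr_ge0// divr_ge0 ?ltW.
  pose a := rho i / l; pose b := Num.truncn a.
  have a1 : 1 <= a by rewrite ler_pdivlMr// mul1r; exact: Nrho.
  have a0 : 0 <= a by lra.
  have /andP[ba ab] := Num.Theory.truncn_itv a0.
  pose fam j := [pred k : 'I_N | (k <= h j + b)%N && (h j <= k + b)%N].
  have Sfam : (#|S i| <= #|family fam|)%N.
    apply: subset_leq_card; apply/fintype.subsetP => g; rewrite !inE => gF.
    apply/familyP => j; rewrite inE.
    have := hS; rewrite !inE => hF.
    have := Fr i _ _ gF hF.
    move=> /(le_trans (norm_le_enorm _))/(le_trans (coord_le_norm _ j)).
    rewrite !mxE.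
    have -> : x ord0 j - r + (g j)%:R * l - (x ord0 j - r + (h j)%:R * l) =
      ((g j)%:R - (h j)%:R) * l by ring.
    rewrite normrM (gtr0_norm l0) -ler_pdivlMr// -/a ler_norml => /andP[h1 h2].
    have e1 : (g j)%:R < (h j)%:R + b.+1%:R :> R by lra.
    have e2 : (h j)%:R < (g j)%:R + b.+1%:R :> R by lra.
    by move: e1 e2; rewrite -!natrD !ltr_nat !addnS !ltnS => -> ->.
  apply: (@le_trans _ _ (((2 * b).+1 ^ m)%N%:R)).
    rewrite ler_nat (leq_trans Sfam)// card_family.
    have -> : ((2 * b).+1 ^ m = foldr muln 1 [seq (2 * b).+1 | j : 'I_m])%N.
      rewrite /image_mem -{1}(card_ord m) cardE; elim: (enum _) => //= ? s <-.
      by rewrite expnS.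
    rewrite /image_mem; elim: (enum _) => //= j s IH; apply: leq_mul => //.
    by apply: (@count_near _ (h j)) => k /andP[].
  rewrite natrX lerXn2r ?nnegrE ?mulr_ge0 ?invr_ge0 ?(ltW l0) ?(ltW (rho0 _))//.
  by rewrite -natr1 natrM -/a; lra.
have key : (N ^ m)%:R <= \sum_(i < n0) (3 * (rho i / l)) ^+ m :> R.
  have -> : (N ^ m = #|[set: T]%SET|)%N by rewrite cardsT card_ffun !card_ord.
  apply: (@le_trans _ _ (\sum_(i < n0) #|S i|)%:R).
    rewrite ler_nat; apply: (leq_trans (subset_leq_card TS)).
    elim/big_ind2 : _ => [|A a B b h1 h2|//]; first by rewrite cards0.
    by rewrite (leq_trans (leq_card_setU _ _))// leq_add.
  by rewrite natr_sum ler_sum// => i _; exact: Scard.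
have {}key : (2 * r / 3) ^+ m <= \sum_(i < n0) rho i ^+ m.
  have l3 : 0 < (3 / l) ^+ m by rewrite exprn_gt0// divr_gt0.
  rewrite -(ler_pM2r l3) -exprMn mulr_suml.
  have -> : 2 * r / 3 * (3 / l) = N%:R.
    by rewrite /l; field; rewrite ?(gt_eqF r0) ?pnatr_eq0 -?lt0n ?N0.
  rewrite -natrX; apply: (le_trans key); apply: ler_sum => i _.
  by rewrite -exprMn (_ : rho i * (3 / l) = 3 * (rho i / l))//; ring.
apply: le_trans Fe; apply: (@le_trans _ _ (\sum_(i < n0) (rho i ^+ m)%:E)%E).
  by rewrite sumEFin lee_fin.
rewrite -(big_mkord xpredT (fun i => (rho i ^+ m)%:E)).
by apply: nneseries_lim_ge => i _ _; rewrite lee_fin exprn_ge0 ?(ltW (rho0 _)).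
Qed.

End cube_measure.

(** * Coverings and extensions *)

Lemma row_norm_lt {R : realType} n (x : 'rV[R]_n) (c : R) :
  0 < c -> (forall i, `|x ord0 i| < c) -> `|x| < c.
Proof.
move=> c0 xc; rewrite /Num.norm/= mx_normrE; apply: bigmax_lt => // -[i j] _ /=.
by rewrite ord1.
Qed.

Lemma rational_row {R : realType} n (x : 'rV[R]_n) (r : R) : 0 < r ->
  exists v : 'rV[rat]_n, `|map_mx ratr v - x| < r.
Proof.
move=> r0.
have H j : exists q : rat, `|ratr q - x ord0 j| < r.
  have lt : x ord0 j - r < x ord0 j + r by lra.
  have [q] := rat_in_itvoo lt; rewrite in_itv/= => /andP[q1 q2].
  by exists q; rewrite ltr_norml; apply/andP; split; lra.
have [q qP] := choice H; exists (\row_j q j).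
by apply: row_norm_lt => // j; rewrite !mxE.
Qed.

(** * Vitali coverings *)

Section vitali_covering.
Context {R : realType} (n : nat).
Variables (V : set 'rV[R]_n) (r : 'rV[R]_n -> R) (M : R).
Hypothesis rV : forall x, V x -> 0 < r x <= M.

Let meet x y := nball x (r x) `&` nball y (r y) !=set0.

(** Zorn's lemma is applied to disjoint families such that a ball meeting some member meets one of
    at least half its own radius. A maximal family meets every ball: otherwise one could add a
    missed ball whose radius exceeds half the supremum of the radii of missed balls. *)
Let disjoint_family : exists D : set 'rV[R]_n, [/\ D `<=` V,
  forall x y, D x -> D y -> meet x y -> x = y &
  forall x, V x -> exists2 y, D y & meet x y /\ r x <= 2 * r y].
Proof.
pose P (D : set 'rV[R]_n) := [/\ D `<=` V,
  forall x y, D x -> D y -> meet x y -> x = y &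
  forall x, V x -> (exists2 y, D y & meet x y) -> exists2 y, D y & meet x y /\ r x <= 2 * r y].
have [F FP Ftot|D [[DV Ddisj Dstar] Dmax]] := @Zorn_bigcup _ P.
  split.
  - by move=> x [A FA Ax]; have [AV _ _] := FP _ FA; exact: AV.
  - move=> x y [A FA Ax] [B FB By].
    have [AB|BA] := Ftot A B FA FB.
      by have [_ + _] := FP _ FB; apply=> //; exact: AB.
    by have [_ + _] := FP _ FA; apply=> //; exact: BA.
  - move=> x Vx [y [A FA Ay] xy]; have [_ _ As] := FP _ FA.
    have [z Az [xz rz]] := As x Vx (ex_intro2 _ _ y Ay xy).
    by exists z => //; exists A.
exists D; split=> // x Vx; apply: (Dstar) => //; apply: contrapT => xD.
pose W := [set x | V x /\ ~ exists2 y, D y & meet x y].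
have Wx : W x by [].
have hs : has_sup (r @` W).
  split; first by exists (r x), x.
  by exists M => _ [y [Vy _] <-]; have /andP[] := rV Vy.
have rx0 : 0 < r x by have /andP[] := rV Vx.
have s0 : 0 < sup (r @` W).
  by apply: (lt_le_trans rx0); apply: ub_le_sup; [exact: hs.2|exists x].
have [_ [x0 Wx0 <-] x0s] := sup_adherent (divr_gt0 s0 (ltr0Sn R 1)) hs.
have [Vx0 nx0] := Wx0.
have meetC a b : meet a b -> meet b a by move=> [z [? ?]]; exists z.
apply: (Dmax (D `|` [set x0])).
  split; first by move=> y; left.
  move=> /(_ x0 (or_intror erefl)) Dx0; apply: nx0; exists x0 => //.
  by exists x0; split; apply: nball_center; have /andP[] := rV Vx0.
split.
- by move=> y [/DV//|->].
- move=> y z [Dy|->] [Dz|->] // yz; first exact: Ddisj.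
    by exfalso; apply: nx0; exists y => //; exact: meetC.
  by exfalso; apply: nx0; exists z.
- move=> y Vy yB; have [/(Dstar _ Vy)[w Dw yw]|yD] := pselect (exists2 w, D w & meet y w).
    by exists w => //; left.
  have {yB} yx0 : meet y x0.
    by case: yB => z [Dz|->//] yz; exfalso; apply: yD; exists z.
  exists x0; first by right.
  split=> //; have : r y <= sup (r @` W) by apply: ub_le_sup; [exact: hs.2|exists y].
  by lra.
Qed.

(** Disjoint balls contain distinct rational points, whose codes index them by [nat]; an index
    without a ball gets radius 0, that is, the empty ball. The constant is 5 because a ball of
    radius r x meeting one of radius r y, with r x <= 2 r y, stays within 2 r x + r y <= 5 r y of
    its centre. *)
Lemma vitali_covering : exists (c : nat -> 'rV[R]_n) (rho : nat -> R),
  [/\ forall i, 0 <= rho i /\ (0 < rho i -> V (c i) /\ rho i = r (c i)),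
      trivIset setT (fun i => nball (c i) (rho i)) &
      forall x, V x -> exists i, 0 < rho i /\ nball x (r x) `<=` nball (c i) (5 * rho i)].
Proof.
have [D [DV Ddisj Dcov]] := disjoint_family.
have H x : exists q : 'rV[rat]_n, D x -> `|map_mx ratr q - x| < r x.
  have [/[dup] Dx /DV/rV/andP[rx _]|nDx] := pselect (D x); last by exists 0.
  by have [q qx] := rational_row x rx; exists q.
have [q qP] := choice H.
have qinj x y : D x -> D y -> pickle (q x) = pickle (q y) -> x = y.
  move=> Dx Dy /(pcan_inj pickleK) xy; apply: Ddisj => //.
  exists (map_mx ratr (q x)); split; first exact: qP.
  by rewrite xy; exact: qP.
pose code i := [set x | D x /\ pickle (q x) = i].
have codeP i x : code i x -> xget 0 (code i) = x.
  move=> [Dx xi]; have [Dz zi] := @xgetI _ 0 (code i) x (conj Dx xi).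
  by apply: qinj => //; rewrite zi xi.
pose rho i := if pselect (code i !=set0) then r (xget 0 (code i)) else 0.
exists (fun i => xget 0 (code i)), rho; split.
- move=> i; rewrite /rho; case: pselect => [[x xi]|_] /=; last by rewrite ltxx.
  rewrite (codeP _ _ xi); have [Dx _] := xi.
  by have /andP[r0 _] := rV (DV _ Dx); rewrite ltW//; split=> // _; split=> //; exact: DV.
- move=> i j _ _ [z [/= zi zj]]; move: zi zj; rewrite /rho /nball/=.
  case: pselect => [[x xi]|_] /=; last by rewrite ltNge normr_ge0.
  case: pselect => [[y yj]|_] /=; last by move=> _; rewrite ltNge normr_ge0.
  rewrite (codeP _ _ xi) (codeP _ _ yj) => zx zy.
  have xy : x = y by apply: Ddisj; [case: xi|case: yj|exists z].
  by case: xi => _ <-; case: yj => _ <-; rewrite xy.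
- move=> x Vx; have [y Dy [[z [zx zy]] rxy]] := Dcov x Vx.
  have yc : code (pickle (q y)) y by [].
  exists (pickle (q y)); rewrite /rho; case: pselect => [_|[]] /=; last by exists y.
  rewrite (codeP _ _ yc); have /andP[r0 _] := rV (DV _ Dy).
  split=> // w; move: zx zy; rewrite /nball/= => zx zy wx.
  have := ler_distD x w y; have := ler_distD z x y; rewrite (distrC x z).
  by lra.
Qed.

End vitali_covering.

Section lipschitz_extension.
Context {R : realType}.

Lemma mcshane p (A : set 'rV[R]_p) (f : 'rV[R]_p -> R) (C : R) : 0 <= C ->
  (forall x y, A x -> A y -> `|f x - f y| <= C * `|x - y|) ->
  exists g : 'rV[R]_p -> R, (forall x y, `|g x - g y| <= C * `|x - y|) /\
    forall x, A x -> g x = f x.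
Proof.
move=> C0 fA; have [[a0 Aa0]|A0] := pselect (A !=set0); last first.
  exists (fun=> 0); split=> [x y|x Ax]; first by rewrite subrr normr0 mulr_ge0.
  by exfalso; apply: A0; exists x.
(* McShane's formula: the infimum of these upper bounds is the largest C-Lipschitz extension. *)
pose S x := [set f a + C * `|x - a| | a in A].
have S0 x : S x !=set0 by exists (f a0 + C * `|x - a0|), a0.
have lbS x : has_lbound (S x).
  exists (f a0 - C * `|x - a0|) => _ [a Aa <-].
  have := fA _ _ Aa0 Aa; rewrite ler_norml => /andP[_].
  have := ler_distD x a0 a; rewrite (distrC a0 x) => h1 h2.
  have : C * `|a0 - a| <= C * (`|x - a0| + `|x - a|) by rewrite ler_wpM2l.
  by lra.
have gle x y : inf (S x) <= inf (S y) + C * `|x - y|.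
  rewrite -lerBlDr; apply: lb_le_inf => // _ [a Aa <-].
  rewrite lerBlDr; apply: (@le_trans _ _ (f a + C * `|x - a|)).
    by apply: ge_inf => //; exists a.
  rewrite -addrA lerD2l -mulrDr ler_wpM2l//.
  by rewrite (le_trans (ler_distD y _ _))// addrC.
exists (fun x => inf (S x)); split=> [x y|x Ax].
  by rewrite ler_distl; have := gle x y; have := gle y x; rewrite (distrC y x) => ? ?;
    apply/andP; split; lra.
apply/le_anti/andP; split.
  apply: (@le_trans _ _ (f x + C * `|x - x|)); last by rewrite subrr normr0 mulr0 addr0.
  by apply: ge_inf => //; exists x.
apply: lb_le_inf => // _ [a Aa <-].
by have := fA _ _ Ax Aa; rewrite ler_norml => /andP[_]; lra.
Qed.

Lemma lipschitz_extension p n (A : set 'rV[R]_p) (f : 'rV[R]_p -> 'rV[R]_n) (C : R) :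
  0 <= C -> (forall x y, A x -> A y -> `|f x - f y| <= C * `|x - y|) ->
  exists g : 'rV[R]_p -> 'rV[R]_n, (forall x y, `|g x - g y| <= C * `|x - y|) /\
    forall x, A x -> g x = f x.
Proof.
move=> C0 fA.
have H j : exists g : 'rV[R]_p -> R, (forall x y, `|g x - g y| <= C * `|x - y|) /\
    forall x, A x -> g x = f x ord0 j.
  apply: mcshane => // x y Ax Ay; apply: le_trans (fA x y Ax Ay).
  by have := coord_le_norm (f x - f y) j; rewrite !mxE.
have [g gP] := choice H; exists (fun x => \row_j g j x); split=> [x y|x Ax].
  apply: row_norm_le; first by rewrite mulr_ge0.
  by move=> j; rewrite !mxE; exact: (gP j).1.
by apply/rowP => j; rewrite !mxE; exact: (gP j).2.
Qed.

Lemma lipschitz_continuous_row p n (f : 'rV[R]_p -> 'rV[R]_n) (C : R) :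
  (forall x y, `|f x - f y| <= C * `|x - y|) -> continuous f.
Proof.
move=> fC x B /nbhs_ballP[e /= e0 eB].
have K0 : 0 < `|C| + 1 by rewrite ltr_wpDl.
apply/nbhs_ballP; exists (e / (`|C| + 1)) => [|y]; first by rewrite /= divr_gt0.
rewrite mx_norm_ball /ball_/= ltr_pdivlMr// mulrC => xy; apply: eB.
rewrite mx_norm_ball /ball_/=; apply: le_lt_trans xy.
apply: (le_trans (fC x y)); rewrite ler_wpM2r//.
by rewrite (le_trans (ler_norm _))// lerDl.
Qed.

End lipschitz_extension.

(** * Replacement of the given set by a sigma-compact one *)

Section unrectifiable_reduction.
Context {R : realType} (m n : nat) (m_gt0 : (0 < m)%N).
Local Notation H := (@hausdorff R n m).

(* Purely unrectifiable in the only form that is used: graphs over R^m are null. *)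
Definition graph_null (K : set 'rV[R]_n) : Prop :=
  forall A (P : 'rV[R]_n -> 'rV[R]_m) (C : R), A `<=` K ->
    (forall x y, A x -> A y -> `|x - y| <= C * `|P x - P y|) -> H A = 0%E.

(** The range is a countable union of compact sets, the images of closed balls. *)
Lemma range_lipschitz_closed (g : 'rV[R]_m -> 'rV[R]_n) (C : R) :
  (forall x y, `|g x - g y| <= C * `|x - y|) -> H.-caratheodory (range g).
Proof.
move=> gC; have -> : range g = \bigcup_k (g @` [set x | `|x - 0| <= k%:R]).
  apply/seteqP; split=> [_ [x _ <-]|_ [k _ [x _ <-]]]; last by exists x.
  exists (Num.bound `|x - 0|) => //; exists x => //=.
  exact/ltW/archi_boundP.
apply: caratheodory_measurable_bigcup => k; apply: closed_caratheodory => //.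
apply: compact_row_closed; apply: continuous_compact.
  exact/continuous_subspaceT/(lipschitz_continuous_row gC).
apply: (@compact_row _ _ _ k%:R); first exact: closed_norm_le.
by move=> x /=; rewrite subr0.
Qed.

(** [S] need not be measurable, so pure unrectifiability is transferred to a G_delta hull [B] with H
    B = H S. For a Lipschitz [g] on R^m, [S] meets the measurable set [range g] in a null set, so H
    B = H S is at most the measure of [B] outside [range g]; by additivity and finiteness [B] meets
    the range in a null set too. *)
Lemma unrectifiable_sigma_compact (S U : set 'rV[R]_n) :
  open U -> S `<=` U -> purely_unrectifiable m S -> (H S < +oo)%E ->
  exists K : (set 'rV[R]_n)^nat,
    [/\ forall i, compact (K i), forall i j, (i <= j)%N -> K i `<=` K j,
        \bigcup_i K i `<=` U, (H (\bigcup_i K i) < +oo)%E &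
        graph_null (\bigcup_i K i) /\ H (S `\` \bigcup_i K i) = 0%E].
Proof.
move=> oU SU puS Soo.
have [G [oG SG HG]] := hausdorff_hull m_gt0 Soo.
(* [U] is put in front of the hull, so that the compact sets stay inside [U]. *)
pose G' l := if l is l'.+1 then G l' else U.
have oG' l : open (G' l) by case: l => [|l] //=.
pose B := setT `&` \bigcap_l G' l.
have SB : S `<=` B.
  by move=> x Sx; split=> // -[_|l _] /=; [exact: SU|exact: SG].
have BG : B `<=` \bigcap_l G l by move=> x [_ Bx] l _; exact: (Bx l.+1 I).
have HB : H B = H S.
  apply/le_anti/andP; split; last exact: le_outer_measure.
  by rewrite -HG; apply: le_outer_measure.
have Boo : (H B < +oo)%E by rewrite HB.
have [K [cK Kincr KB BK]] := Gdelta_sigma_compact m_gt0 closedT oG' Boo.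
have KB' : \bigcup_i K i `<=` B by move=> x [i _ /KB].
have KU : \bigcup_i K i `<=` U by move=> x /KB'[_ /(_ 0%N I)].
exists K; split=> //.
  by apply: le_lt_trans Boo; exact: le_outer_measure.
split; last first.
  apply/le_anti; rewrite outer_measure_ge0 andbT -BK.
  by apply: le_outer_measure => x [/SB].
move=> A P C AK APC.
(* The hypothesis makes [P] injective on [A]; its inverse is Lipschitz on the image and extends to
   R^m. *)
pose f u := xget (0 : 'rV[R]_n) [set x | A x /\ P x = u].
have fP x : A x -> A (f (P x)) /\ P (f (P x)) = P x.
  by move=> Ax; apply: (@xgetI _ 0 [set y | A y /\ P y = P x] x).
have fK x : A x -> f (P x) = x.
  move=> Ax; have [Af Pf] := fP x Ax; apply/eqP; rewrite -subr_eq0 -normr_le0.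
  by apply: (le_trans (APC _ _ Af Ax)); rewrite Pf subrr normr0 mulr0.
have C'0 : 0 <= `|C| by [].
have [|g [gC gf]] := @lipschitz_extension R m n (P @` A) f `|C| C'0.
  move=> _ _ [x Ax <-] [y Ay <-]; rewrite !fK//.
  by apply: (le_trans (APC _ _ Ax Ay)); rewrite ler_wpM2r// ler_norm.
have Ag : A `<=` range g by move=> x Ax; exists (P x) => //; rewrite gf ?fK//; exists x.
have mE := range_lipschitz_closed gC.
have SE0 : H (S `&` range g) = 0%E.
  apply: puS; exists (fun=> g); split.
    move=> _; exists (n%:R * `|C|) => x y.
    apply: (le_trans (enorm_le_norm _)); rewrite -mulrA ler_wpM2l//.
    by apply: (le_trans (gC x y)); rewrite ler_wpM2l// norm_le_enorm.
  rewrite (_ : _ `\` _ = set0) ?outer_measure0//.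
  by apply/seteqP; split=> // x [gx]; apply; exists 0%N.
have HSE : (H S <= H (S `&` ~` range g))%E.
  by rewrite [leLHS](mE S) SE0 add0e.
have : H (B `&` range g) = 0%E.
  apply/le_anti; rewrite outer_measure_ge0 andbT.
  have Bfin : H B \is a fin_num by rewrite ge0_fin_numE// outer_measure_ge0.
  rewrite -(leeD2rE _ _ Bfin) add0e [leRHS](mE B) leeD2l// HB.
  apply: (le_trans HSE); apply: le_outer_measure => x [Sx Ex]; split=> //.
  exact: SB.
move=> BE0; apply/le_anti; rewrite outer_measure_ge0 andbT -BE0.
by apply: le_outer_measure => x Ax; split; [exact/KB'/AK|exact: Ag].
Qed.

End unrectifiable_reduction.

(** * Densities and fibres *)

Section cube_coverings.
Context {R : realType} (m : nat) (m_gt0 : (0 < m)%N).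
Local Notation L := (@hausdorff R m m).

Lemma nball_ub (x : 'rV[R]_m) (r : R) : 0 <= r ->
  (L (nball x r) <= ((2 * m%:R * r) ^+ m)%:E)%E.
Proof.
rewrite le_eqVlt => /predU1P[<-|r0].
  rewrite (_ : nball x 0 = set0) ?outer_measure0 ?lee_fin ?mulr0 ?exprn_ge0//.
  by apply/seteqP; split=> // y; rewrite /nball/= ltNge normr_ge0.
apply: le_trans (cube_ub m_gt0 x r0); apply: le_outer_measure => y; exact: ltW.
Qed.

Lemma nball_lb (x : 'rV[R]_m) (r : R) : 0 <= r -> (((r / 3) ^+ m)%:E <= L (nball x r))%E.
Proof.
rewrite le_eqVlt => /predU1P[<-|r0].
  by rewrite mul0r expr0n eqn0Ngt m_gt0 outer_measure_ge0.
have r2 : 0 < r / 2 by rewrite divr_gt0.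
apply: (@le_trans _ _ (L [set y | (`|y - x| <= r / 2)%R])).
  by have := cube_lb m_gt0 x r2; rewrite (_ : 2 * (r / 2) = r)//; field.
by apply: le_outer_measure => y /=; rewrite /nball/=; lra.
Qed.

Variables (c : nat -> 'rV[R]_m) (rho : nat -> R).
Hypothesis rho0 : forall i, 0 <= rho i.
Local Notation S := (\sum_(0 <= i <oo) (rho i ^+ m)%:E)%E.

Lemma cubes_cover_le (T : set 'rV[R]_m) (C : R) : 0 <= C ->
  T `<=` \bigcup_i nball (c i) (C * rho i) ->
  (L T <= ((2 * m%:R * C) ^+ m)%:E * S)%E.
Proof.
move=> C0 TB; apply: (le_trans (le_outer_measure _ _ _ TB)).
apply: (le_trans (outer_measure_sigma_subadditive L _)).
rewrite -nneseriesZl => [|i _]; last by rewrite lee_fin exprn_ge0.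
apply: lee_nneseries => [i _ _|i _]; first exact: outer_measure_ge0.
apply: (le_trans (nball_ub _ _)); first by rewrite mulr_ge0.
by rewrite -EFinM lee_fin !exprMn !mulrA.
Qed.

(** With [cubes_cover_le] this compares measures in R^m with sums of rho^m in both directions; the
    Vitali arguments below run through such sums. *)
Lemma cubes_disjoint_le (X : set 'rV[R]_m) :
  trivIset setT (fun i => nball (c i) (rho i)) ->
  (forall i, 0 < rho i -> nball (c i) (rho i) `<=` X) ->
  (S <= (3 ^+ m)%:E * L X)%E.
Proof.
move=> tB BX.
have h : (((1 / 3) ^+ m)%:E * S <= L X)%E.
  rewrite -nneseriesZl => [|i _]; last by rewrite lee_fin exprn_ge0.
  have mB i : L.-caratheodory (nball (c i) (rho i)).
    by apply: open_caratheodory => //; exact: open_nball.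
  apply: (le_trans _ (hausdorff_disjoint_le X mB tB)).
  apply: lee_nneseries => [i _ _|i _].
    by rewrite -EFinM lee_fin -exprMn exprn_ge0// mulr_ge0.
  have := rho0 i; rewrite le_eqVlt => /predU1P[ri0|ri].
    by rewrite -ri0 expr0n eqn0Ngt m_gt0 mule0 outer_measure_ge0.
  rewrite setIidr; last exact: BX.
  apply: (le_trans _ (nball_lb _ (ltW ri))).
  by rewrite -EFinM lee_fin -exprMn mulrC mulrA mulr1.
have -> : S = ((3 ^+ m)%:E * (((1 / 3) ^+ m)%:E * S))%E.
  by rewrite muleA -EFinM -exprMn mulrCA divff ?mulr1 ?expr1n ?mul1e.
by rewrite lee_wpmul2l// lee_fin exprn_ge0.
Qed.

End cube_coverings.

Lemma finite_min_gt0 {R : realType} (f : nat -> R) (N : nat) :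
  (forall i, (i < N)%N -> 0 < f i) ->
  exists2 d, 0 < d & forall i, (i < N)%N -> d <= f i.
Proof.
elim: N => [|N IH] f0; first by exists 1.
have [i iN|d d0 dP] := IH; first by apply: f0; exact: ltnW.
exists (Num.min d (f N)); first by rewrite lt_min d0 f0.
move=> i; rewrite ltnS leq_eqVlt => /predU1P[->|/dP]; first by rewrite ge_min lexx orbT.
by rewrite ge_min => ->.
Qed.

(** * Values of infinite density or infinite multiplicity *)

Section densities.
Context {R : realType} (m n : nat) (m_gt0 : (0 < m)%N).
Local Notation L := (@hausdorff R m m).
Local Notation H := (@hausdorff R n m).

(** The points of infinite upper m-density for the image under [P] of the measure H on [K]. *)
Definition infinite_density (K : set 'rV[R]_n) (P : 'rV[R]_n -> 'rV[R]_m) :=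
  [set u | forall M rho0 : R, 0 < rho0 -> exists2 rho, 0 < rho < rho0 &
    ((M * rho ^+ m)%:E <= H (K `&` P @^-1` nball u rho))%E].

Lemma open_preimage_lip (P : 'rV[R]_n -> 'rV[R]_m) (C : R) (G : set 'rV[R]_m) :
  (forall x y, `|P x - P y| <= C * `|x - y|) -> open G -> open (P @^-1` G).
Proof.
by move=> /lipschitz_continuous_row/continuousP; apply.
Qed.

(** Disjoint balls of mass at least M rho^m have disjoint preimages, so M times the sum of rho^m is
    at most H K, while five times larger balls cover. Let M grow. *)
Lemma infinite_density_null K P (C : R) : (H K < +oo)%E ->
  (forall x y, `|P x - P y| <= C * `|x - y|) ->
  L (infinite_density K P) = 0%E.
Proof.
move=> Koo PC; apply/le_anti; rewrite outer_measure_ge0 andbT.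
apply/lee_addgt0Pr => e e0; rewrite ?add0r.
have Kfin : H K \is a fin_num by rewrite ge0_fin_numE ?outer_measure_ge0.
pose h := fine (H K); have h0 : 0 <= h by rewrite fine_ge0// outer_measure_ge0.
pose A : R := (2 * m%:R * 5) ^+ m.
have A0 : 0 <= A by rewrite exprn_ge0 ?mulr_ge0.
(* Chosen so that A * h / M <= e, also when h = 0. *)
pose M := (A * h + 1) / e.
have M0 : 0 < M by rewrite divr_gt0// ltr_wpDl// mulr_ge0.
have H1 u : exists r, infinite_density K P u -> 0 < r <= 1 /\
    ((M * r ^+ m)%:E <= H (K `&` P @^-1` nball u r))%E.
  have [/(_ M 1 ltr01)[r /andP[r0 r1] rM]|] := pselect (infinite_density K P u).
    by exists r => _; rewrite r0 ltW.
  by exists 0.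
have [r rP] := choice H1.
have rT u : infinite_density K P u -> 0 < r u <= 1 by move=> /rP[].
have [c [rho [rhoP tB cov]]] := vitali_covering rT.
have rho0 i : 0 <= rho i by case: (rhoP i).
have TS := @cubes_cover_le R m m_gt0 c rho rho0 (infinite_density K P) 5 ltac:(lra).
apply: (le_trans (TS _)).
  by move=> u uT; have [i [_ ui]] := cov u uT; exists i => //; apply: ui;
    apply: nball_center; have /andP[] := rT u uT.
have MS : (M%:E * \sum_(0 <= i <oo) (rho i ^+ m)%:E <= H K)%E.
  rewrite -nneseriesZl => [|i _]; last by rewrite lee_fin exprn_ge0.
  have mB i : H.-caratheodory (P @^-1` nball (c i) (rho i)).
    by apply: open_caratheodory => //; apply: open_preimage_lip PC _; exact: open_nball.
  have tPB : trivIset setT (fun i => P @^-1` nball (c i) (rho i)).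
    apply/trivIsetP => i j _ _ ij; move/trivIsetP : tB => /(_ i j I I ij) tB.
    by rewrite -preimage_setI tB preimage_set0.
  apply: (le_trans _ (hausdorff_disjoint_le K mB tPB)).
  apply: lee_nneseries => [i _ _|i _].
    by rewrite -EFinM lee_fin mulr_ge0 ?exprn_ge0 ?(ltW M0).
  have := rho0 i; rewrite le_eqVlt => /predU1P[ri0|ri].
    by rewrite -ri0 expr0n eqn0Ngt m_gt0 mule0 outer_measure_ge0.
  have [Tc rc] := (rhoP i).2 ri.
  by rewrite -EFinM rc; apply: (rP _ Tc).2.
move: MS; set S := limn _; rewrite -/h.
have S0 : (0 <= S)%E by apply: nneseries_ge0 => i _ _; rewrite lee_fin exprn_ge0.
rewrite -(fineK Kfin) -/h; case: S S0 => [s| |] //; last first.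
  by move=> _; rewrite gt0_muley ?lte_fin// leye_eq.
rewrite -!EFinM !lee_fin => s0 Ms.
have : s <= h / M by rewrite ler_pdivlMr// mulrC.
move=> /(ler_wpM2l A0)/le_trans; apply.
rewrite /M invf_div mulrA mulrA ler_pdivrMr; last by rewrite ltr_wpDl// mulr_ge0.
have : A * h * e <= (A * h + 1) * e by rewrite ler_pM2r// lerDl.
by rewrite (mulrC e).
Qed.

(** The inverse of twice the total loss in [low_density_null]: 5 from the Vitali enlargement, 3 from
    the packing and 2 m from the measure of a cube. *)
Definition density_constant : R := (2 * (2 * m%:R * 3 * 5) ^+ m)^-1.

Lemma density_constant_gt0 : 0 < density_constant.
Proof. by rewrite invr_gt0 mulr_gt0// exprn_gt0// !mulr_gt0// ltr0n. Qed.

Definition low_density (E : set 'rV[R]_m) := [set u | E u /\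
  forall rho0 : R, 0 < rho0 -> exists2 rho, 0 < rho < rho0 &
    (L (E `&` nball u rho) <= (density_constant * rho ^+ m)%:E)%E].

(** A covering proof valid for non-measurable [E], as needed for projections. Inside an open set of
    measure comparable to that of [F], Vitali balls on which [E] has low density give L F <= (L F +
    e) / 2, hence L F <= e as L F is finite. *)
Lemma low_density_null E : L (low_density E) = 0%E.
Proof.
suff bounded k : L (low_density E `&` [set u | `|u - 0| <= k.+1%:R]) = 0%E.
  apply/le_anti; rewrite outer_measure_ge0 andbT.
  apply: (@le_trans _ _ (L (\bigcup_k (low_density E `&` [set u | (`|u - 0| <= k.+1%:R)%R])))).
    apply: le_outer_measure => u uE; exists (Num.bound `|u - 0|) => //; split=> //=.
    by apply: (le_trans (ltW (archi_boundP _)))=> //; rewrite ler_nat.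
  apply: (le_trans (outer_measure_sigma_subadditive L _)).
  by rewrite eseries0// => i _ _; exact: bounded.
set F := _ `&` _.
have Foo : (L F < +oo)%E.
  apply: (@le_lt_trans _ _ (L [set u | (`|u - 0| <= k.+1%:R)%R])).
    by apply: le_outer_measure => u [].
  by apply: (le_lt_trans (cube_ub m_gt0 _ _)); rewrite ?ltry// ltr0n.
have Ffin : L F \is a fin_num by rewrite ge0_fin_numE ?outer_measure_ge0.
apply/le_anti; rewrite outer_measure_ge0 andbT.
apply/lee_addgt0Pr => e e0; rewrite ?add0r.
have [Vo [rad [FV oV rad0 Orad radS]]] := open_coverP m_gt0 Foo ltr01 e0.
pose G := \bigcup_i Vo i.
have oG : open G by apply: bigcup_open => i _.
have LG : (L G <= ((2 * m%:R) ^+ m)%:E * (L F + e%:E))%E.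
  apply: (@le_trans _ _ (((2 * m%:R) ^+ m)%:E * (\sum_(0 <= i <oo) (rad i ^+ m)%:E))%E); last first.
    by rewrite lee_wpmul2l// lee_fin exprn_ge0// mulr_ge0.
  rewrite -nneseriesZl => [|i _]; last first.
    by rewrite lee_fin exprn_ge0//; have /andP[/ltW] := rad0 i.
  apply: (le_trans (outer_measure_sigma_subadditive L _)).
  apply: lee_nneseries => [i _ _|i _]; first exact: outer_measure_ge0.
  have /andP[ri0 _] := rad0 i.
  have [[x Ox]|Oi] := pselect (Vo i !=set0); last first.
    rewrite (_ : Vo i = set0); last by apply/seteqP; split=> // x Ox; apply: Oi; exists x.
    by rewrite outer_measure0 mule_ge0// lee_fin exprn_ge0 ?mulr_ge0 ?ltW.
  rewrite -EFinM -exprMn; apply: le_trans (cube_ub m_gt0 x ri0).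
  apply: le_outer_measure => y Oy /=.
  by apply: (le_trans (norm_le_enorm _)); exact: Orad.
have H1 u : exists r, F u -> 0 < r <= 1 /\ nball u (5 * r) `<=` G /\
    (L (E `&` nball u (5 * r)) <= (density_constant * (5 * r) ^+ m)%:E)%E.
  have [Fu|] := pselect (F u); last by exists 0.
  have [d d0 dG] := (open_nballP G).1 oG u (FV _ Fu).
  have [[_ Fd] _] := Fu; have := Fd (Num.min d 5).
  rewrite lt_min d0 ltr0n => /(_ isT)[rho /andP[rho0]]; rewrite lt_min => /andP[rd r5] rE.
  (* The density bound is needed on the enlarged ball, so [rho] is the radius after enlargement. *)
  exists (rho / 5) => _; have -> : 5 * (rho / 5) = rho by field.
  split; first by apply/andP; split; lra.
  by split=> // y; rewrite /nball/= => yu; apply: dG; exact: lt_trans rd.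
have [r rP] := choice H1.
have rF u : F u -> 0 < r u <= 1 by move=> /rP[].
have [c [rho [rhoP tB cov]]] := vitali_covering rF.
have rho0 i : 0 <= rho i by case: (rhoP i).
have SG := @cubes_disjoint_le R m m_gt0 c rho rho0 G tB _.
have {}SG := SG _.
have LF : (L F <= (density_constant * 5 ^+ m)%:E * \sum_(0 <= i <oo) (rho i ^+ m)%:E)%E.
  rewrite -nneseriesZl => [|i _]; last by rewrite lee_fin exprn_ge0.
  apply: (@le_trans _ _ (L (\bigcup_i (E `&` nball (c i) (5 * rho i))))).
    apply: le_outer_measure => u Fu; have [i [_ ui]] := cov u Fu.
    exists i => //; split; first by case: Fu => -[].
    by apply: ui; apply: nball_center; have /andP[] := rF u Fu.
  apply: (le_trans (outer_measure_sigma_subadditive L _)).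
  apply: lee_nneseries => [i _ _|i _]; first exact: outer_measure_ge0.
  have := rho0 i; rewrite le_eqVlt => /predU1P[ri0|ri].
    rewrite -ri0 mulr0 expr0n eqn0Ngt m_gt0 mule0 (_ : _ `&` _ = set0) ?outer_measure0//.
    by apply/seteqP; split=> // y [_]; rewrite /nball/= ltNge normr_ge0.
  have [Fc rc] := (rhoP i).2 ri; have [_ [_]] := rP _ Fc.
  by rewrite -rc exprMn -EFinM mulrA.
have {}SG : (\sum_(0 <= i <oo) (rho i ^+ m)%:E <= (3 ^+ m)%:E * L G)%E.
  apply: SG => i ri; have [Fc rc] := (rhoP i).2 ri; have [_ [cG _]] := rP _ Fc.
  by move=> y; rewrite /nball/= => yc; apply: cG; rewrite /nball/= -rc; lra.
have key : (L F <= (2^-1)%:E * (L F + e%:E))%E.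
  apply: (le_trans LF).
  have d5 : (0 <= (density_constant * 5 ^+ m)%:E :> \bar R)%E.
    by rewrite lee_fin mulr_ge0 ?exprn_ge0 ?(ltW density_constant_gt0).
  apply: (le_trans (lee_wpmul2l d5 SG)).
  have d3 : (0 <= (3 ^+ m)%:E :> \bar R)%E by rewrite lee_fin exprn_ge0.
  apply: (le_trans (lee_wpmul2l d5 (lee_wpmul2l d3 LG))).
  rewrite !muleA -!EFinM le_eqVlt; apply/orP; left; apply/eqP; congr (_%:E * _)%E.
  have X0 : 0 < (2 * m%:R * 3 * 5) ^+ m :> R by rewrite exprn_gt0// !mulr_gt0// ltr0n.
  have XE : 5 ^+ m * (3 ^+ m * (2 * m%:R) ^+ m) = (2 * m%:R * 3 * 5) ^+ m :> R.
    by rewrite -!exprMn; congr (_ ^+ _); ring.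
  have -> : density_constant * 5 ^+ m * 3 ^+ m * (2 * m%:R) ^+ m =
      density_constant * (2 * m%:R * 3 * 5) ^+ m by rewrite -XE !mulrA.
  by rewrite /density_constant; move: X0; set X := _ ^+ _ => X0; field; rewrite gt_eqF.
move: key; rewrite -(fineK Ffin) -EFinD -EFinM !lee_fin.
by move: (fine _) => x; lra.
Qed.

Let gball (l i : nat) : set 'rV[R]_n :=
  nball (if unpickle i is Some q then map_mx ratr (q : 'rV[rat]_n) else 0) l.+1%:R^-1.

(** For each l, balls around rational points made disjoint: a countable measurable partition of R^n
    whose cells have diameter below 2/(l+1) in the sup norm. *)
Let cell (l i : nat) : set 'rV[R]_n := seqDU (gball l) i.

Let cell_caratheodory l i : H.-caratheodory (cell l i).
Proof.
have mB k : H.-caratheodory (gball l k).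
  by apply: open_caratheodory => //; exact: open_nball.
apply: caratheodory_measurable_setD => //.
exact: (caratheodory_measurable_bigsetU mB).
Qed.

Let cell_small l i x y : cell l i x -> cell l i y -> `|x - y| < 2 / l.+1%:R.
Proof.
move=> [xi _] [yi _].
have key (e : R) z : `|x - z| < e -> `|y - z| < e -> `|x - y| < 2 * e.
  by have := ler_distD z x y; rewrite (distrC z y); lra.
exact: key xi yi.
Qed.

Let cell_cover l x : exists i, cell l i x.
Proof.
have l0 : 0 < l.+1%:R^-1 :> R by rewrite invr_gt0.
have [q qx] := rational_row x l0.
have : (\bigcup_i cell l i) x.
  rewrite -seqDU_bigcup_eq; exists (pickle q) => //; rewrite /gball pickleK /nball/=.
  by rewrite distrC.
by case=> i _ xi; exists i.
Qed.

Definition infinite_fibre (K : set 'rV[R]_n) (P : 'rV[R]_n -> 'rV[R]_m) :=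
  [set u | exists ys : nat -> 'rV[R]_n, injective ys /\ forall i, K (ys i) /\ P (ys i) = u].

(* N points of a fibre lie in N disjoint cells, and the projection of each cell has
   positive lower density at almost every point: so the density over an infinite
   fibre is infinite. *)
Lemma infinite_fibre_null K P (C : R) : (H K < +oo)%E ->
  (forall x y, `|P x - P y| <= C * `|x - y|) ->
  L (infinite_fibre K P) = 0%E.
Proof.
move=> Koo PC.
pose bad l i := low_density (P @` (K `&` cell l i)).
pose Bad := \bigcup_l \bigcup_i bad l i.
have Bad0 : L Bad = 0%E.
  apply/le_anti; rewrite outer_measure_ge0 andbT.
  apply: (le_trans (outer_measure_sigma_subadditive L _)).
  rewrite eseries0// => l _ _; apply/le_anti; rewrite outer_measure_ge0 andbT.
  apply: (le_trans (outer_measure_sigma_subadditive L _)).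
  by rewrite eseries0// => i _ _; exact: low_density_null.
suff sub : infinite_fibre K P `<=` infinite_density K P `|` Bad.
  apply/le_anti; rewrite outer_measure_ge0 andbT.
  apply: (le_trans (le_outer_measure L _ _ sub)).
  apply: (le_trans (outer_measureU2 _ _ _)).
  by rewrite [X in (X + _ <= _)%E](infinite_density_null Koo PC) [X in (_ + X <= _)%E]Bad0 adde0.
move=> u [ys [ys_inj ysK]]; have [Bu|nBu] := pselect (Bad u); [by right|left].
move=> M rho0 rho00.
(* [P] multiplies measures by at most [c], so a cell whose projection has density [density_constant]
   carries at least [density_constant / c] times r^m. [N] such cells exceed [M]. *)
pose c : R := (m%:R * (`|C| + 1)) ^+ m.
have mR : 0 < m%:R :> R by rewrite ltr0n.
have c0 : 0 < c by rewrite exprn_gt0// mulr_gt0// ltr_wpDl.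
have dc0 := density_constant_gt0.
pose N := Num.bound (c * `|M| / density_constant).
have NM : M <= N%:R * (density_constant / c).
  have : c * `|M| / density_constant < N%:R.
    by apply: archi_boundP; rewrite !mulr_ge0 ?invr_ge0 ?(ltW c0) ?(ltW dc0).
  rewrite ltr_pdivrMr// => h; rewrite mulrA ler_pdivlMr// mulrC.
  by apply: le_trans (ltW h); rewrite ler_wpM2l ?(ltW c0)// ler_norm.
have [l lsep] : exists l, forall i j, (i < N)%N -> (j < N)%N -> i != j ->
    2 / l.+1%:R <= `|ys i - ys j|.
  have H1 i : exists d, 0 < d /\ forall j, (j < N)%N -> i != j -> d <= `|ys i - ys j|.
    have [|d d0 dP] := @finite_min_gt0 R (fun j => if i == j then 1 else `|ys i - ys j|) N.
      move=> j _ /=; case: eqP => // ij; rewrite normr_gt0 subr_eq0.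
      by apply/eqP => /ys_inj.
    by exists d; split=> // j /dP + /negbTE ij; rewrite ij.
  have [d dP] := choice H1.
  have [|e e0 eP] := @finite_min_gt0 R d N; first by move=> i _; case: (dP i).
  have [l] := ltr_add_invr (divr_gt0 e0 (ltr0Sn R 1)); rewrite add0r => le.
  exists l => i j iN jN ij; apply: (le_trans _ ((dP i).2 j jN ij)).
  by apply: (le_trans _ (eP i iN)); move: le; rewrite ltr_pdivlMr// mulrC => /ltW.
have [k kP] := choice (fun i => cell_cover l (ys i)).
have H1 i : exists rho, 0 < rho /\ forall r, 0 < r < rho ->
    ((density_constant * r ^+ m)%:E <= L (P @` (K `&` cell l (k i)) `&` nball u r))%E.
  have : ~ bad l (k i) u by move=> b; apply: nBu; exists l => //; exists (k i).
  move=> nb; apply: contrapT => nr; apply: nb; split.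
    by exists (ys i); [split; [case: (ysK i)|exact: kP]|case: (ysK i)].
  move=> r r0; apply: contrapT => nrr; apply: nr; exists r; split=> // s sr.
  by rewrite leNgt; apply/negP => lt; apply: nrr; exists s => //; exact: ltW.
have [rho rhoP] := choice H1.
have [|d d0 dP] := @finite_min_gt0 R rho N; first by move=> i _; case: (rhoP i).
pose r := Num.min (rho0 / 2) (d / 2).
have r0 : 0 < r by rewrite lt_min !divr_gt0.
have rrho i : (i < N)%N -> r < rho i.
  by move=> /dP; apply: lt_le_trans; rewrite /r gt_min; apply/orP; right; lra.
exists r; first by rewrite r0 /r gt_min; apply/orP; left; lra.
pose A i := if (i < N)%N then cell l (k i) else set0.
have mA i : H.-caratheodory (A i).
  by rewrite /A; case: ifP => _ //; exact: caratheodory_measurable_set0.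
have tA : trivIset setT A.
  apply/trivIsetP => i j _ _ ij; rewrite /A; case: ltnP => iN; last by rewrite set0I.
  case: ltnP => jN; last by rewrite setI0.
  have kij : k i != k j.
    apply/eqP => kij; have := lsep i j iN jN ij; rewrite leNgt => /negP; apply.
    by apply: (@cell_small l (k i)) => //; rewrite kij.
  by have /trivIsetP := trivIset_seqDU (gball l); apply.
apply: (@le_trans _ _ (\sum_(i < N) H (K `&` P @^-1` nball u r `&` A i))%E); last first.
  rewrite -(caratheodory_additive mA tA).
  by apply: le_outer_measure => x [].
apply: (@le_trans _ _ (\sum_(i < N) (density_constant / c * r ^+ m)%:E)%E).
  rewrite sumEFin lee_fin sumr_const card_ord -[leRHS]mulr_natl mulrA.
  by rewrite ler_pM2r// exprn_gt0.
apply: lee_sum => i _; have iN := ltn_ord i.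
have [_ /(_ r)] := rhoP i; rewrite r0 rrho// => /(_ isT) low.
rewrite /A iN; set X := K `&` _ `&` _.
have : (L (P @` (K `&` cell l (k i)) `&` nball u r) <= c%:E * H X)%E.
  apply: (@le_trans _ _ (L (P @` X))).
    apply: le_outer_measure => _ [[x [Kx xi] <-] xu]; exists x => //.
  have := @hausdorff_image_le R m m_gt0 n m X P (`|C| + 1) _ _; apply.
    by rewrite addr_ge0.
  move=> x y _ _; apply: (le_trans (PC x y)); rewrite ler_wpM2r//.
  by rewrite (le_trans (ler_norm _))// lerDl.
move=> /(le_trans low) h.
have c1 : (0 <= (c^-1)%:E :> \bar R)%E by rewrite lee_fin invr_ge0 ltW.
have := lee_wpmul2l c1 h; rewrite muleA -!EFinM mulVf ?gt_eqF// mul1e.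
by rewrite mulrCA mulrA.
Qed.

End densities.

(** * Narrow cones *)

Section dyadic.
Context {R : realType}.

(** All scales are powers of 1/2: quantifiers over small radii become countable, so that the sets of
    bad directions are measurable, at the price of the factor 2 in [dyad_round]. *)
Definition dyad (i : nat) : R := (1 / 2) ^+ i.

Lemma dyad_gt0 i : 0 < dyad i.
Proof. by rewrite exprn_gt0// divr_gt0. Qed.

Lemma dyadS i : dyad i.+1 = dyad i / 2.
Proof. by rewrite /dyad exprS; field. Qed.

Lemma dyad_le i j : (i <= j)%N -> dyad j <= dyad i.
Proof.
move=> /subnK <-; elim: (j - i)%N => [|k IH] //.
by rewrite addSn dyadS; have := dyad_gt0 (k + i); lra.
Qed.

Lemma dyad_le1 i : dyad i <= 1.
Proof. by apply: le_trans (dyad_le (leq0n i)) _; rewrite /dyad expr0. Qed.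

Lemma dyad_small (t : R) : 0 < t -> exists i, dyad i < t.
Proof.
move=> t0; have [k] := ltr_add_invr t0; rewrite add0r => kt; exists k.
apply: le_lt_trans kt; elim: k => [|k IH]; first by rewrite /dyad expr0 invr1.
rewrite dyadS; apply: (@le_trans _ _ (k.+1%:R^-1 / 2)); first by rewrite ler_pM2r.
by rewrite -invfM lef_pV2 ?posrE ?mulr_gt0 ?ltr0n// -natrM ler_nat; lia.
Qed.

Lemma dyad_round (i0 : nat) (t : R) : 0 < t -> t <= dyad i0 ->
  exists2 i, (i0 <= i)%N & t <= dyad i <= 2 * t.
Proof.
move=> t0 ti0; have [j jt] := dyad_small t0.
have ex : exists i, dyad i.+1 < t.
  by exists j; rewrite dyadS; have := dyad_gt0 j; lra.
have [i it imin] := ex_minnP ex.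
have it' : t <= dyad i.
  rewrite leNgt; apply/negP => lt; case: i lt it imin => [|i] lt it imin.
    by move: ti0; rewrite leNgt; apply/negP/negPn/(le_lt_trans (dyad_le (leq0n i0)) lt).
  by have := imin i lt; rewrite ltnn.
exists i; last by rewrite it'/=; move: it; rewrite dyadS; lra.
rewrite leqNgt; apply/negP => ii0.
by have := dyad_le ii0; lra.
Qed.

End dyadic.

(** * Sets with thin cones are null *)

Section cone_lemma.
Context {R : realType} (m n k : nat) (m_gt0 : (0 < m)%N).
Local Notation L := (@hausdorff R m m).
Local Notation H := (@hausdorff R n m).
Variables (P : 'rV[R]_n -> 'rV[R]_m) (Q : 'rV[R]_n -> 'rV[R]_k).

(** As [Q] is bi-Lipschitz on the set considered, this is a cone of opening [s] around the fibre of
    [P] through [a], cut off at distance [r]. *)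
Definition cone (a : 'rV[R]_n) (r s : R) : set 'rV[R]_n :=
  [set y | `|P y - P a| < s * `|Q y - Q a| /\ `|Q y - Q a| < r].

Variables (K A : set 'rV[R]_n) (C s c : R) (i0 : nat).
Hypotheses (Koo : (H K < +oo)%E) (Knull : graph_null m K).
Hypotheses (C_gt0 : 0 < C) (s_gt0 : 0 < s) (s_le1 : s <= 1) (c_ge0 : 0 <= c).
Hypothesis P_lip : forall x y, `|P x - P y| <= C * `|x - y|.
Hypothesis Q_lip : forall x y, `|Q x - Q y| <= C * `|x - y|.
Hypothesis Q_colip : forall x y, A x -> A y -> `|x - y| <= C * `|Q x - Q y|.
Hypothesis AK : A `<=` K.
Hypothesis c_small : c * (4 * (600 * 18 * m%:R * C) ^+ m) <= 1.
Hypothesis thin : forall a i, A a -> (i0 <= i)%N ->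
  (H (K `&` cone a (dyad i) s) <= (c * (dyad i * s) ^+ m)%:E)%E.

(** Let h be the supremum of |Q y - Q a| over the y that violate the first alternative, and y one
    with |Q y - Q a| > h/2. A point x with |P x - P a| < s h / 20 satisfies |Q x - Q a| <= h by the
    choice of h. If |Q x - Q a| >= h/20 it lies in the cone at a; if not, Q x is far from Q y and x
    lies in the cone at y. *)
Let strip (A1 : set 'rV[R]_n) (rho : R) : A1 `<=` A ->
  (forall x y, A1 x -> A1 y -> `|x - y| <= rho) -> 0 <= rho -> 6 * (C * rho) <= dyad i0 ->
  forall a, A1 a ->
  (forall y, A1 y -> s / 8 * `|Q y - Q a| <= `|P y - P a|) \/
  exists h, [/\ 0 < h, h <= C * rho &
    (H (A1 `&` P @^-1` nball (P a) (5 * (s * h / 100)))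
      <= (2 * c * (600 * (s * h / 100)) ^+ m)%:E)%E].
Proof.
move=> A1A A1rho rho0 rhoi0 a A1a.
have [?|n0] := pselect (forall y, A1 y -> s / 8 * `|Q y - Q a| <= `|P y - P a|); [by left|right].
move: n0 => /existsNP[y0 /not_implyP[A1y0 /negP]]; rewrite -ltNge => y0lt.
pose B := [set `|Q y - Q a| | y in [set y | A1 y /\ `|P y - P a| < s / 8 * `|Q y - Q a|]].
have By0 : B `|Q y0 - Q a| by exists y0.
have Bub : ubound B (C * rho).
  move=> _ [y [A1y _] <-]; apply: (le_trans (Q_lip _ _)).
  by rewrite ler_wpM2l ?(ltW C_gt0)// A1rho.
have hB : has_sup B by split; [exists (`|Q y0 - Q a|) | exists (C * rho)].
pose h := sup B.
have y0h : `|Q y0 - Q a| <= h by apply: ub_le_sup => //; exact: hB.2.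
have h0 : 0 < h.
  apply: lt_le_trans y0h; rewrite lt_neqAle normr_ge0 andbT eq_sym; apply/eqP => e.
  by move: y0lt; rewrite e mulr0 ltNge normr_ge0.
exists h; split=> //; first by apply: ge_sup => //; exists `|Q y0 - Q a|.
have [_ [y [A1y yP] <-] yh] := sup_adherent (divr_gt0 h0 (ltr0Sn R 1)) hB.
have {}yh : h / 2 < `|Q y - Q a| by move: yh; rewrite -/h; lra.
have yh' : `|Q y - Q a| <= h by apply: ub_le_sup; [exact: hB.2|exists y].
have h3 : 3 * h <= dyad i0.
  have : h <= C * rho by apply: ge_sup => //; exists `|Q y0 - Q a|.
  by lra.
(* Lengths up to 3h leave room for both cones; rounding gives at most 6h, and 6 s h = 600 * (s h /
   100) explains the constant. *)
have [i ii0 /andP[hi ih]] := @dyad_round R i0 (3 * h) ltac:(lra) h3.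
apply: (@le_trans _ _ (H (K `&` cone a (dyad i) s) + H (K `&` cone y (dyad i) s))%E).
  apply: (le_trans _ (outer_measureU2 _ _ _)); apply: le_outer_measure => x [A1x].
  have Kx : K x by apply/AK/A1A.
  rewrite /= /nball/= => xs.
  have sh : 5 * (s * h / 100) = s * h / 20 by field.
  rewrite {}sh in xs.
  have Dh : `|Q x - Q a| <= h.
    rewrite leNgt; apply/negP => hD.
    have [xB|xB] := ltP `|P x - P a| (s / 8 * `|Q x - Q a|).
      by move: hD; rewrite ltNge => /negP; apply; apply: ub_le_sup; [exact: hB.2|exists x].
    have : s / 8 * h <= s / 8 * `|Q x - Q a| by rewrite ler_wpM2l ?(ltW hD)// divr_ge0 ?(ltW s_gt0).
    have : 0 < s * h by rewrite mulr_gt0.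
    by lra.
  have [hD|Dh'] := leP (h / 20) `|Q x - Q a|.
    left; split=> //; split; last by lra.
    apply: (lt_le_trans xs); rewrite -mulrA ler_wpM2l// ltW//.
  right; split=> //.
  have lb : h / 2 - h / 20 < `|Q x - Q y|.
    by have := ler_distD (Q x) (Q y) (Q a); rewrite (distrC (Q y) (Q x)); lra.
  have ub : `|Q x - Q y| <= h / 20 + h.
    by have := ler_distD (Q a) (Q x) (Q y); rewrite (distrC (Q a) (Q y)); lra.
  split; last by lra.
  have : `|P x - P y| < s * h / 20 + s / 8 * h.
    have := ler_distD (P a) (P x) (P y); rewrite (distrC (P a) (P y)).
    have : s / 8 * `|Q y - Q a| <= s / 8 * h by rewrite ler_wpM2l// divr_ge0 ?(ltW s_gt0).
    by lra.
  have : s * (h / 2 - h / 20) <= s * `|Q x - Q y| by rewrite ler_wpM2l ?(ltW s_gt0)// ltW.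
  have : 0 < s * h by rewrite mulr_gt0.
  by lra.
apply: (le_trans (leeD (thin (A1A _ A1a) ii0) (thin (A1A _ A1y) ii0))).
rewrite -EFinD lee_fin (_ : _ + _ = 2 * c * (dyad i * s) ^+ m); last by ring.
rewrite ler_wpM2l ?mulr_ge0//.
have d0 := @dyad_gt0 R i.
have ds0 : 0 <= dyad i * s by rewrite mulr_ge0 ?(ltW s_gt0) ?(ltW d0).
have sh0 : 0 <= 600 * (s * h / 100) by have := mulr_gt0 s_gt0 h0; lra.
apply: lerXn2r; [exact: ds0|exact: sh0|].
have : dyad i * s <= 2 * (3 * h) * s by rewrite ler_wpM2r// ltW.
by lra.
Qed.

(** Points of the first kind in [strip] form a graph over R^m and are null. The values of the others
    are centres of balls with light preimages; Vitali's theorem bounds the total through a ball of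
    radius 3 C rho that contains the disjoint ones. *)
Let piece (F : set 'rV[R]_n) (rho : R) :
  (forall x y, F x -> F y -> `|x - y| <= rho) -> 0 <= rho -> 6 * (C * rho) <= dyad i0 ->
  (H (A `&` F) <= (rho ^+ m / 2)%:E)%E.
Proof.
move=> Frho rho0 rhoi0; pose A1 := A `&` F.
have A1A : A1 `<=` A by move=> x [].
have A1rho x y : A1 x -> A1 y -> `|x - y| <= rho by move=> [_ Fx] [_ Fy]; exact: Frho.
pose Z := [set a | A1 a /\ forall y, A1 y -> s / 8 * `|Q y - Q a| <= `|P y - P a|].
have HZ : H Z = 0%E.
  apply: (@Knull Z P (C * (8 / s))); first by move=> x [/A1A/AK].
  move=> x y [A1x Zx] [A1y Zy]; apply: (le_trans (Q_colip (A1A _ A1x) (A1A _ A1y))).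
  rewrite -mulrA ler_wpM2l ?(ltW C_gt0)//.
  by have := Zy x A1x; rewrite -ler_pdivlMl ?divr_gt0// invf_div.
have H1 u : exists ah : 'rV[R]_n * R, (P @` (A1 `\` Z)) u ->
    [/\ P ah.1 = u, 0 < ah.2, ah.2 <= C * rho &
    (H (A1 `&` P @^-1` nball u (5 * (s * ah.2 / 100)))
      <= (2 * c * (600 * (s * ah.2 / 100)) ^+ m)%:E)%E].
  have [[a [A1a nZa] <-]|nu] := pselect ((P @` (A1 `\` Z)) u); last by exists (0, 0).
  have [Za|[h [h0 hr hH]]] := strip A1A A1rho rho0 rhoi0 A1a.
    by exfalso; apply: nZa.
  by exists (a, h).
have [ah ahP] := choice H1.
pose r u := s * (ah u).2 / 100.
have rV u : (P @` (A1 `\` Z)) u -> 0 < r u <= C * rho.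
  move=> /ahP[_ h0 hr _]; rewrite divr_gt0 ?mulr_gt0//=.
  have : s * (ah u).2 <= 1 * (C * rho) by rewrite ler_pM// ltW.
  by have : 0 < s * (ah u).2 by [rewrite mulr_gt0]; rewrite /r; lra.
have [cc [rr [rrP tB cov]]] := vitali_covering rV.
have rr0 i : 0 <= rr i by case: (rrP i).
have HA1 : (H (A1 `\` Z) <= (2 * c * 600 ^+ m)%:E * \sum_(0 <= i <oo) (rr i ^+ m)%:E)%E.
  rewrite -nneseriesZl => [|i _]; last by rewrite lee_fin exprn_ge0.
  apply: (@le_trans _ _ (H (\bigcup_i (A1 `&` P @^-1` nball (cc i) (5 * rr i))))).
    apply: le_outer_measure => x [A1x nZx].
    have Vx : (P @` (A1 `\` Z)) (P x) by exists x.
    have [i [_ xi]] := cov _ Vx; exists i => //; split=> //.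
    by apply: xi; apply: nball_center; case/andP: (rV _ Vx).
  apply: (le_trans (outer_measure_sigma_subadditive H _)).
  apply: lee_nneseries => [i _ _|i _]; first exact: outer_measure_ge0.
  have := rr0 i; rewrite le_eqVlt => /predU1P[ri0|ri].
    rewrite -ri0 mulr0 expr0n eqn0Ngt m_gt0 mule0 (_ : _ `&` _ = set0) ?outer_measure0//.
    by apply/seteqP; split=> // y [_]; rewrite /= /nball/= ltNge normr_ge0.
  have [Vc rc] := (rrP i).2 ri; have [_ _ _] := ahP _ Vc.
  by rewrite -/(r (cc i)) -rc exprMn -EFinM mulrA.
have HS : (A1 `\` Z !=set0 -> \sum_(0 <= i <oo) (rr i ^+ m)%:E <= ((18 * m%:R * C * rho) ^+ m)%:E)%E.
  move=> [a0 Aa0]; have Va0 : (P @` (A1 `\` Z)) (P a0) by exists a0.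
  have Crho : 0 < C * rho by case/andP: (rV _ Va0) => /lt_le_trans; apply.
  have := @cubes_disjoint_le R m m_gt0 cc rr rr0 (nball (P a0) (3 * (C * rho))) tB.
  move=> /(_ _)/le_trans; apply.
    move=> i ri u; rewrite /nball/= => ui; have [[a [Aa nZa] ca] rc] := (rrP i).2 ri.
    have Vc : (P @` (A1 `\` Z)) (cc i) by exists a.
    have /andP[_ rle] := rV _ Vc; rewrite -rc in rle.
    have := ler_distD (cc i) u (P a0); rewrite -ca in ui *.
    have : `|P a - P a0| <= C * rho.
      apply: (le_trans (P_lip _ _)); rewrite ler_wpM2l ?(ltW C_gt0)//.
      by apply: A1rho => //; case: Aa0.
    by lra.
  apply: (@le_trans _ _ ((3 ^+ m)%:E * ((2 * m%:R * (3 * (C * rho))) ^+ m)%:E)%E).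
    rewrite lee_wpmul2l ?lee_fin ?exprn_ge0//; apply: nball_ub => //.
    by rewrite !mulr_ge0 ?(ltW C_gt0).
  rewrite -EFinM -exprMn lee_fin le_eqVlt; apply/orP; left; apply/eqP.
  by congr (_ ^+ _); ring.
apply: (@le_trans _ _ (H Z + H (A1 `\` Z))%E).
  apply: (le_trans _ (outer_measureU2 _ _ _)); apply: le_outer_measure => x A1x.
  by have [Zx|nZx] := pselect (Z x); [left|right].
rewrite HZ add0e; have [/HS{}HS|A1Z] := pselect (A1 `\` Z !=set0); last first.
  rewrite (_ : A1 `\` Z = set0) ?outer_measure0 ?lee_fin ?divr_ge0 ?exprn_ge0//.
  by apply/seteqP; split=> // x xA; apply: A1Z; exists x.
apply: (le_trans HA1).
have c6 : (0 <= (2 * c * 600 ^+ m)%:E :> \bar R)%E by rewrite lee_fin; apply: mulr_ge0; [exact: mulr_ge0|exact: exprn_ge0 (ler0n R 600)].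
apply: (le_trans (lee_wpmul2l c6 HS)); rewrite -EFinM lee_fin.
(* The origin of [c_small]: 600 from [strip]; 18 = 3 * 2 * 3 from packing, measure of a cube and
   radius 3 C rho; 4 from the two cones and the half to be gained. *)
have e1 : 600 ^+ m * (18 * m%:R * C * rho) ^+ m = (600 * 18 * m%:R * C) ^+ m * rho ^+ m.
  by rewrite -!exprMn; congr (_ ^+ _); ring.
rewrite -[leLHS]mulrA e1; have r0 : 0 <= rho ^+ m by rewrite exprn_ge0.
have := ler_wpM2r r0 c_small; move: (_ ^+ m) => X; lra.
Qed.

(* A set in which the narrow cones are uniformly thin is null: it meets every set F in
   measure at most half of (diam F)^m, which is impossible for a set of positive measure. *)
Lemma cone_null : H A = 0%E.
Proof.
have Aoo : (H A < +oo)%E by apply: le_lt_trans Koo; exact: le_outer_measure.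
have Afin : H A \is a fin_num by rewrite ge0_fin_numE ?outer_measure_ge0.
apply/le_anti; rewrite outer_measure_ge0 andbT.
have d0 : 0 < dyad i0 / (6 * C) :> R by rewrite divr_gt0 ?dyad_gt0 ?mulr_gt0.
suff half e : 0 < e -> (H A <= (2^-1)%:E * (H A + e%:E))%E.
  apply/lee_addgt0Pr => e /half; rewrite ?add0r -(fineK Afin) -EFinD -EFinM !lee_fin.
  by move: (fine _) => x; lra.
move=> e0; have [F [r [AF rd Fr Fe]]] := hausdorff_coverP m_gt0 Aoo d0 e0.
have r0 i : 0 <= r i by case/andP: (rd i).
apply: (@le_trans _ _ ((2^-1)%:E * \sum_(0 <= i <oo) (r i ^+ m)%:E)%E); last first.
  by rewrite lee_wpmul2l// lee_fin invr_ge0.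
rewrite -nneseriesZl => [|i _]; last by rewrite lee_fin exprn_ge0.
apply: (@le_trans _ _ (H (\bigcup_i (A `&` F i)))).
  by apply: le_outer_measure => x Ax; have [i _ Fi] := AF x Ax; exists i.
apply: (le_trans (outer_measure_sigma_subadditive H _)).
apply: lee_nneseries => [i _ _|i _]; first exact: outer_measure_ge0.
rewrite -EFinM mulrC; apply: piece => //.
  by move=> x y Fx Fy; apply: (le_trans (norm_le_enorm _)); exact: Fr.
have /andP[_] := rd i; rewrite ler_pdivlMr ?mulr_gt0//.
by rewrite mulrC -mulrA.
Qed.

End cone_lemma.

(** * Lebesgue density in R^m *)

Section lebesgue_density.
Context {R : realType} (m : nat) (m_gt0 : (0 < m)%N).
Local Notation L := (@hausdorff R m m).

Lemma bounded_hausdorff_lty (E : set 'rV[R]_m) (M : R) :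
  (forall u, E u -> `|u| <= M) -> (L E < +oo)%E.
Proof.
move=> EM; apply: (@le_lt_trans _ _ (L [set u | (`|u - 0| <= `|M| + 1)%R])).
  apply: le_outer_measure => u /EM /= uM; rewrite subr0 (le_trans uM)//.
  by rewrite (le_trans (ler_norm _))// lerDl.
by apply: le_lt_trans (cube_ub m_gt0 _ _) (ltry _); rewrite ltr_pwDr.
Qed.

(** Closed subsets of [G] are complements, in a box, of open sets containing the rest of the box.
    What they miss is the part of [G] in a hull of that rest, null because [G] splits the hull
    additively. *)
Lemma inner_compact (G : set 'rV[R]_m) (M : R) : L.-caratheodory G ->
  (forall u, G u -> `|u| <= M) ->
  exists C : (set 'rV[R]_m)^nat, [/\ forall i, closed (C i), forall i, C i `<=` G &
    L (G `\` \bigcup_i C i) = 0%E].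
Proof.
move=> mG GM; pose B := [set u : 'rV[R]_m | `|u - 0| <= M].
have [V [oV DV LV]] := @hausdorff_hull R m m m_gt0 (B `\` G)
  (@bounded_hausdorff_lty (B `\` G) M ltac:(by move=> u [+ _]; rewrite /B/= subr0)).
have Voo : (L (\bigcap_l V l) < +oo)%E.
  by rewrite LV; apply: (@bounded_hausdorff_lty _ M) => u [+ _]; rewrite /B/= subr0.
exists (fun l => B `\` V l); split.
- move=> l; apply: closedI; [exact: closed_norm_le|exact/open_closedC].
- move=> l u [Bu nVu]; apply: contrapT => nGu; apply: nVu.
  exact: (DV u (conj Bu nGu) l I).
- have sub : G `\` \bigcup_i (B `\` V i) `<=` \bigcap_l V l `&` G.
    move=> u [Gu nu]; split=> // l _; apply: contrapT => nV; apply: nu.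
    by exists l => //; split; [rewrite /B/= subr0; exact: GM|exact: nV].
  apply/le_anti; rewrite outer_measure_ge0 andbT.
  apply: (le_trans (le_outer_measure L _ _ sub)).
  have fin : L (B `\` G) \is a fin_num by rewrite -LV ge0_fin_numE ?outer_measure_ge0.
  rewrite -(leeD2rE _ _ fin) add0e -[leRHS]LV [leRHS](mG (\bigcap_l V l)).
  by rewrite leeD2l//; apply: le_outer_measure => u uD; split; [exact: DV|case: uD].
Qed.

(** The neighbourhoods of width 1/(l+1) of [C], with [C] removed, decrease to the empty set.
    Disjoint balls centred in [C], each with a fixed proportion outside [C], pack into such a
    remainder. *)
Lemma complement_density_null (C : set 'rV[R]_m) (M eta : R) : closed C ->
  (forall u, C u -> `|u| <= M) -> 0 < eta ->
  L [set t | C t /\ forall s0 : R, 0 < s0 -> exists2 s, 0 < s < s0 &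
     ((eta * s ^+ m)%:E <= L (nball t s `\` C))%E] = 0%E.
Proof.
move=> cC CM eta0; set E := [set t | _].
apply/le_anti; rewrite outer_measure_ge0 andbT.
apply/lee_addgt0Pr => e e0; rewrite ?add0r.
pose A : R := (2 * m%:R * 5) ^+ m.
have A0 : 0 < A by rewrite exprn_gt0// !mulr_gt0// ltr0n.
pose nb l : set 'rV[R]_m := \bigcup_(v in C) nball v l.+1%:R^-1.
have onb l : open (nb l) by apply: bigcup_open => v _; exact: open_nball.
have mC : L.-caratheodory C by exact: closed_caratheodory.
have mnb l : L.-caratheodory (nb l `\` C).
  by apply: caratheodory_measurable_setD => //; apply: open_caratheodory.
have [||||N NP] := @hausdorff_vanish R m m (fun l => nb l `\` C) (e * eta / A) mnb.
- apply: (@bounded_hausdorff_lty _ (M + 1)) => u [[v Cv]]; rewrite /nball/= invr1 => uv _.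
  have := CM v Cv; have := ler_normD (u - v) v; rewrite subrK; lra.
- move=> i j ij u [[v Cv uv] nC]; split=> //; exists v => //.
  apply: (lt_le_trans uv); by rewrite lef_pV2 ?posrE ?ltr0n// ler_nat ltnS.
- apply/seteqP; split=> // u h; have [_ nC] := h 0%N I; apply: nC.
  move/closed_nballP : cC; apply => d d0.
  have [l] := ltr_add_invr d0; rewrite add0r => ld.
  have [[v Cv uv] _] := h l I; exists v => //; rewrite distrC; exact: lt_trans ld.
- by rewrite divr_gt0// mulr_gt0.
have {}NP := NP N (leqnn N).
have H1 t : exists s, E t -> 0 < s <= 1 /\ s <= N.+1%:R^-1 /\
    ((eta * s ^+ m)%:E <= L (nball t s `\` C))%E.
  have [[Ct Et]|] := pselect (E t); last by exists 0.
  have [|s /andP[s0 sN] sC] := Et N.+1%:R^-1; first by rewrite invr_gt0.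
  exists s => _; split; last by rewrite ltW.
  rewrite s0 (le_trans (ltW sN))// invf_le1 ?ltr0n// ler1n//.
have [r rP] := choice H1.
have rE t : E t -> 0 < r t <= 1 by move=> /rP[].
have [c [rho [rhoP tB cov]]] := vitali_covering rE.
have rho0 i : 0 <= rho i by case: (rhoP i).
have TS := @cubes_cover_le R m m_gt0 c rho rho0 E 5 ltac:(lra).
apply: (le_trans (TS _)).
  move=> t Et; have [i [_ ui]] := cov t Et; exists i => //; apply: ui.
  by apply: nball_center; have /andP[] := rE t Et.
have MS : (eta%:E * \sum_(0 <= i <oo) (rho i ^+ m)%:E <= L (nb N `\` C))%E.
  rewrite -nneseriesZl => [|i _]; last by rewrite lee_fin exprn_ge0.
  have mB i : L.-caratheodory (nball (c i) (rho i)).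
    by apply: open_caratheodory => //; exact: open_nball.
  apply: (le_trans _ (hausdorff_disjoint_le (nb N `\` C) mB tB)).
  apply: lee_nneseries => [i _ _|i _].
    by rewrite -EFinM lee_fin mulr_ge0 ?exprn_ge0 ?(ltW eta0).
  have := rho0 i; rewrite le_eqVlt => /predU1P[ri0|ri].
    by rewrite -ri0 expr0n eqn0Ngt m_gt0 mule0 outer_measure_ge0.
  have [Tc rc] := (rhoP i).2 ri; have [_ [rN rL]] := rP _ Tc.
  rewrite -EFinM rc; apply: (le_trans rL).
  apply: le_outer_measure => u [uc nC]; split=> //; split=> //.
  exists (c i); [by case: Tc|exact: lt_le_trans rN].
move: (le_trans MS NP); set S := limn _.
have S0 : (0 <= S)%E by apply: nneseries_ge0 => i _ _; rewrite lee_fin exprn_ge0.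
case: S S0 => [s| |] //; last by move=> _; rewrite gt0_muley ?lte_fin// leye_eq.
rewrite -!EFinM !lee_fin -/A => s0 etas.
have : s <= e / A.
  by rewrite -(ler_pM2l eta0) (le_trans etas)// mulrA (mulrC eta).
by rewrite ler_pdivlMr// mulrC.
Qed.

End lebesgue_density.

(** * Varying one direction from a fixed base point *)

Section direction.
Context {R : realType} (m n : nat) (m_gt0 : (0 < m)%N).
Local Notation L := (@hausdorff R m m).
Local Notation H := (@hausdorff R n m).
Variables (Ks : (set 'rV[R]_n)^nat) (Y : set 'rV[R]_n).
Variables (w : 'rV[R]_n -> 'rV[R]_m) (e : 'rV[R]_n -> R).
Variables (M : R) (i0 i2 : nat) (c : R).
Hypotheses (M_gt0 : 0 < M) (c_gt0 : 0 < c).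
Hypothesis Ye : forall y, Y y -> e y != 0.
Let K := \bigcup_l Ks l.

(** Here t stands for b_j; the base point and the other vectors are fixed, and w y - e y t is the
    difference of the shear values at y and at the base point. Strips around the fibre have bounded
    density. *)
Definition bounded_strips : set 'rV[R]_m := [set t | forall i, (i0 <= i)%N ->
  (H (K `&` [set y | (`|w y - e y *: t| < dyad i)%R]) <= (M * dyad i ^+ m)%:E)%E].

(** A measurable substitute for the isolation of the base point in its fibre, which implies it by
    compactness ([isolated_nohit]): in each annulus a thin strip around the fibre is null. *)
Definition no_hit : set 'rV[R]_m := [set t | forall l1 l2, exists i,
  H (Ks l1 `&` [set y | [/\ Y y, dyad l2 <= `|e y| <= dyad i2 &
    `|w y - e y *: t| < dyad i]]) = 0%E].

(** The opening [dyad i] is arbitrarily small, while the length [dyad i'] may depend on it. *)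
Definition fat_cones : set 'rV[R]_m := [set t | forall i1, exists i i',
  [/\ (i1 <= i)%N, (i2 <= i')%N &
  ((c * (dyad i * dyad i') ^+ m)%:E < H (K `&`
    [set y | [/\ Y y, (`|w y - e y *: t| < dyad i * `|e y|)%R & (`|e y| < dyad i')%R]]))%E]].

Hypothesis measurable_good : L.-caratheodory (no_hit `&` bounded_strips).

(** Each t in [C] comes with a null strip, which contains the points hit by directions close to t,
    because |e y| <= 1. Vitali's theorem serves to extract countably many such t. *)
Let no_hit_null (C : set 'rV[R]_m) : C `<=` no_hit ->
  H (K `&` [set y | [/\ Y y, `|e y| <= dyad i2 & exists2 t, C t & w y = e y *: t]]) = 0%E.
Proof.
move=> Cn; pose Z l1 l2 := Ks l1 `&`
  [set y | [/\ Y y, dyad l2 <= `|e y| <= dyad i2 & exists2 t, C t & w y = e y *: t]].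
suff Z0 l1 l2 : H (Z l1 l2) = 0%E.
  apply/le_anti; rewrite outer_measure_ge0 andbT.
  apply: (@le_trans _ _ (H (\bigcup_l1 \bigcup_l2 Z l1 l2))).
    apply: le_outer_measure => y [[l1 _ yl1] [Yy ey [t Ct wt]]].
    have [l2 /ltW el2] : exists l2, dyad l2 < `|e y|.
      by apply: dyad_small; rewrite normr_gt0; exact: Ye.
    by exists l1 => //; exists l2 => //; split=> //; split; [|rewrite el2|exists t].
  apply: (le_trans (outer_measure_sigma_subadditive H _)).
  rewrite eseries0// => l1 _ _; apply/le_anti; rewrite outer_measure_ge0 andbT.
  apply: (le_trans (outer_measure_sigma_subadditive H _)).
  by rewrite eseries0// => l2 _ _; exact: Z0.
have H1 t : exists i, C t -> H (Ks l1 `&` [set y | [/\ Y y, dyad l2 <= `|e y| <= dyad i2 &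
    `|w y - e y *: t| < dyad i]]) = 0%E.
  have [/Cn/(_ l1 l2)[i ti]|] := pselect (C t); first by exists i.
  by exists 0%N.
have [i iP] := choice H1.
pose r t : R := dyad (i t) / 5.
have rC t : C t -> 0 < r t <= 1.
  by move=> _; rewrite /r; have := @dyad_gt0 R (i t); have := @dyad_le1 R (i t); lra.
have [cc [rho [rhoP _ cov]]] := vitali_covering rC.
apply/le_anti; rewrite outer_measure_ge0 andbT.
pose W j := if pselect (0 < rho j) then Ks l1 `&` [set y | [/\ Y y, dyad l2 <= `|e y| <= dyad i2 &
    `|w y - e y *: cc j| < dyad (i (cc j))]] else set0.
apply: (@le_trans _ _ (H (\bigcup_j W j))).
  apply: le_outer_measure => y [yl1 [Yy /andP[el2 ei2] [t Ct wt]]].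
  have [j [rj tj]] := cov t Ct; exists j => //.
  rewrite /W; case: pselect => //= _; split=> //; split=> //; first by rewrite el2.
  have [_ rhoj] := (rhoP j).2 rj.
  have := tj t (nball_center _ _); rewrite rhoj /r => /(_ _); have [/andP[rt _]] := rC t Ct.
  move=> /(_ rt); rewrite /nball/= (_ : 5 * (_ / 5) = dyad (i (cc j))); last by field.
  move=> tc; rewrite wt -scalerBr normrZ.
  apply: le_lt_trans tc; rewrite ler_piMl//.
  by apply: (le_trans ei2); exact: dyad_le1.
apply: (le_trans (outer_measure_sigma_subadditive H _)).
rewrite eseries0// => j _ _; rewrite /W; case: pselect => /= [rj|_]; last exact: outer_measure0.
by apply: iP; case: ((rhoP j).2 rj).
Qed.

(* Near a density point t of a compact C inside the good set, the directions seen from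
   the base point lie in the complement of C; covering this small complement by Whitney
   balls and bounding each ball by a strip around a nearby point of C shows that
   the cone around t is thin. *)
Let thin_at_density (C : set 'rV[R]_m) (t0 : 'rV[R]_m) (s0 : R) :
  closed C -> C `<=` no_hit `&` bounded_strips -> C t0 -> 0 < s0 ->
  (forall s, 0 < s < s0 ->
    (L (nball t0 s `\` C) <= (c / (M * 84 ^+ m) * s ^+ m)%:E)%E) ->
  ~ fat_cones t0.
Proof.
move=> cC Cgood Ct0 s00 dens /=.
(* 84 = 14 * 6: a strip of half-width 7 rho r is rounded up to at most 14 rho r, and packing in the
   ball of radius 2s bounds the sum of rho^m by (3 * 2s)^m * eta. *)
have eta0 : 0 < c / (M * 84 ^+ m) by rewrite divr_gt0// mulr_gt0// exprn_gt0.
set eta := c / _ in dens eta0.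
have [i1 i1s] : exists i1, dyad i1 < Num.min (s0 / 2) (dyad i0 / 7).
  by apply: dyad_small; rewrite lt_min !divr_gt0 ?dyad_gt0.
move: i1s; rewrite lt_min => /andP[i1s i1i0].
move=> /(_ i1)[i [i' [ii1 ii2]]]; apply/negP; rewrite -leNgt.
pose s : R := dyad i; pose r : R := dyad i'.
have s_gt0 : 0 < s by exact: dyad_gt0.
have r_gt0 : 0 < r by exact: dyad_gt0.
have ss0 : 2 * s < s0 by have := @dyad_le R _ _ ii1; rewrite -/s; lra.
have s7 : 7 * s <= dyad i0 by have := @dyad_le R _ _ ii1; rewrite -/s; lra.
have r1 : r <= 1 by exact: dyad_le1.
pose V := nball t0 s `\` C.
have C0 : C !=set0 by exists t0.
have dV u : V u -> 0 < dist C u <= s.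
  move=> [us nCu]; rewrite dist_gt0//=.
  by apply: (le_trans (dist_le _ Ct0)); apply: ltW.
have [cc [rho [rhoP tB cov]]] := vitali_covering dV.
have rho0 j : 0 <= rho j by case: (rhoP j).
have HS : (\sum_(0 <= j <oo) (rho j ^+ m)%:E <= ((6 * s) ^+ m * eta)%:E)%E.
  have h j : 0 < rho j -> nball (cc j) (rho j) `<=` nball t0 (2 * s) `\` C.
    move=> rj u; rewrite /nball/= => ur; have [[ct nC] rc] := (rhoP j).2 rj.
    have /andP[_ rs] := dV _ (conj ct nC); rewrite -rc in rs.
    split; first by have := ler_distD (cc j) u t0; move: ct; rewrite /nball/=; lra.
    by move=> Cu; have := dist_le (cc j) Cu; rewrite -rc distrC leNgt ur.
  apply: (le_trans (@cubes_disjoint_le R m m_gt0 cc rho rho0 _ tB h)).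
  have {}dens := dens (2 * s) _; rewrite mulr_gt0//= in dens.
  have p3 : (0 <= (3 ^+ m)%:E :> \bar R)%E by rewrite lee_fin exprn_ge0.
  apply: (le_trans (lee_wpmul2l p3 (dens ss0))).
  rewrite -EFinM lee_fin le_eqVlt; apply/orP; left; apply/eqP.
  by rewrite mulrCA -exprMn mulrC; congr (_ ^+ _ * _); ring.
(* The radius rho is the distance from the centre to [C], so a point v of [C] is within 2 rho of the
   centre, hence within 7 rho of every direction in the ball enlarged five times. *)
have H1 j : exists v, 0 < rho j -> C v /\ `|cc j - v| < 2 * rho j.
  have [rj|] := pselect (0 < rho j); last by exists 0.
  have [Vc rc] := (rhoP j).2 rj.
  have [|v Cv vc] := @dist_lt R m C (cc j) (2 * rho j) C0; first by rewrite -rc; lra.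
  by exists v.
have [v vP] := choice H1.
pose T j := if pselect (0 < rho j) then
  K `&` [set y | `|w y - e y *: v j| < 7 * rho j * r] else set0.
pose N := K `&` [set y | [/\ Y y, `|e y| <= dyad i2 & exists2 t, C t & w y = e y *: t]].
have HN : H N = 0%E by apply: no_hit_null => t /Cgood[].
apply: (@le_trans _ _ (H N + \sum_(0 <= j <oo) H (T j))%E); last first.
  rewrite HN add0e.
  apply: (@le_trans _ _ ((M * (14 * r) ^+ m)%:E * \sum_(0 <= j <oo) (rho j ^+ m)%:E)%E).
    rewrite -nneseriesZl => [|j _]; last by rewrite lee_fin exprn_ge0.
    apply: lee_nneseries => [j _ _|j _]; first exact: outer_measure_ge0.
    rewrite /T; case: pselect => /= [rj|_]; last first.
      by rewrite outer_measure0 -EFinM lee_fin !mulr_ge0 ?exprn_ge0 ?mulr_ge0 ?(ltW M_gt0) ?(ltW r_gt0).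
    have [Vc rc] := (rhoP j).2 rj; have /andP[_ rs] := dV _ Vc; rewrite -rc in rs.
    have [Cv _] := vP j rj; have [_ bs] := Cgood _ Cv.
    have t0' : 0 < 7 * rho j * r by rewrite !mulr_gt0.
    have ti0 : 7 * rho j * r <= dyad i0.
      apply: le_trans s7; rewrite -[leRHS]mulr1 ler_pM ?mulr_ge0 ?(ltW r_gt0)//.
      by lra.
    have [ii iii0 /andP[h1 h2]] := dyad_round t0' ti0.
    apply: (@le_trans _ _ (M * dyad ii ^+ m)%:E).
      apply: le_trans (bs ii iii0); apply: le_outer_measure => y [Ky /= yv].
      by split=> //=; exact: lt_le_trans h1.
    rewrite -EFinM lee_fin -mulrA ler_wpM2l ?(ltW M_gt0)// -exprMn.
    rewrite lerXn2r ?nnegrE ?(ltW (dyad_gt0 _)) ?mulr_ge0 ?(ltW r_gt0)//.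
    by move: h2; rewrite (_ : 2 * (7 * rho j * r) = 14 * r * rho j)//; ring.
  have p : (0 <= (M * (14 * r) ^+ m)%:E :> \bar R)%E.
    by rewrite lee_fin mulr_ge0 ?exprn_ge0 ?mulr_ge0 ?(ltW M_gt0) ?(ltW r_gt0).
  apply: (le_trans (lee_wpmul2l p HS)).
  rewrite -EFinM lee_fin le_eqVlt; apply/orP; left; apply/eqP.
  have -> : M * (14 * r) ^+ m * ((6 * s) ^+ m * eta) = M * eta * ((14 * r) ^+ m * (6 * s) ^+ m).
    by ring.
  rewrite -exprMn (_ : 14 * r * (6 * s) = 84 * (s * r)); last by ring.
  rewrite exprMn mulrA; congr (_ * _); rewrite /eta; field.
  by rewrite gt_eqF ?exprn_gt0//= gt_eqF.
apply: (@le_trans _ _ (H (N `|` \bigcup_j T j))); last first.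
  apply: (le_trans (outer_measureU2 _ _ _)); rewrite leeD2l//.
  exact: (outer_measure_sigma_subadditive H).
apply: le_outer_measure => y [Ky [Yy ys er]].
have ey0 := Ye Yy; have ney0 : 0 < `|e y| by rewrite normr_gt0.
pose t := (e y)^-1 *: w y.
have wt : w y = e y *: t by rewrite scalerA divff// scale1r.
have [Ct|nCt] := pselect (C t).
  left; split=> //; split=> //; last by exists t.
  by apply: (le_trans (ltW er)); exact: dyad_le.
have Vt : V t.
  split=> //; rewrite /nball/= -(ltr_pM2l ney0) -normrZ scalerBr -wt mulrC.
  exact: ys.
right; have [j [rj tj]] := cov t Vt; exists j => //.
rewrite /T; case: pselect => //= _; split=> //=.
have [_ vc] := vP j rj.
have /andP[dt _] := dV t Vt.
have := tj t (nball_center _ dt); rewrite /nball/= => tc.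
rewrite wt -scalerBr normrZ mulrC; apply: ltr_pM => //.
by have := ler_distD (cc j) t (v j); lra.
Qed.

(** Bounded parts of the good set are exhausted, up to null sets, by closed sets; at almost every
    point of such a set its complement has density 0, and [thin_at_density] applies. *)
Lemma fat_cones_null : L ((no_hit `&` bounded_strips) `&` fat_cones) = 0%E.
Proof.
set G := no_hit `&` bounded_strips.
suff bounded k : L (G `&` fat_cones `&` [set u | `|u - 0| <= k%:R]) = 0%E.
  apply/le_anti; rewrite outer_measure_ge0 andbT.
  apply: (@le_trans _ _ (L (\bigcup_k (G `&` fat_cones `&` [set u | (`|u - 0| <= k%:R)%R])))).
    apply: le_outer_measure => u uE; exists (Num.bound `|u - 0|) => //; split=> //=.
    exact: (ltW (archi_boundP _)).
  apply: (le_trans (outer_measure_sigma_subadditive L _)).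
  by rewrite eseries0// => i _ _; exact: bounded.
pose Gk := G `&` [set u | `|u - 0| <= k%:R].
have mGk : L.-caratheodory Gk.
  apply: caratheodory_measurable_setI => //; apply: closed_caratheodory => //.
  exact: closed_norm_le.
have Gkb u : Gk u -> `|u| <= k%:R by move=> [_ /=]; rewrite subr0.
have [C [cC CG CL]] := inner_compact m_gt0 mGk Gkb.
have eta0 : 0 < c / (M * 84 ^+ m) by rewrite divr_gt0// mulr_gt0// exprn_gt0.
pose E i := [set t | C i t /\ forall s0 : R, 0 < s0 -> exists2 s, 0 < s < s0 &
     ((c / (M * 84 ^+ m) * s ^+ m)%:E <= L (nball t s `\` C i))%E].
have E0 i : L (E i) = 0%E.
  by apply: (@complement_density_null _ _ m_gt0 _ k%:R) => // u /CG/Gkb.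
apply/le_anti; rewrite outer_measure_ge0 andbT.
apply: (@le_trans _ _ (L ((Gk `\` \bigcup_i C i) `|` \bigcup_i E i))).
  apply: le_outer_measure => t [[Gt ft] kt].
  have [[i _ Ct]|nC] := pselect ((\bigcup_i C i) t); last by left; split.
  right; exists i => //; split=> // s0 s00; apply: contrapT => ns.
  have CiG : C i `<=` G by move=> u /CG[].
  apply: (@thin_at_density (C i) t s0 (@cC i) CiG Ct s00 _ ft).
  move=> s ss; rewrite leNgt; apply/negP => lt; apply: ns.
  by exists s => //; exact: ltW.
apply: (le_trans (outer_measureU2 _ _ _)); rewrite [X in (X + _)%E]CL add0e.
apply: (le_trans (outer_measure_sigma_subadditive L _)).
by rewrite eseries0// => i _ _; exact: E0.
Qed.

End direction.

(** * Generic shears *)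

Section fubini_null.
Context {R : realType} d1 d2 (T1 : measurableType d1) (T2 : measurableType d2).
Variables (mu : {sigma_finite_measure set T1 -> \bar R})
  (nu : {sigma_finite_measure set T2 -> \bar R}).
Implicit Types A : set (T1 * T2).

Lemma product_null A : (forall x, nu [set t | A (x, t)] = 0%E) -> (mu \x nu)%E A = 0%E.
Proof.
move=> A0; rewrite /product_measure1; apply: integral0_eq => x _ /=.
rewrite -[RHS](A0 x); congr (nu _); apply/seteqP; split=> t.
  by rewrite /xsection/= inE.
by rewrite /xsection/= inE.
Qed.

Lemma product_null_section A : measurable A -> (mu \x nu)%E A = 0%E ->
  nu.-negligible [set t | mu [set x | A (x, t)] <> 0%E].
Proof.
move=> mA A0.
have E : (mu \x nu)%E A = (mu \x^ nu)%E A.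
  apply: (@product_measure_unique _ _ _ _ _ mu nu (mu \x^ nu)%E) => // B C mB mC.
  exact: product_measure2E.
have mf := measurable_fun_ysection mu mA.
have : (\int[nu]_t `|(mu \o ysection A) t| = 0)%E.
  rewrite -A0 E /product_measure2; apply: eq_integral => t _.
  by rewrite gee0_abs.
move/(ae_eq_integral_abs _ measurableT mf).1 => [N [mN N0 subN]].
exists N; split=> // t /= At; apply: subN => /= h; apply: At.
rewrite -[RHS](h I) /=; congr (mu _); apply/seteqP; split=> x; by rewrite /ysection/= inE.
Qed.

End fubini_null.

Section finite_product.
Context {R : realType} d1 d2 (T1 : measurableType d1) (T2 : measurableType d2).
Variables (mu : {finite_measure set T1 -> \bar R}) (nu : {finite_measure set T2 -> \bar R}).

(** The product is kept as a finite measure, so that the induction in [fubini_columns] can multiply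
    again. *)
Definition finite_product : set (T1 * T2) -> \bar R := (mu \x nu)%E.

HB.instance Definition _ := Measure.on finite_product.

Let finite_product_fin : fin_num_fun finite_product.
Proof.
move=> A mA; rewrite ge0_fin_numE//.
apply: (@le_lt_trans _ _ (finite_product setT)); first by apply: le_measure; rewrite ?inE.
rewrite /finite_product -setXTT product_measure1E//.
by rewrite lte_mul_pinfty// ?fin_num_measure// -ge0_fin_numE// fin_num_measure.
Qed.

HB.instance Definition _ := Measure_isFinite.Build _ _ _ finite_product finite_product_fin.

End finite_product.

Section columns.
Context {d2} {T2 : measurableType d2}.

Definition set_column (b : nat -> T2) (j : nat) (t : T2) : nat -> T2 :=
  fun i => if i == j then t else b i.

(* Joint measurability of a set of pairs (point, columns), phrased without a
   product sigma-algebra on the countable family of columns. *)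
Definition columns_measurable d (X : measurableType d) (B : X -> (nat -> T2) -> Prop) :=
  forall d' (Z : measurableType d') (alpha : Z -> X) (beta : nat -> Z -> T2),
    measurable_fun setT alpha -> (forall j, measurable_fun setT (beta j)) ->
    measurable [set z | B (alpha z) (beta^~ z)].

(** Induction on the number of columns: the last one joins the point in the base space, X becoming X
    * T2. Slices in column [k] are null by hypothesis and those in earlier columns by induction, so
    for almost every value of the last column all sections are null. *)
Lemma fubini_columns {R : realType} (k : nat) (nu : {finite_measure set T2 -> \bar R})
    (D : set T2) d (X : measurableType d) (mu : {finite_measure set X -> \bar R})
    (B : nat -> X -> (nat -> T2) -> Prop) (jj : nat -> nat) (t0 : T2) :
  measurable D -> (0 < nu D)%E ->
  (forall i, columns_measurable (B i)) ->
  (forall i, (jj i < k)%N -> forall x b, nu [set t | B i x (set_column b (jj i) t)] = 0%E) ->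
  exists b, (forall j, (j < k)%N -> D (b j)) /\
    forall i, (jj i < k)%N -> mu [set x | B i x b] = 0%E.
Proof.
move=> mD D0; elim: k d X mu B jj => [|k IH] d X mu B jj mB B0.
  by exists (fun=> t0).
pose B' i (xt : X * T2) b := B i xt.1 (set_column b k xt.2).
have mB' i : columns_measurable (B' i).
  move=> d' Z al be mal mbe; apply: mB.
    by apply: measurableT_comp.
  move=> j; rewrite /set_column; case: eqP => // _.
  by apply: measurableT_comp.
pose pm : {finite_measure set (X * T2)%type -> \bar R} := finite_product mu nu.
have [|b [bD bB]] := IH _ _ pm B' jj mB'.
  move=> i ik [x t] b; rewrite -[RHS](B0 i (ltnW ik) x (set_column b k t)).
  congr (nu _); apply/seteqP; split=> s; rewrite /B'/=;
    rewrite (_ : set_column (set_column b (jj i) s) k t = set_column (set_column b k t) (jj i) s)//;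
    apply/funext => j; rewrite /set_column; case: eqP => [->|]//;
    by rewrite gtn_eqF.
have mBb i : measurable [set xt : X * T2 | B' i xt b].
  exact: (mB' i _ _ id (fun j=> cst (b j))).
have null i : (jj i < k.+1)%N -> nu.-negligible [set t | mu [set x | B i x (set_column b k t)] <> 0%E].
  move=> ik; apply: (product_null_section (mBb i)).
  move: ik; rewrite ltnS leq_eqVlt => /predU1P[ik|ik]; last exact: bB.
  apply: product_null => x; rewrite -[RHS](B0 i _ x b); last by rewrite ik.
  by rewrite ik.
(* Only countably many null sets of t are excluded, and [D] has positive measure. *)
have [t Dt tB] : exists2 t, D t & forall i, (jj i < k.+1)%N ->
    mu [set x | B i x (set_column b k t)] = 0%E.
  apply: contrapT => nt; have : nu.-negligible D.
    apply: (@negligibleS _ _ _ nu (\bigcup_i [set t | (jj i < k.+1)%N /\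
        mu [set x | B i x (set_column b k t)] <> 0%E]) D).
      move=> t Dt; apply: contrapT => nU; apply: nt; exists t => // i ik.
      by apply: contrapT => ni; apply: nU; exists i.
    apply: negligible_bigcup => i; have [ik|ik] := boolP (jj i < k.+1)%N.
      by apply: (negligibleS _ (null i ik)) => t [].
    by apply: (negligibleS _ (negligible_set0 nu)) => t [].
  by move=> /(negligibleP nu mD).1 nuD; rewrite nuD ltxx in D0.
exists (set_column b k t); split=> // j jk; rewrite /set_column; case: eqP => // /eqP jk'.
by apply: bD; rewrite ltn_neqAle jk' -ltnS.
Qed.

End columns.

(** * Measurability of conditions on sections *)

Section measurable_tools.
Context {R : realType}.

Lemma measurable_row_norm d (Z : measurableType d) p (f : Z -> 'rV[R]_p) :
  (forall i, measurable_fun setT (fun z => f z ord0 i)) ->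
  measurable_fun setT (fun z => `|f z|).
Proof.
move=> mf.
have -> : (fun z => `|f z|) = (fun z => \big[Num.max/0]_(ij <- index_enum ('I_1 * 'I_p)%type) `|f z ij.1 ij.2|).
  by apply/funext => z; rewrite [LHS]/Num.norm/= mx_normrE.
elim: (index_enum _) => [|ij s IH].
  by under eq_fun do rewrite big_nil; exact: measurable_cst.
under eq_fun do rewrite big_cons.
apply: measurable_maxr => //; apply: measurableT_comp => //.
by rewrite (ord1 ij.1).
Qed.

Lemma measurable_ltr_set d (Z : measurableType d) (f g : Z -> R) :
  measurable_fun setT f -> measurable_fun setT g -> measurable [set z | f z < g z].
Proof.
move=> mf mg; have := measurable_fun_ltr mf mg measurableT (Y:=[set true]) I.
by rewrite setTI.
Qed.

Lemma measurable_ler_set d (Z : measurableType d) (f g : Z -> R) :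
  measurable_fun setT f -> measurable_fun setT g -> measurable [set z | f z <= g z].
Proof.
move=> mf mg; have := measurable_fun_ler mf mg measurableT (Y:=[set true]) I.
by rewrite setTI.
Qed.

Lemma measurable_lipschitz n m (f : 'rV[R]_n -> R) (C : R) : (0 < m)%N ->
  (forall x y, `|f x - f y| <= C * `|x - y|) ->
  measurable_fun setT (f : caratheodory_type (hausdorff_outer n m) -> R).
Proof.
move=> m0 fC; apply: (measurability _ (RGenOInfty.measurableE R)).
move=> _ [_ [a ->] <-]; rewrite setTI; apply: (open_caratheodory m0).
apply/open_nballP => x /=; rewrite in_itv/= andbT => ax.
have K0 : 0 < `|C| + 1 by rewrite ltr_wpDl.
exists ((f x - a) / (`|C| + 1)); first by rewrite divr_gt0// subr_gt0.
move=> y; rewrite /nball/= ltr_pdivlMr// in_itv/= andbT => yx.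
have := fC y x; have : C * `|y - x| <= (`|C| + 1) * `|y - x|.
  by rewrite ler_wpM2r// (le_trans (ler_norm _))// lerDl.
by rewrite ler_norml => ? /andP[? ?]; lra.
Qed.

End measurable_tools.

Section sections.
Context {R : realType} (n m : nat) (m_gt0 : (0 < m)%N).
Local Notation H := (@hausdorff R n m).
Local Notation T1 := (caratheodory_type (hausdorff_outer n m : set 'rV[R]_n -> \bar R)).
Variable K : set 'rV[R]_n.
Hypotheses (mK : H.-caratheodory K) (Koo : (H K < +oo)%E).

(** Restricting to [K] gives a finite measure, to which Fubini's theorem applies. *)
Definition hausdorff_on : set T1 -> \bar R :=
  mfrestr (mK : measurable (K : set T1)) (Koo : (hausdorff_measure n m K < +oo)%E).

HB.instance Definition _ := Measure.on hausdorff_on.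
HB.instance Definition _ := FiniteMeasure.on hausdorff_on.

Lemma hausdorff_onE (A : set 'rV[R]_n) : hausdorff_on A = H (K `&` A).
Proof. by rewrite /hausdorff_on /mfrestr /mrestr setIC. Qed.

Lemma measurable_hausdorff_section d (Z : measurableType d) (A : set (Z * T1)) :
  measurable A -> measurable_fun setT (fun z => H (K `&` [set y | A (z, y)])).
Proof.
move=> mA; have := @measurable_fun_xsection _ _ _ _ _ hausdorff_on A mA.
apply: eq_measurable_fun => z _ /=; rewrite hausdorff_onE; congr (H (_ `&` _)).
by apply/seteqP; split=> y; rewrite /xsection/= inE.
Qed.

Lemma measurable_section_le d (Z : measurableType d) (A : set (Z * T1)) (v : \bar R) :
  measurable A -> measurable [set z | (H (K `&` [set y | A (z, y)]) <= v)%E].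
Proof.
move=> /measurable_hausdorff_section mf.
by have := measurable_lee measurableT mf (measurable_cst v); rewrite setTI.
Qed.

Lemma measurable_section_lt d (Z : measurableType d) (A : set (Z * T1)) (v : \bar R) :
  measurable A -> measurable [set z | (v < H (K `&` [set y | A (z, y)]))%E].
Proof.
move=> /measurable_hausdorff_section mf.
by have := measurable_lte measurableT (measurable_cst v) mf; rewrite setTI.
Qed.

End sections.

Section countable_quantifiers.
Context d (Z : measurableType d).

Lemma measurable_forall_nat (F : nat -> set Z) :
  (forall i, measurable (F i)) -> measurable [set z | forall i, F i z].
Proof.
move=> mF; have -> : [set z | forall i, F i z] = \bigcap_i F i.
  by apply/seteqP; split=> z Fz i; [move=> _|]; exact: Fz.
exact: bigcapT_measurable.
Qed.

Lemma measurable_exists_nat (F : nat -> set Z) :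
  (forall i, measurable (F i)) -> measurable [set z | exists i, F i z].
Proof.
move=> mF; have -> : [set z | exists i, F i z] = \bigcup_i F i.
  by apply/seteqP; split=> z [i Fz]; exists i.
exact: bigcupT_measurable.
Qed.

Lemma measurable_forall_ord k (F : 'I_k -> set Z) :
  (forall i, measurable (F i)) -> measurable [set z | forall i, F i z].
Proof.
move=> mF; have -> : [set z | forall i, F i z] = \bigcap_(i in setT) F i.
  by apply/seteqP; split=> z Fz i; [move=> _|]; exact: Fz.
exact: fin_bigcap_measurable.
Qed.

Lemma measurable_imply (b : bool) (F : set Z) :
  measurable F -> measurable [set z | b -> F z].
Proof.
case: b => mF; last by rewrite (_ : [set z | _] = setT)//; apply/seteqP; split.
by rewrite (_ : [set z | _] = F)//; apply/seteqP; split=> [z Fz|z Fz _]; exact: Fz.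
Qed.

Lemma measurable_and (b : bool) (F : set Z) :
  measurable F -> measurable [set z | b /\ F z].
Proof.
case: b => mF; last by rewrite (_ : [set z | _] = set0)//; apply/seteqP; split=> // z [].
by rewrite (_ : [set z | _] = F)//; apply/seteqP; split=> // z [].
Qed.

End countable_quantifiers.

(** * Projection theorem for shears *)

Section shears.
Context {R : realType} (m n k : nat) (m_gt0 : (0 < m)%N).
Local Notation L := (@hausdorff R m m).
Local Notation H := (@hausdorff R n m).
Local Notation T1 := (caratheodory_type (hausdorff_outer n m : set 'rV[R]_n -> \bar R)).
Local Notation T2 := (caratheodory_type (hausdorff_outer m m : set 'rV[R]_m -> \bar R)).
Variables (Ks : (set 'rV[R]_n)^nat) (p : 'rV[R]_n -> 'rV[R]_m) (Q : 'rV[R]_n -> 'rV[R]_k).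
Variable C : R.
Let K := \bigcup_l Ks l.
Hypotheses (Kcompact : forall l, compact (Ks l)) (Koo : (H K < +oo)%E).
Hypotheses (Knull : graph_null m K) (C_gt0 : 0 < C).
Hypothesis p_lip : forall x y, `|p x - p y| <= C * `|x - y|.
Hypothesis Q_lip : forall x y, `|Q x - Q y| <= C * `|x - y|.
Hypothesis Q_colip : forall l, exists c, forall x y, Ks l x -> Ks l y ->
  `|x - y| <= c * `|Q x - Q y|.

Definition shear (b : nat -> 'rV[R]_m) (x : 'rV[R]_n) : 'rV[R]_m :=
  p x - \sum_(j < k) Q x ord0 j *: b j.

Let D b a y := shear b y - shear b a.
Let Dq j a y := Q y ord0 j - Q a ord0 j.

(** Where coordinate j realizes |Q y - Q a|. A cone in [Q] splits into [k] such parts, and in each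
    one the vector b_j alone can be varied. *)
Let dominant j a := [set y | (forall i, `|Dq i a y| <= `|Dq j a y|) /\ 0 < `|Dq j a y|].

Let strips (M : R) i0 (a : T1) (b : nat -> T2) := forall i, (i0 <= i)%N ->
  (H (K `&` [set y | (`|D b a y| < dyad i)%R]) <= (M * dyad i ^+ m)%:E)%E.

Let nohit j i2 (a : T1) (b : nat -> T2) := forall l1 l2, exists i,
  (H (Ks l1 `&` [set y | [/\ dominant j a y, (dyad l2 <= `|Dq j a y| <= dyad i2)%R &
    (`|D b a y| < dyad i)%R]]) <= 0)%E.

Let fat j i2 (c : R) (a : T1) (b : nat -> T2) := forall i1, exists i i',
  [/\ (i1 <= i)%N, (i2 <= i')%N &
  ((c * (dyad i * dyad i') ^+ m)%:E < H (K `&`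
    [set y | [/\ dominant j a y, (`|D b a y| < dyad i * `|Dq j a y|)%R & (`|Dq j a y| < dyad i')%R]]))%E].

Let K_mes l : H.-caratheodory (Ks l).
Proof. by apply: closed_caratheodory => //; exact: compact_row_closed. Qed.

Let mK : H.-caratheodory K.
Proof. by apply: caratheodory_measurable_bigcup => l; exact: K_mes. Qed.

Let Ksoo l : (H (Ks l) < +oo)%E.
Proof. by apply: le_lt_trans Koo; apply: le_outer_measure => x Kx; exists l. Qed.

Let coord_lip q (f : 'rV[R]_n -> 'rV[R]_q) (i : 'I_q) :
  (forall x y, `|f x - f y| <= C * `|x - y|) ->
  forall x y, `|f x ord0 i - f y ord0 i| <= C * `|x - y|.
Proof.
move=> fC x y; apply: le_trans (fC x y).
by have := coord_le_norm (f x - f y) i; rewrite !mxE.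
Qed.

Section joint_measurability.
Variables (d : measure_display) (Z : measurableType d).
Variables (alpha : Z -> T1) (beta : nat -> Z -> T2).
Hypotheses (malpha : measurable_fun setT alpha) (mbeta : forall j, measurable_fun setT (beta j)).

Let mcoord q (f : 'rV[R]_n -> 'rV[R]_q) (i : 'I_q) :
  (forall x y, `|f x - f y| <= C * `|x - y|) ->
  measurable_fun setT (fun zy : Z * T1 => f zy.2 ord0 i - f (alpha zy.1) ord0 i).
Proof.
move=> fC; have mf := @measurable_lipschitz R n m (fun x => f x ord0 i) C m_gt0 (coord_lip i fC).
apply: measurable_funB; first exact: (measurableT_comp mf measurable_snd).
exact: (measurableT_comp mf (measurableT_comp malpha measurable_fst)).
Qed.

Let mDq j : measurable_fun setT (fun zy : Z * T1 => `|Dq j (alpha zy.1) zy.2|).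
Proof. by apply: measurableT_comp => //; exact: mcoord. Qed.

Let mD : measurable_fun setT (fun zy : Z * T1 => `|D (beta^~ zy.1) (alpha zy.1) zy.2|).
Proof.
apply: measurable_row_norm => i.
have -> : (fun zy : Z * T1 => D (beta^~ zy.1) (alpha zy.1) zy.2 ord0 i) = fun zy =>
  (p zy.2 ord0 i - p (alpha zy.1) ord0 i) -
    \sum_(j < k) (Q zy.2 ord0 j - Q (alpha zy.1) ord0 j) * (beta j zy.1 : 'rV_m) ord0 i.
  apply/funext => zy; rewrite /D /shear !mxE !summxE !opprB.
  rewrite (eq_bigr (fun j : 'I_k => Q zy.2 ord0 j * (beta j zy.1 : 'rV_m) ord0 i)); last first.
    by move=> j _; rewrite mxE.
  rewrite [X in _ + (X - _)](eq_bigr (fun j : 'I_k => Q (alpha zy.1) ord0 j * (beta j zy.1 : 'rV_m) ord0 i)); last first.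
    by move=> j _; rewrite mxE.
  under [in RHS]eq_bigr do rewrite mulrBl.
  by rewrite sumrB; ring.
apply: measurable_funB; first exact: mcoord.
apply: measurable_sum => j; apply: measurable_funM; first exact: mcoord.
have mc : measurable_fun setT ((fun u : 'rV[R]_m => u ord0 i) : T2 -> R).
  apply: (@measurable_lipschitz R m m (fun u => u ord0 i) 1 m_gt0) => x y.
  by have := coord_le_norm (x - y) i; rewrite !mxE mul1r.
exact: (measurableT_comp mc (measurableT_comp (mbeta j) measurable_fst)).
Qed.

Let mdominant j : measurable [set zy : Z * T1 | dominant j (alpha zy.1) zy.2].
Proof.
apply: measurableI; last by apply: measurable_ltr_set => //; exact: mDq.
by apply: measurable_forall_ord => i; apply: measurable_ler_set; exact: mDq.
Qed.

Lemma measurable_strips M i0 : measurable [set z | strips M i0 (alpha z) (beta^~ z)].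
Proof.
apply: measurable_forall_nat => i; apply: measurable_imply.
apply: (@measurable_section_le R n m K mK Koo _ Z
  [set zy | `|D (beta^~ zy.1) (alpha zy.1) zy.2| < dyad i]).
exact: measurable_ltr_set.
Qed.

Lemma measurable_nohit j i2 : measurable [set z | nohit j i2 (alpha z) (beta^~ z)].
Proof.
apply: measurable_forall_nat => l1; apply: measurable_forall_nat => l2.
apply: measurable_exists_nat => i.
apply: (@measurable_section_le R n m (Ks l1) (K_mes l1) (Ksoo l1) _ Z
  [set zy | [/\ dominant j (alpha zy.1) zy.2, dyad l2 <= `|Dq j (alpha zy.1) zy.2| <= dyad i2 &
    `|D (beta^~ zy.1) (alpha zy.1) zy.2| < dyad i]]).
set A := [set zy | _]; have -> : A = [set zy | dominant j (alpha zy.1) zy.2] `&`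
    ([set zy | dyad l2 <= `|Dq j (alpha zy.1) zy.2|] `&` [set zy | `|Dq j (alpha zy.1) zy.2| <= dyad i2]) `&`
    [set zy | `|D (beta^~ zy.1) (alpha zy.1) zy.2| < dyad i].
  apply/seteqP; split=> zy; first by move=> [? /andP[? ?] ?].
  by move=> [[? [/= ? ?]] ?]; split=> //; apply/andP.
apply: measurableI; last exact: measurable_ltr_set.
apply: measurableI; first exact: mdominant.
by apply: measurableI; apply: measurable_ler_set.
Qed.

Lemma measurable_fat j i2 c : measurable [set z | fat j i2 c (alpha z) (beta^~ z)].
Proof.
apply: measurable_forall_nat => i1; apply: measurable_exists_nat => i.
apply: measurable_exists_nat => i'.
pose A := [set zy : Z * T1 | [/\ dominant j (alpha zy.1) zy.2,
  `|D (beta^~ zy.1) (alpha zy.1) zy.2| < dyad i * `|Dq j (alpha zy.1) zy.2| &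
  `|Dq j (alpha zy.1) zy.2| < dyad i']].
have mA : measurable A.
  have -> : A = [set zy | dominant j (alpha zy.1) zy.2] `&`
    [set zy | `|D (beta^~ zy.1) (alpha zy.1) zy.2| < dyad i * `|Dq j (alpha zy.1) zy.2|] `&`
    [set zy | `|Dq j (alpha zy.1) zy.2| < dyad i'].
    by apply/seteqP; split=> zy; [move=> []|move=> [[]]].
  apply: measurableI; last exact: measurable_ltr_set.
  apply: measurableI; first exact: mdominant.
  by apply: measurable_ltr_set => //; apply: measurable_funM.
have := measurable_and (i2 <= i')%N (@measurable_section_lt R n m K mK Koo _ Z A
  (c * (dyad i * dyad i') ^+ m)%:E mA).
move=> /(measurable_and (i1 <= i)%N).
by congr measurable; apply/seteqP; split=> z; [move=> [? []]|move=> []].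
Qed.

End joint_measurability.

Let bad j (M : R) i0 i2 (c : R) a b := [/\ nohit j i2 a b, strips M i0 a b & fat j i2 c a b].

Let measurable_bad j M i0 i2 c : columns_measurable (bad j M i0 i2 c).
Proof.
move=> d' Z al be mal mbe.
have -> : [set z | bad j M i0 i2 c (al z) (be^~ z)] = [set z | nohit j i2 (al z) (be^~ z)] `&`
    [set z | strips M i0 (al z) (be^~ z)] `&` [set z | fat j i2 c (al z) (be^~ z)].
  by apply/seteqP; split=> z; [move=> []|move=> [[]]].
apply: measurableI; last exact: measurable_fat.
by apply: measurableI; [exact: measurable_nohit|exact: measurable_strips].
Qed.

Let D_set_column (j : 'I_k) (b : nat -> T2) (t : T2) (a y : 'rV[R]_n) :
  D (set_column b j t) a y = D (set_column b j 0) a y - Dq j a y *: t.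
Proof.
have E x s : shear (set_column b j s) x = shear (set_column b j 0) x - Q x ord0 j *: s.
  rewrite /shear (bigD1 j)//= [in RHS](bigD1 j)//= /set_column eqxx scaler0 add0r.
  rewrite opprD addrA [RHS]addrAC; congr (_ - _ - _); apply: eq_bigr => i ij.
  by rewrite (_ : (i == j :> nat) = false)//; exact: negbTE ij.
rewrite /D (E y t) (E a t) /Dq scalerBl.
set u := shear _ y; set v := shear _ a; set r := _ *: _; set r' := _ *: _.
by rewrite opprD addrACA -opprD.
Qed.

(** By [D_set_column] the shear difference is affine in the j-th vector, so slices of [bad] lie in
    the sets treated by [fat_cones_null]. *)
Let bad_slice_null (j : 'I_k) M i0 i2 c a b : 0 < M -> 0 < c ->
  L [set t | bad j M i0 i2 c a (set_column b j t)] = 0%E.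
Proof.
move=> M0 c0; pose w y := D (set_column b j 0) a y; pose e y := Dq j a y.
have Ye y : dominant j a y -> e y != 0 by move=> [_]; rewrite normr_gt0.
have DE t y : D (set_column b j t) a y = w y - e y *: t by exact: D_set_column.
have nohitE : no_hit Ks (dominant j a) w e i2 = [set t | nohit j i2 a (set_column b j t)].
  apply/seteqP; split=> t ht l1 l2; have [i hi] := ht l1 l2; exists i.
    apply: le_trans (_ : 0 <= 0)%E => //; rewrite -[X in (_ <= X)%E]hi.
    by apply: le_outer_measure => y [yl [Yy ey]]; rewrite DE => Dy; split.
  apply/le_anti; rewrite outer_measure_ge0 andbT; apply: le_trans hi.
  by apply: le_outer_measure => y [yl [Yy ey Dy]]; split=> //; split=> //; rewrite DE.
have stripsE : bounded_strips Ks w e M i0 = [set t | strips M i0 a (set_column b j t)].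
  apply/seteqP; split=> t ht i ii0; apply: le_trans (ht i ii0);
    by apply: le_outer_measure => y [yl]; rewrite /= DE.
have fatE t : fat j i2 c a (set_column b j t) -> fat_cones Ks (dominant j a) w e i2 c t.
  move=> ft i1; have [i [i' [h1 h2 h3]]] := ft i1; exists i, i'; split; [exact: h1|exact: h2|].
  apply: (lt_le_trans h3); apply: le_outer_measure => y [yl [Yy hD hq]].
  split; first exact: yl.
  by split; [exact: Yy|rewrite -DE; exact: hD|exact: hq].
have mgood : L.-caratheodory (no_hit Ks (dominant j a) w e i2 `&` bounded_strips Ks w e M i0).
  have mcol : forall i, measurable_fun setT (fun t : T2 => set_column b j t i : T2).
    by move=> i; rewrite /set_column; case: eqP => _; [exact: measurable_id|exact: measurable_cst].
  rewrite nohitE stripsE; apply: caratheodory_measurable_setI.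
    exact: (@measurable_nohit _ T2 (cst a) (fun i t => set_column b j t i) (measurable_cst _) mcol).
  exact: (@measurable_strips _ T2 (cst a) (fun i t => set_column b j t i) (measurable_cst _) mcol).
have := @fat_cones_null R m n m_gt0 Ks (dominant j a) w e M i0 i2 c M0 c0 Ye mgood.
move=> F0; apply/le_anti; rewrite outer_measure_ge0 andbT -[leRHS]F0.
apply: le_outer_measure => t [nt st ft]; split; last exact: fatE.
by split; [rewrite nohitE|rewrite stripsE].
Qed.

Let exists_good (eps : R) : 0 < eps -> exists b : nat -> 'rV[R]_m,
  (forall j, (j < k)%N -> `|b j| < eps) /\
  forall (j : 'I_k) (M i0 i2 ic : nat),
    H (K `&` [set a | bad j M.+1%:R i0 i2 ic.+1%:R^-1 a b]) = 0%E.
Proof.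
move=> eps0.
pose B0 : set T2 := nball 0 eps.
have mB0 : measurable B0 by apply: open_caratheodory => //; exact: open_nball.
have Boo : (L (nball 0 eps) < +oo)%E.
  by apply: le_lt_trans (nball_ub m_gt0 _ (ltW eps0)) (ltry _).
pose nu : {finite_measure set T2 -> \bar R} := hausdorff_on mB0 Boo.
pose mu : {finite_measure set T1 -> \bar R} := hausdorff_on mK Koo.
(* All parameters are packed into one natural number. An invalid code carries the empty condition
   and the out-of-range column [k]. *)
pose code i : option ('I_k * nat * nat * nat * nat) := unpickle i.
pose B i (a : T1) (b : nat -> T2) := if code i is Some (j, M, i0, i2, ic) then
  bad j M.+1%:R i0 i2 ic.+1%:R^-1 a b else False.
pose jj i : nat := if code i is Some (j, _, _, _, _) then j else k.
have mB i : columns_measurable (B i).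
  rewrite /B; case: (code i) => [[[[[j M] i0] i2] ic]|]; first exact: measurable_bad.
  by move=> d' Z al be _ _; exact: measurable0.
have B0' i : (jj i < k)%N -> forall a b, nu [set t | B i a (set_column b (jj i) t)] = 0%E.
  rewrite /jj /B; case: (code i) => [[[[[j M] i0] i2] ic]|]; last by rewrite ltnn.
  move=> _ a b; apply/le_anti; rewrite measure_ge0 andbT.
  rewrite -[leRHS](@bad_slice_null j M.+1%:R i0 i2 ic.+1%:R^-1 a b) ?invr_gt0 ?ltr0n//.
  by rewrite [leLHS]hausdorff_onE; apply: le_outer_measure => t [].
have D0 : (0 < nu B0)%E.
  rewrite [ltRHS]hausdorff_onE setIid; apply: lt_le_trans (nball_lb m_gt0 _ (ltW eps0)).
  by rewrite lte_fin exprn_gt0// divr_gt0.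
have [b [bB bnull]] := @fubini_columns _ T2 R k nu B0 _ T1 mu B jj (0 : 'rV[R]_m) mB0 D0 mB B0'.
exists b; split; first by move=> j /bB; rewrite /B0 /nball/= subr0.
move=> j M i0 i2 ic; pose i := pickle (j, M, i0, i2, ic).
have ci : code i = Some (j, M, i0, i2, ic) by rewrite /code /i pickleK.
have := bnull i; rewrite /jj ci => /(_ (ltn_ord j)).
by rewrite /B ci [LHS]hausdorff_onE.
Qed.

Let shear_lip (b : nat -> 'rV[R]_m) : exists2 c, C <= c &
  forall x y, `|shear b x - shear b y| <= c * `|x - y|.
Proof.
exists (C + \sum_(j < k) C * `|b j|).
  by rewrite lerDl sumr_ge0// => j _; rewrite mulr_ge0// ltW.
move=> x y; rewrite mulrDl.
have -> : shear b x - shear b y = (p x - p y) - \sum_(j < k) (Q x ord0 j - Q y ord0 j) *: b j.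
  rewrite /shear; under [in RHS]eq_bigr do rewrite scalerBl.
  by rewrite sumrB opprD addrACA -opprD.
apply: (le_trans (ler_normB _ _)); rewrite lerD// mulr_suml.
apply: (le_trans (ler_norm_sum _ _ _)); apply: ler_sum => j _.
by rewrite normrZ mulrAC ler_wpM2r// coord_lip.
Qed.

(** Otherwise a sequence in the fibre has strictly decreasing positive distances |Q y - Q a|; its
    terms are distinct. *)
Let isolated_fibre (b : nat -> 'rV[R]_m) a : ~ infinite_fibre K (shear b) (shear b a) ->
  exists2 delta : R, 0 < delta & forall y, K y -> shear b y = shear b a ->
    0 < `|Q y - Q a| -> delta <= `|Q y - Q a|.
Proof.
move=> nf; apply: contrapT => nd; apply: nf.
have H1 (d : R) : exists y, 0 < d -> [/\ K y, shear b y = shear b a & 0 < `|Q y - Q a| < d].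
  have [d0|] := ltP 0 d; last by exists 0.
  apply: contrapT => ny; apply: nd; exists d => // y Ky Py Qy.
  by rewrite leNgt; apply/negP => lt; apply: ny; exists y => _; rewrite Qy.
have [g gP] := choice H1.
pose ys := fix f i := if i is i'.+1 then g `|Q (f i') - Q a| else g 1.
have ysP i : [/\ K (ys i), shear b (ys i) = shear b a & 0 < `|Q (ys i) - Q a|].
  elim: i => [|i [_ _ IH]] /=; first by have [? ? /andP[]] := gP 1 ltr01.
  by have [? ? /andP[]] := gP _ IH.
have ysdecr i : `|Q (ys i.+1) - Q a| < `|Q (ys i) - Q a|.
  by have [_ _ IH] := ysP i; have [_ _ /andP[]] := gP _ IH.
have yslt i j : (i < j)%N -> `|Q (ys j) - Q a| < `|Q (ys i) - Q a|.
  elim: j => // j IH; rewrite ltnS leq_eqVlt => /predU1P[->//|/IH].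
  exact: lt_trans.
exists ys; split; last by move=> i; have [] := ysP i.
by move=> i j ij; case: (ltngtP i j) => // /yslt; rewrite ij ltxx.
Qed.

Let lip_gt_open (f : 'rV[R]_n -> R) (c t : R) :
  (forall x y, `|f x - f y| <= c * `|x - y|) -> open [set x | t < f x].
Proof.
move=> fc; apply/open_nballP => x /= tx.
have K0 : 0 < `|c| + 1 by rewrite ltr_wpDl.
exists ((f x - t) / (`|c| + 1)); first by rewrite divr_gt0// subr_gt0.
move=> y; rewrite /nball/= ltr_pdivlMr// => yx.
have := fc y x; have : c * `|y - x| <= (`|c| + 1) * `|y - x|.
  by rewrite ler_wpM2r// (le_trans (ler_norm _))// lerDl.
by rewrite ler_norml => ? /andP[? ?]; lra.
Qed.

(** In the part of the annulus where j dominates, the shear difference has no zero. The open sets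
    [F 0], [F 1], [F 2] leave exactly this part, the others say that the difference exceeds
    [dyad i]; a finite subcover of the compact set yields one scale that empties the strip. *)
Let isolated_nohit (b : nat -> 'rV[R]_m) a i2 (j : 'I_k) :
  (forall y, K y -> shear b y = shear b a -> 0 < `|Q y - Q a| -> dyad i2 < `|Q y - Q a|) ->
  nohit j i2 a b.
Proof.
move=> iso l1 l2; have [c _ sc] := shear_lip b.
have DqL i : forall x y, `| `|Dq i a x| - `|Dq i a y| | <= C * `|x - y|.
  move=> x y; apply: (le_trans (ler_dist_dist _ _)).
  rewrite (_ : Dq i a x - Dq i a y = Q x ord0 i - Q y ord0 i); first exact: coord_lip.
  by rewrite /Dq; ring.
have DL : forall x y, `| `|D b a x| - `|D b a y| | <= c * `|x - y|.
  move=> x y; apply: (le_trans (ler_dist_dist _ _)).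
  rewrite (_ : D b a x - D b a y = shear b x - shear b y) // /D.
  by move: (shear b x) (shear b y) (shear b a) => u v w; rewrite opprB addrA subrK.
pose F (i : nat) : set 'rV[R]_n := match i with
  | 0 => [set y | - dyad l2 < - `|Dq j a y|]
  | 1 => [set y | dyad i2 < `|Dq j a y|]
  | 2 => \bigcup_(i in [set: 'I_k]) [set y | 0 < `|Dq i a y| - `|Dq j a y|]
  | i.+3 => [set y | dyad i < `|D b a y|] end.
have oF i : open (F i).
  case: i => [|[|[|i]]] /=.
  - by apply: (@lip_gt_open _ C) => x y; rewrite -opprD normrN; exact: DqL.
  - by apply: (@lip_gt_open _ C) => x y; exact: DqL.
  - apply: bigcup_open => i _; apply: (@lip_gt_open _ (C + C)) => x y.
    rewrite mulrDl; have -> : `|Dq i a x| - `|Dq j a x| - (`|Dq i a y| - `|Dq j a y|) =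
      (`|Dq i a x| - `|Dq i a y|) - (`|Dq j a x| - `|Dq j a y|) by ring.
    by apply: (le_trans (ler_normB _ _)); apply: lerD.
  - by apply: (@lip_gt_open _ c) => x y; exact: DL.
have KF : Ks l1 `<=` \bigcup_i F i.
  move=> y yl1; have Ky : K y by exists l1.
  have [h0|h0] := ltP `|Dq j a y| (dyad l2); first by exists 0%N => //=; rewrite ltrN2.
  have [h1|h1] := ltP (dyad i2) `|Dq j a y|; first by exists 1%N.
  have [[i h2]|h2] := pselect (exists i, `|Dq j a y| < `|Dq i a y|).
    by exists 2%N => //; exists i => //=; rewrite subr_gt0.
  have Dpos : 0 < `|D b a y|.
    rewrite normr_gt0 subr_eq0; apply/eqP => Py.
    have Qle : `|Q y - Q a| <= `|Dq j a y|.
      apply: row_norm_le => // i; rewrite !mxE leNgt; apply/negP => lt.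
      by apply: h2; exists i.
    have Qge : `|Dq j a y| <= `|Q y - Q a|.
      by have := coord_le_norm (Q y - Q a) j; rewrite !mxE.
    have Qpos : 0 < `|Q y - Q a|.
      by apply: (lt_le_trans (dyad_gt0 l2)); apply: (le_trans h0).
    by have := iso y Ky Py Qpos; lra.
  by have [i ih] := dyad_small Dpos; exists i.+3.
have [N KN] := finite_open_cover (@Kcompact l1) oF KF.
exists N; rewrite (_ : _ `&` _ = set0) ?outer_measure0//.
apply/seteqP; split=> // y [yl1 [[h2 h3] /andP[h0 h1] hD]].
have [i /= iN Fy] := KN y yl1; case: i iN Fy => [|[|[|i]]] /= iN Fy.
- by move: Fy; rewrite ltrN2 ltNge h0.
- by move: Fy; rewrite ltNge h1.
- by case: Fy => i _ /=; rewrite subr_gt0 ltNge h2.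
- have : dyad N <= dyad i :> R by apply: dyad_le; lia.
  by lra.
Qed.

(* Besicovitch-Federer for the family p - \sum_j q_j b_j. *)
Theorem shear_null (eps : R) : 0 < eps -> exists b : nat -> 'rV[R]_m,
  (forall j, (j < k)%N -> `|b j| < eps) /\ L (shear b @` K) = 0%E.
Proof.
move=> eps0; have [b [beps bnull]] := exists_good eps0.
exists b; split=> //; pose P := shear b.
have [c Cc Pc] := shear_lip b.
have c0 : 0 < c by apply: lt_le_trans Cc.
have [cl clP] := choice Q_colip.
(* One constant serves as Lipschitz bound for [P] and [Q] and as co-Lipschitz bound for [Q] on
   [Ks l]; [th l] is the largest thinness that [cone_null] then admits. *)
pose c'' l := c + `|cl l|.
have c''0 l : 0 < c'' l by rewrite ltr_pwDl.
pose th l : R := (4 * (600 * 18 * m%:R * c'' l) ^+ m)^-1.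
have X0 l : 0 < 4 * (600 * 18 * m%:R * c'' l) ^+ m :> R.
  by rewrite !(mulr_gt0, exprn_gt0) ?ltr0n.
have th0 l : 0 < th l by rewrite invr_gt0.
(* Null by [cone_null]. The rest of the proof places every point of [K] in such a set, unless it is
   in the null set [Bad] or has a value of infinite density or multiplicity. *)
pose A l ii i2 := [set a | Ks l a /\ forall i, (i2 <= i)%N ->
  (H (K `&` cone P Q a (dyad i) (dyad ii)) <= (th l * (dyad i * dyad ii) ^+ m)%:E)%E].
have A0 l ii i2 : H (A l ii i2) = 0%E.
  have Pl x y : `|P x - P y| <= c'' l * `|x - y|.
    by apply: (le_trans (Pc x y)); rewrite ler_wpM2r// lerDl.
  have Ql x y : `|Q x - Q y| <= c'' l * `|x - y|.
    apply: (le_trans (Q_lip x y)); rewrite ler_wpM2r//.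
    by rewrite (le_trans Cc)// lerDl.
  apply: (@cone_null R m n k m_gt0 P Q K (A l ii i2) (c'' l) (dyad ii) (th l) i2 Koo Knull).
  - exact: c''0.
  - exact: dyad_gt0.
  - exact: dyad_le1.
  - exact: ltW (th0 l).
  - exact: Pl.
  - exact: Ql.
  - move=> x y [xl _] [yl _]; apply: (le_trans (clP l x y xl yl)).
    by rewrite ler_wpM2r// (le_trans (ler_norm _))// lerDr ltW.
  - by move=> x [xl _]; exists l.
  - by rewrite /th mulVf ?gt_eqF.
  - by move=> a i [_ h] ii2; exact: h.
pose badset (j : 'I_k) (M i0 i2 ic : nat) := K `&` [set a | bad j M.+1%:R i0 i2 ic.+1%:R^-1 a b].
pose code i : option ('I_k * nat * nat * nat * nat) := unpickle i.
pose Bad := \bigcup_i (if code i is Some (j, M, i0, i2, ic) then badset j M i0 i2 ic else set0).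
have Bad0 : H Bad = 0%E.
  apply/le_anti; rewrite outer_measure_ge0 andbT.
  apply: (le_trans (outer_measure_sigma_subadditive H _)).
  rewrite eseries0// => i _ _; case: (code i) => [[[[[j M] i0] i2] ic]|].
    exact: bnull.
  exact: outer_measure0.
pose Gd := \bigcup_l \bigcup_ii \bigcup_i2 A l ii i2.
have Gd0 : H Gd = 0%E.
  apply/le_anti; rewrite outer_measure_ge0 andbT.
  apply: (le_trans (outer_measure_sigma_subadditive H _)); rewrite eseries0// => l _ _.
  apply/le_anti; rewrite outer_measure_ge0 andbT.
  apply: (le_trans (outer_measure_sigma_subadditive H _)); rewrite eseries0// => ii _ _.
  apply/le_anti; rewrite outer_measure_ge0 andbT.
  by apply: (le_trans (outer_measure_sigma_subadditive H _)); rewrite eseries0 => [//|i2 _ _]; exact: A0.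
have image0 E : H E = 0%E -> L (P @` E) = 0%E.
  by apply: (@hausdorff_image0 R m m_gt0 n m E P c) => x y _ _; exact: Pc.
have cover : P @` K `<=` (infinite_density K P `|` infinite_fibre K P) `|` (P @` Bad `|` P @` Gd).
  move=> _ [a Ka <-].
  have [|nd] := pselect (infinite_density K P (P a)); first by left; left.
  have [|nf] := pselect (infinite_fibre K P (P a)); first by left; right.
  have [aB|nB] := pselect (Bad a); first by right; left; exists a.
  right; right; exists a => //.
  have [M [rho0 [rho00 Mrho]]] : exists M rho0 : R, 0 < rho0 /\ forall rho, 0 < rho < rho0 ->
      (H (K `&` P @^-1` nball (P a) rho) <= (M * rho ^+ m)%:E)%E.
    apply: contrapT => nM; apply: nd => M rho0 rho00; apply: contrapT => nr; apply: nM.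
    exists M, rho0; split=> // rho rhor; rewrite leNgt; apply/negP => lt; apply: nr.
    by exists rho => //; exact: ltW.
  pose M' := Num.bound `|M|.
  have MM' : M <= M'.+1%:R.
    apply: (le_trans (ler_norm _)); apply: (le_trans (ltW (archi_boundP (normr_ge0 M)))).
    by rewrite ler_nat.
  have [i0 i0rho] := dyad_small rho00.
  have [delta delta0 iso] := isolated_fibre nf.
  have [i2 i2delta] := dyad_small delta0.
  have st : strips M'.+1%:R i0 a b.
    move=> i ii0; apply: (@le_trans _ _ (M * dyad i ^+ m)%:E).
      apply: Mrho; rewrite dyad_gt0/=; apply: le_lt_trans i0rho; exact: dyad_le.
    by rewrite lee_fin ler_wpM2r// exprn_ge0// ltW// dyad_gt0.
  have nh j : nohit j i2 a b.
    apply: isolated_nohit => y Ky Py Qy; apply: (lt_le_trans i2delta).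
    exact: iso.
  have [l _ la] := Ka.
  (* The [k] parts of the cone, one per dominant coordinate, have thinness 1/(ic+1) each and must
     add up to at most [th l]. *)
  have [ic icth] : exists ic : nat, k%:R * ic.+1%:R^-1 <= th l.
    have tk : 0 < th l / (k%:R + 1) by rewrite divr_gt0// ltr_wpDl.
    have [ic] := ltr_add_invr tk; rewrite add0r ltr_pdivlMr ?ltr_wpDl// => h.
    exists ic; apply: le_trans (ltW h); rewrite mulrC ler_wpM2l ?invr_ge0// lerDl//.
  have nfat (j : 'I_k) : exists i1, forall i i', (i1 <= i)%N -> (i2 <= i')%N ->
      (H (K `&` [set y | [/\ dominant j a y, (`|D b a y| < dyad i * `|Dq j a y|)%R &
        (`|Dq j a y| < dyad i')%R]]) <= (ic.+1%:R^-1 * (dyad i * dyad i') ^+ m)%:E)%E.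
    apply: contrapT => ni; apply: nB; exists (pickle (j, M', i0, i2, ic)); first exact: I.
    rewrite /code pickleK; split; first exact: Ka.
    split; [exact: nh|exact: st|move=> i1; apply: contrapT => nii; apply: ni].
    exists i1 => i i' h1 h2; rewrite leNgt; apply/negP => lt; apply: nii.
    by exists i, i'; split; [exact: h1|exact: h2|exact: lt].
  have [i1 i1P] := choice nfat.
  pose ii := \max_(j < k) i1 j.
  exists l; [exact: I|exists ii; [exact: I|exists i2; [exact: I|split; [exact: la|move=> i i2i]]]].
  pose T (j : 'I_k) := K `&` [set y | [/\ dominant j a y, `|D b a y| < dyad ii * `|Dq j a y| &
        `|Dq j a y| < dyad i]].
  apply: (@le_trans _ _ (\sum_(j < k) H (T j))%E).
    apply: (@le_trans _ _ (H (\big[setU/set0]_(j < k) T j))); last first.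
      elim/big_ind2 : _ => [|x1 x2 y1 y2 h1 h2|//]; first by rewrite outer_measure0.
      by apply: (le_trans (outer_measureU2 _ _ _)); exact: leeD.
    apply: le_outer_measure => y [Ky [yP yQ]].
    have Qn0 : mx_norm (Q y - Q a) != 0.
      apply/eqP => e0; move: yP; rewrite [X in _ * X](_ : _ = 0); last exact: e0.
      by rewrite mulr0 ltNge normr_ge0.
    have [[j1 j] /= Qj] := mx_norm_neq0 Qn0.
    have QE : `|Q y - Q a| = `|Dq j a y| by rewrite [LHS]Qj ord1 !mxE.
    rewrite (bigD1 j)//=; left; split=> //; split.
    - split; last by rewrite -QE lt_neqAle eq_sym Qn0 normr_ge0.
      by move=> i'; rewrite -QE; have := coord_le_norm (Q y - Q a) i'; rewrite !mxE.
    - by rewrite -QE.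
    - by rewrite -QE.
  apply: (@le_trans _ _ (\sum_(j < k) (ic.+1%:R^-1 * (dyad ii * dyad i) ^+ m)%:E)%E).
    by apply: lee_sum => j _; apply: i1P => //; exact: leq_bigmax.
  rewrite sumEFin sumr_const card_ord lee_fin -[leLHS]mulr_natl mulrA (mulrC (dyad i)).
  by rewrite ler_wpM2r// exprn_ge0// mulr_ge0// ltW// dyad_gt0.
have bad0 : L (infinite_density K P) = 0%E by exact: (@infinite_density_null R m n m_gt0 K P c).
have fib0 : L (infinite_fibre K P) = 0%E by exact: (@infinite_fibre_null R m n m_gt0 K P c).
apply/le_anti; rewrite outer_measure_ge0 andbT.
apply: (le_trans (le_outer_measure L _ _ cover)).
apply: (le_trans (outer_measureU2 _ _ _)).
have PBG : L (P @` Bad `|` P @` Gd) = 0%E.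
  rewrite -image_setU; apply: image0; apply/le_anti; rewrite outer_measure_ge0 andbT.
  by apply: (le_trans (outer_measureU2 H _ _)); rewrite [X in (X + _ <= _)%E]Bad0
    [X in (_ + X <= _)%E]Gd0 adde0.
rewrite [X in (_ + X <= _)%E]PBG adde0.
apply: (le_trans (outer_measureU2 _ _ _)).
by rewrite [X in (X + _ <= _)%E]bad0 [X in (_ + X <= _)%E]fib0 adde0.
Qed.

End shears.

(** * Jacobians *)

Section matrix_norm.
Context {R : realType}.

Lemma mx_entry_le_norm p q (A : 'M[R]_(p, q)) i j : `|A i j| <= `|A|.
Proof.
by rewrite [leRHS]/Num.norm/= mx_normrE (le_bigmax _ (fun k : 'I_p * 'I_q => `|A k.1 k.2|) (i, j)).
Qed.

Lemma mx_norm_le p q (A : 'M[R]_(p, q)) (c : R) :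
  0 <= c -> (forall i j, `|A i j| <= c) -> `|A| <= c.
Proof.
by move=> c0 Ac; rewrite /Num.norm/= mx_normrE; apply: bigmax_le => // -[i j] _; exact: Ac.
Qed.

Lemma norm_mulmx p q r (A : 'M[R]_(p, q)) (B : 'M[R]_(q, r)) :
  `|A *m B| <= q%:R * `|A| * `|B|.
Proof.
apply: mx_norm_le => [|i j]; first by rewrite !mulr_ge0.
rewrite mxE; apply: (le_trans (ler_norm_sum _ _ _)).
apply: (@le_trans _ _ (\sum_(k < q) `|A| * `|B|)).
  by apply: ler_sum => k _; rewrite normrM ler_pM ?mx_entry_le_norm.
by rewrite sumr_const card_ord -[leLHS]mulr_natl mulrA.
Qed.

End matrix_norm.

(** * Differential calculus by estimates *)

Section jacobian_calculus.
Context {R : realType}.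

(** Differentiability with the derivative as explicit data, in the row convention of the Jacobian;
    [has_jac_jacobian] and [differentiable_has_jac] link it to the library notion. *)
Definition has_jac p q (f : 'rV[R]_p -> 'rV[R]_q) x (A : 'M[R]_(p, q)) :=
  forall e, 0 < e -> exists2 d, 0 < d &
    forall y, `|y - x| < d -> `|f y - f x - (y - x) *m A| <= e * `|y - x|.

Definition cont_at p q r (f : 'rV[R]_p -> 'M[R]_(q, r)) x :=
  forall e, 0 < e -> exists2 d, 0 < d & forall y, `|y - x| < d -> `|f y - f x| <= e.

Lemma has_jac_jacobian p q (f : 'rV[R]_p -> 'rV[R]_q) x :
  differentiable f x -> has_jac f x ('J f x).
Proof.
move=> df e e0; have := diff_locally df => /eqaddoP /(_ e e0).
move=> /nbhs_ballP[d /= d0 dP]; exists d => // y yx.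
have := dP (y - x); rewrite -ball_normE /ball_/= sub0r normrN => /(_ yx).
rewrite /= !fctE /= /shift /= subrK /jacobian mul_rV_lin1.
by rewrite opprD addrA.
Qed.

Lemma differentiable_has_jac p q (f : 'rV[R]_p -> 'rV[R]_q) x A :
  has_jac f x A -> differentiable f x /\ 'J f x = A.
Proof.
move=> fA.
have cA : continuous (mulmxr A : 'rV[R]_p -> 'rV[R]_q).
  apply: (@lipschitz_continuous_row R _ _ _ (p%:R * `|A|)) => y z /=.
  by rewrite -mulmxBl mulrAC; exact: norm_mulmx.
pose dA : {linear 'rV[R]_p -> 'rV[R]_q} := mulmxr A.
have E : f \o shift x = cst (f x) + (dA : 'rV[R]_p -> 'rV[R]_q) +o_ (0 : 'rV[R]_p) id.
  apply/eqaddoP => e e0; have [d d0 dP] := fA e e0.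
  apply/nbhs_ballP; exists d => // y; rewrite -ball_normE /ball_/= sub0r normrN => yd.
  have := dP (y + x); rewrite addrK => /(_ yd).
  by rewrite /= !fctE /= /shift/= opprD addrA.
have D := @diff_unique R _ _ f dA x cA E.
have df : differentiable f x by apply/diff_locallyP; rewrite D.
split=> //; apply/row_matrixP => i; rewrite !rowE /jacobian mul_rV_lin1.
by rewrite D.
Qed.

Lemma has_jac_lip p q (f : 'rV[R]_p -> 'rV[R]_q) x A : has_jac f x A ->
  exists c d, [/\ 0 < c, 0 < d & forall y, `|y - x| < d -> `|f y - f x| <= c * `|y - x|].
Proof.
move=> /(_ 1 ltr01)[d d0 dP]; exists (1 + p%:R * `|A|), d; split=> [||y yx]; [by rewrite ltr_pwDl ?mulr_ge0|exact: d0|].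
rewrite -[f y - f x](subrK ((y - x) *m A)).
apply: (le_trans (ler_normD _ _)); rewrite mulrDl; apply: lerD; first exact: dP.
by apply: (le_trans (norm_mulmx _ _)); rewrite mulrAC.
Qed.

Lemma has_jac_cont p q (f : 'rV[R]_p -> 'rV[R]_q) x A : has_jac f x A -> cont_at f x.
Proof.
move=> /has_jac_lip[c [d [c0 d0 dP]]] e e0; exists (Num.min d (e / c)).
  by rewrite lt_min d0 divr_gt0.
move=> y; rewrite lt_min => /andP[yd]; rewrite ltr_pdivlMr// mulrC => /ltW.
by apply: le_trans; exact: dP.
Qed.

Lemma has_jac_near p q (f g : 'rV[R]_p -> 'rV[R]_q) x A d : 0 < d ->
  (forall y, `|y - x| < d -> f y = g y) -> has_jac f x A -> has_jac g x A.
Proof.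
move=> d0 fg fA e /fA[d' d'0 d'P]; exists (Num.min d d'); first by rewrite lt_min d0.
move=> y; rewrite lt_min => /andP[yd yd']; rewrite -!fg//; first exact: d'P.
by rewrite subrr normr0.
Qed.

Lemma has_jac_cst p q (c : 'rV[R]_q) (x : 'rV[R]_p) : has_jac (fun=> c) x 0.
Proof.
move=> e e0; exists 1 => // y _.
by rewrite subrr mulmx0 subr0 normr0 mulr_ge0// ltW.
Qed.

Lemma has_jac_mulmxr p q (A : 'M[R]_(p, q)) x : has_jac (mulmx^~ A) x A.
Proof.
move=> e e0; exists 1 => // y _.
by rewrite -mulmxBl subrr normr0 mulr_ge0// ltW.
Qed.

Lemma has_jacD p q (f g : 'rV[R]_p -> 'rV[R]_q) x A B :
  has_jac f x A -> has_jac g x B -> has_jac (fun y => f y + g y) x (A + B).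
Proof.
move=> fA gB e e0; have e2 : 0 < e / 2 by rewrite divr_gt0.
have [d d0 dP] := fA _ e2; have [d' d'0 d'P] := gB _ e2.
exists (Num.min d d'); first by rewrite lt_min d0.
move=> y; rewrite lt_min => /andP[/dP fy /d'P gy].
rewrite mulmxDr (_ : _ - _ - _ = (f y - f x - (y - x) *m A) + (g y - g x - (y - x) *m B)).
  by apply: (le_trans (ler_normD _ _)); lra.
by apply/rowP => i; rewrite !mxE; ring.
Qed.

Lemma has_jac_comp p q r (f : 'rV[R]_p -> 'rV[R]_q) (g : 'rV[R]_q -> 'rV[R]_r) x A B :
  has_jac f x A -> has_jac g (f x) B -> has_jac (g \o f) x (A *m B).
Proof.
move=> fA gB e e0; have [c [d1 [c0 d10 d1P]]] := has_jac_lip fA.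
have e2 : 0 < e / (2 * c) by rewrite divr_gt0// mulr_gt0.
have [d2 d20 d2P] := gB _ e2.
pose b := q%:R * `|B| + 1.
have b0 : 0 < b by rewrite ltr_wpDl// mulr_ge0.
have e3 : 0 < e / (2 * b) by rewrite divr_gt0// mulr_gt0.
have [d3 d30 d3P] := fA _ e3.
exists (Num.min (Num.min d1 d3) (d2 / c)); first by rewrite !lt_min d10 d30 divr_gt0.
move=> y; rewrite !lt_min => /andP[/andP[/d1P y1 /d3P y3]].
rewrite ltr_pdivlMr// mulrC => y2.
have /d2P{}y2 : `|f y - f x| < d2 by exact: le_lt_trans y2.
rewrite /= mulmxA (_ : g (f y) - g (f x) - _ =
  (g (f y) - g (f x) - (f y - f x) *m B) + (f y - f x - (y - x) *m A) *m B); last first.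
  move: (f y - f x) => v; rewrite [X in _ = _ + X]mulmxBl addrA subrK//.
apply: (le_trans (ler_normD _ _)); rewrite [e in leRHS]splitr mulrDl; apply: lerD.
  apply: (le_trans y2); apply: (@le_trans _ _ (e / (2 * c) * (c * `|y - x|))).
    by rewrite ler_wpM2l// ltW.
  by rewrite invfM !mulrA mulfVK ?gt_eqF.
apply: (le_trans (norm_mulmx _ _)).
apply: (@le_trans _ _ (b * (e / (2 * b) * `|y - x|))).
  by rewrite mulrAC; apply: ler_pM => //; rewrite ?mulr_ge0// lerDl.
by rewrite (_ : b * _ = e / 2 * `|y - x|)//; move: `|y - x| => N; field; rewrite gt_eqF.
Qed.

Lemma has_jac_mulmx p q r (f : 'rV[R]_p -> 'rV[R]_q) x A (B : 'M[R]_(q, r)) :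
  has_jac f x A -> has_jac (fun y => f y *m B) x (A *m B).
Proof. by move=> fA; exact: (has_jac_comp fA (has_jac_mulmxr _ _)). Qed.

(* Scalar functions are treated as 'rV_1-valued, their gradients being columns. *)
Lemma has_jac_scale p q (u : 'rV[R]_p -> R) (f : 'rV[R]_p -> 'rV[R]_q) x G A :
  has_jac (fun y => (u y)%:M : 'rV[R]_1) x G -> has_jac f x A ->
  has_jac (fun y => u y *: f y) x (G *m f x + u x *: A).
Proof.
move=> uG fA e e0.
pose b := 1 * `|f x| + 1; have b0 : 0 < b by rewrite ltr_wpDl// mulr_ge0.
pose c := `|u x| + 1; have c0 : 0 < c by rewrite ltr_wpDl.
have [cu [d1 [cu0 d10 d1P]]] := has_jac_lip uG.
have e1 : 0 < e / 3 / b by rewrite !divr_gt0.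
have e2 : 0 < e / 3 / c by rewrite !divr_gt0.
have e3 : 0 < e / 3 / cu by rewrite !divr_gt0.
have [d2 d20 d2P] := uG _ e1; have [d3 d30 d3P] := fA _ e2.
have [d4 d40 d4P] := has_jac_cont fA e3.
exists (Num.min (Num.min d1 d2) (Num.min d3 d4)); first by rewrite !lt_min d10 d20 d30.
move=> y; rewrite !lt_min => /andP[/andP[/d1P y1 /d2P y2] /andP[/d3P y3 /d4P y4]].
have -> : u y *: f y - u x *: f x - (y - x) *m (G *m f x + u x *: A) =
  ((u y)%:M - (u x)%:M - (y - x) *m G) *m f x + u x *: (f y - f x - (y - x) *m A) +
  ((u y)%:M - (u x)%:M) *m (f y - f x).
  move: (y - x) => v; rewrite !mulmxBl mulmxDr !mul_scalar_mx mulmxA -scalemxAr.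
  move: (v *m G *m f x) (v *m A) => a b'.
  by apply/rowP => i; rewrite !mxE; ring.
apply: (le_trans (ler_normD _ _)); apply: (@le_trans _ _ ((e / 3 + e / 3) * `|y - x| +
  e / 3 * `|y - x|)); last by rewrite -mulrDl; have := normr_ge0 (y - x); nra.
apply: lerD; first (apply: (le_trans (ler_normD _ _)); rewrite mulrDl; apply: lerD).
- apply: (le_trans (norm_mulmx _ _)).
  apply: (@le_trans _ _ (e / 3 / b * `|y - x| * b)); last by rewrite mulrAC mulfVK ?gt_eqF.
  rewrite mulrAC [leLHS]mulrC; apply: ler_pM; rewrite ?mulr_ge0 ?lerDl//.
- rewrite normrZ; apply: (@le_trans _ _ (c * (e / 3 / c * `|y - x|))).
    by apply: ler_pM => //; rewrite lerDl.
  by rewrite mulrA mulrCA mulfV ?gt_eqF ?mulr1.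
- apply: (le_trans (norm_mulmx _ _)); rewrite mul1r.
  apply: (@le_trans _ _ (cu * `|y - x| * (e / 3 / cu))); first exact: ler_pM.
  by rewrite mulrAC [cu * _]mulrC mulfVK ?gt_eqF.
Qed.

Lemma norm_row_mx p a b (A : 'M[R]_(p, a)) (B : 'M[R]_(p, b)) (c : R) :
  0 <= c -> `|A| <= c -> `|B| <= c -> `|row_mx A B| <= c.
Proof.
move=> c0 Ac Bc; apply: mx_norm_le => // i j; rewrite mxE.
by case: (fintype.split j) => k; [apply: le_trans Ac|apply: le_trans Bc]; exact: mx_entry_le_norm.
Qed.

Lemma sub_row_mx p a b (A A' : 'M[R]_(p, a)) (B B' : 'M[R]_(p, b)) :
  row_mx A B - row_mx A' B' = row_mx (A - A') (B - B').
Proof. by rewrite opp_row_mx add_row_mx. Qed.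

Lemma has_jac_row_mx p a b (f : 'rV[R]_p -> 'rV[R]_a) (g : 'rV[R]_p -> 'rV[R]_b) x A B :
  has_jac f x A -> has_jac g x B -> has_jac (fun y => row_mx (f y) (g y)) x (row_mx A B).
Proof.
move=> fA gB e e0; have [d d0 dP] := fA _ e0; have [d' d'0 d'P] := gB _ e0.
exists (Num.min d d'); first by rewrite lt_min d0.
move=> y; rewrite lt_min => /andP[/dP fy /d'P gy].
rewrite mul_mx_row !sub_row_mx; apply: norm_row_mx => //.
by rewrite mulr_ge0// ltW.
Qed.

Lemma is_derive_approx (g : R -> R) t c :
  (forall e, 0 < e -> exists2 d, 0 < d &
    forall h, `|h| < d -> `|g (h + t) - g t - h * c| <= e * `|h|) ->
  is_derive t 1 g c.
Proof.
move=> H.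
have C : (fun h => h^-1 *: ((g \o shift t) (h *: (1 : R)) - g t)) @ 0^' --> c.
  apply/cvgrPdist_le => e e0; have [d d0 dP] := H e e0.
  apply/nbhs_ballP; exists d => // h; rewrite /ball/= sub0r normrN => hd h0.
  have := dP h hd; rewrite /shift/= [h *: 1]mulr1.
  rewrite (_ : g (h + t) - g t - h * c = - (h * (c - h^-1 *: (g (h + t) - g t)))).
    by rewrite normrN normrM mulrC ler_pM2r ?normr_gt0.
  rewrite (_ : h^-1 *: (g (h + t) - g t) = h^-1 * (g (h + t) - g t))//.
  by rewrite mulrBr mulrA mulfV// mul1r; ring.
by apply: DeriveDef; [apply/cvg_ex; exists c|exact: cvg_lim C].
Qed.

(** The intermediate point depends on the coordinate j: the one-variable theorem is applied to each
    coordinate along the segment. *)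
Lemma mean_value p q (f : 'rV[R]_p -> 'rV[R]_q) (J : 'rV[R]_p -> 'M[R]_(p, q))
    (x y : 'rV[R]_p) j :
  (forall t : R, 0 <= t <= 1 -> has_jac f (x + t *: (y - x)) (J (x + t *: (y - x)))) ->
  exists2 t : R, 0 <= t <= 1 &
    (f y - f x) ord0 j = ((y - x) *m J (x + t *: (y - x))) ord0 j.
Proof.
move=> fJ; pose g (t : R) : R := f (x + t *: (y - x)) ord0 j.
pose dg (t : R) : R := ((y - x) *m J (x + t *: (y - x))) ord0 j.
have gd (t : R) : 0 <= t <= 1 -> is_derive t 1 g (dg t).
  move=> /fJ{}fJ; apply: is_derive_approx => e e0.
  pose b := `|y - x| + 1; have b0 : 0 < b by rewrite ltr_wpDl.
  have eb : 0 < e / b by rewrite divr_gt0.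
  have [d d0 dP] := fJ _ eb; exists (d / b); first by rewrite divr_gt0.
  move=> h; rewrite ltr_pdivlMr// => hd.
  have := dP (x + (h + t) *: (y - x)).
  rewrite scalerDl addrCA addrK normrZ => H.
  have hb : `|h| * `|y - x| <= `|h| * b by rewrite ler_wpM2l// lerDl.
  apply: le_trans (_ : e / b * (`|h| * b) <= _); last by rewrite mulrCA mulfVK ?gt_eqF// mulrC.
  have {}H := H (le_lt_trans hb hd).
  apply: le_trans (le_trans (coord_le_norm _ j) (le_trans H _)); last by rewrite ler_wpM2l// ltW.
  by rewrite /g /dg scalerDl addrCA -scalemxAl; move: (_ *m _) => V; rewrite !mxE.
have gc : {within `[0, 1], continuous g}.
  apply: derivable_within_continuous => t; rewrite in_itv/= => t01.
  by have [] := gd t t01.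
have [t|t] := @MVT_segment R g dg 0 1 ler01 _ gc.
  by rewrite in_itv/= => /andP[t0 t1]; apply: gd; rewrite !ltW.
rewrite in_itv/= => t01 gE; exists t => //.
by move: gE; rewrite /g /dg subr0 mulr1 scale1r scale0r addr0 [x + _]addrC subrK !mxE.
Qed.

Lemma mean_value_le p q (f : 'rV[R]_p -> 'rV[R]_q) (J : 'rV[R]_p -> 'M[R]_(p, q))
    (A : 'M[R]_(p, q)) (M : R) (x y : 'rV[R]_p) : 0 <= M ->
  (forall t : R, 0 <= t <= 1 -> has_jac f (x + t *: (y - x)) (J (x + t *: (y - x)))) ->
  (forall t : R, 0 <= t <= 1 -> `|J (x + t *: (y - x)) - A| <= M) ->
  `|f y - f x - (y - x) *m A| <= p%:R * M * `|y - x|.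
Proof.
move=> M0 fJ JM; apply: row_norm_le => [|j]; first by rewrite !mulr_ge0.
have [t t01 tE] := mean_value j fJ.
rewrite 2!mxE in tE; rewrite !mxE in tE *; rewrite tE.
have -> : \sum_(i < p) (y - x) ord0 i * J (x + t *: (y - x)) i j -
  \sum_(i < p) (y - x) ord0 i * A i j = ((y - x) *m (J (x + t *: (y - x)) - A)) ord0 j.
  by rewrite mulmxBr !mxE.
apply: (le_trans (mx_entry_le_norm _ _ _)); apply: (le_trans (norm_mulmx _ _)).
by rewrite [leRHS]mulrAC ler_wpM2l ?mulr_ge0// JM.
Qed.

(** The differentiable half of the inverse function theorem: for a lift z of y through Psi with |z
    x' - z x| <= c |y x' - y x|, errors of size o(|y x' - y x|) for Psi become errors for z after
    applying [invmx A]. *)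
Lemma has_jac_lift p q (Psi : 'rV[R]_q -> 'rV[R]_q) (z y : 'rV[R]_p -> 'rV[R]_q) x A B c d :
  0 < d -> 0 < c -> (forall x', `|x' - x| < d -> Psi (z x') = y x') ->
  (forall x', `|x' - x| < d -> `|z x' - z x| <= c * `|y x' - y x|) ->
  has_jac Psi (z x) A -> A \in unitmx -> has_jac y x B ->
  has_jac z x (B *m invmx A).
Proof.
move=> d0 c0 zE zc PA uA yB e e0.
have [b [d1 [b0 d10 d1P]]] := has_jac_lip yB.
pose a := q%:R * `|invmx A| + 1; have a0 : 0 < a by rewrite ltr_wpDl// mulr_ge0.
have e1 : 0 < e / 2 / (a * (c * b)) by rewrite !divr_gt0// !mulr_gt0.
have e2 : 0 < e / 2 / a by rewrite !divr_gt0.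
have [d2 d20 d2P] := PA _ e1; have [d3 d30 d3P] := yB _ e2.
exists (Num.min (Num.min d d1) (Num.min d3 (d2 / (c * b)))).
  by rewrite !lt_min d0 d10 d30 divr_gt0// mulr_gt0.
move=> x'; rewrite !lt_min => /andP[/andP[x'd /d1P x'1] /andP[/d3P x'3]].
rewrite ltr_pdivlMr ?mulr_gt0// mulrC => x'2.
have zb : `|z x' - z x| <= c * b * `|x' - x|.
  by apply: (le_trans (zc _ x'd)); rewrite -mulrA ler_wpM2l// ltW.
have /d2P := le_lt_trans zb x'2.
rewrite !zE ?subrr ?normr0// => Pz.
have -> : z x' - z x - (x' - x) *m (B *m invmx A) =
   ((y x' - y x - (x' - x) *m B) - (y x' - y x - (z x' - z x) *m A)) *m invmx A.
  move: (z x' - z x) (y x' - y x) (x' - x) => u v w.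
  rewrite !mulmxBl mulmxA mulmxK//; apply/rowP => i; rewrite !mxE; ring.
apply: (le_trans (norm_mulmx _ _)); rewrite mulrAC.
apply: (@le_trans _ _ (a * (e / 2 / a * `|x' - x| + e / 2 / (a * (c * b)) * (c * b * `|x' - x|)))).
  apply: ler_pM; rewrite ?mulr_ge0 ?lerDl//.
  apply: (le_trans (ler_normB _ _)); apply: lerD => //.
  by apply: (le_trans Pz); rewrite ler_wpM2l// ltW.
move: `|x' - x| => N; rewrite (_ : a * _ = e * N)//; field.
by rewrite !gt_eqF.
Qed.

End jacobian_calculus.

Section continuity.
Context {R : realType}.

Lemma cont_at_cst p q r (A : 'M[R]_(q, r)) (x : 'rV[R]_p) : cont_at (fun=> A) x.
Proof. by move=> e e0; exists 1 => // y _; rewrite subrr normr0 ltW. Qed.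

Lemma cont_atD p q r (f g : 'rV[R]_p -> 'M[R]_(q, r)) x :
  cont_at f x -> cont_at g x -> cont_at (fun y => f y + g y) x.
Proof.
move=> fc gc e e0; have e2 : 0 < e / 2 by rewrite divr_gt0.
have [d d0 dP] := fc _ e2; have [d' d'0 d'P] := gc _ e2.
exists (Num.min d d'); first by rewrite lt_min d0.
move=> y; rewrite lt_min => /andP[/dP fy /d'P gy].
rewrite opprD addrACA; apply: (le_trans (ler_normD _ _)); lra.
Qed.

Lemma cont_at_mulmx p q r s (f : 'rV[R]_p -> 'M[R]_(q, r)) (g : 'rV[R]_p -> 'M[R]_(r, s)) x :
  cont_at f x -> cont_at g x -> cont_at (fun y => f y *m g y) x.
Proof.
move=> fc gc e e0.
pose a := r%:R * (`|f x| + 1) + 1; have a0 : 0 < a by rewrite ltr_wpDl// mulr_ge0// addr_ge0.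
pose b := r%:R * `|g x| + 1; have b0 : 0 < b by rewrite ltr_wpDl// mulr_ge0.
have e1 : 0 < Num.min 1 (e / 2 / b) by rewrite lt_min ltr01 !divr_gt0.
have e2 : 0 < e / 2 / a by rewrite !divr_gt0.
have [d d0 dP] := fc _ e1; have [d' d'0 d'P] := gc _ e2.
exists (Num.min d d'); first by rewrite lt_min d0.
move=> y; rewrite lt_min => /andP[/dP fy /d'P gy]; move: fy; rewrite le_min => /andP[fy1 fy].
have -> : f y *m g y - f x *m g x = f y *m (g y - g x) + (f y - f x) *m g x.
  by rewrite mulmxBr mulmxBl addrA subrK.
have fyn : `|f y| <= `|f x| + 1.
  by rewrite -(subrK (f x) (f y)) addrC (le_trans (ler_normD _ _))// lerD2l.
apply: (le_trans (ler_normD _ _)); rewrite [leRHS]splitr; apply: lerD.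
  apply: (le_trans (norm_mulmx _ _)); rewrite -[leRHS](divfK (lt0r_neq0 a0)) [leRHS]mulrC.
  apply: ler_pM; rewrite ?mulr_ge0//; apply: (@le_trans _ _ (r%:R * (`|f x| + 1))).
    by rewrite ler_wpM2l.
  by rewrite lerDl.
apply: (le_trans (norm_mulmx _ _)); rewrite -[leRHS](divfK (lt0r_neq0 b0)) [leRHS]mulrC mulrAC.
by apply: ler_pM; rewrite ?mulr_ge0// lerDl.
Qed.

Lemma cont_at_comp p q r s (f : 'rV[R]_p -> 'rV[R]_q) (g : 'rV[R]_q -> 'M[R]_(r, s)) x :
  cont_at f x -> cont_at g (f x) -> cont_at (g \o f) x.
Proof.
move=> fc gc e e0; have [d d0 dP] := gc _ e0.
have d2 : 0 < d / 2 by rewrite divr_gt0.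
have [d' d'0 d'P] := fc _ d2; exists d' => // y /d'P yx; apply: dP.
by apply: le_lt_trans yx _; rewrite ltr_pdivrMr// ltr_pMr// ltr1n.
Qed.

Lemma cont_at_scale p q r (u : 'rV[R]_p -> R) (g : 'rV[R]_p -> 'M[R]_(q, r)) x :
  cont_at (fun y => (u y)%:M : 'rV[R]_1) x -> cont_at g x -> cont_at (fun y => u y *: g y) x.
Proof.
move=> uc gc; have H := @cont_at_mulmx p q q r (fun y => (u y)%:M) g x _ gc.
move=> e e0; have [|d d0 dP] := H _ e e0.
  move=> e' e'0; have [d d0 dP] := uc _ e'0; exists d => // y /dP uy.
  apply: mx_norm_le => [|i j]; first exact: ltW.
  have := mx_entry_le_norm ((u y)%:M - (u x)%:M : 'rV[R]_1) 0 0.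
  rewrite !mxE !mulr1n => /le_trans-/(_ _ uy) {}uy.
  by case: eqP => _; rewrite ?mulr1n// !mulr0n subrr normr0 ltW.
by exists d => // y /dP; rewrite !mul_scalar_mx.
Qed.

Lemma cont_at_near p q r (f g : 'rV[R]_p -> 'M[R]_(q, r)) x d : 0 < d ->
  (forall y, `|y - x| < d -> f y = g y) -> cont_at f x -> cont_at g x.
Proof.
move=> d0 fg fc e /fc[d' d'0 d'P]; exists (Num.min d d'); first by rewrite lt_min d0.
move=> y; rewrite lt_min => /andP[yd yd']; rewrite -!fg//; first exact: d'P.
by rewrite subrr normr0.
Qed.

Lemma cont_at_row_mx p q a b (f : 'rV[R]_p -> 'M[R]_(q, a)) (g : 'rV[R]_p -> 'M[R]_(q, b)) x :
  cont_at f x -> cont_at g x -> cont_at (fun y => row_mx (f y) (g y)) x.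
Proof.
move=> fc gc e e0; have [d d0 dP] := fc _ e0; have [d' d'0 d'P] := gc _ e0.
exists (Num.min d d'); first by rewrite lt_min d0.
move=> y; rewrite lt_min => /andP[/dP fy /d'P gy].
by rewrite sub_row_mx; apply: norm_row_mx => //; exact: ltW.
Qed.

Lemma cont_atP p q r (f : 'rV[R]_p -> 'M[R]_(q, r)) x :
  {for x, continuous f} <-> cont_at f x.
Proof.
split=> [fc e e0|fc B /nbhs_ballP[e /= e0 eB]].
  have /fc : nbhs (f x) (ball (f x) e) by exact: nbhsx_ballx.
  move=> /nbhs_ballP[d /= d0 dP]; exists d => // y yx.
  have : ball x d y by rewrite mx_norm_ball /ball_/= distrC.
  by move=> /dP /=; rewrite mx_norm_ball /ball_/= distrC => /ltW.
have e2 : 0 < e / 2 by rewrite divr_gt0.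
have [d d0 dP] := fc _ e2; apply/nbhs_ballP; exists d => // y.
rewrite mx_norm_ball /ball_/= distrC => /dP yx; apply: eB.
rewrite mx_norm_ball /ball_/= distrC; apply: le_lt_trans yx _.
by rewrite ltr_pdivrMr// ltr_pMr// ltr1n.
Qed.

Lemma expanding_unitmx n (A : 'M[R]_n) : (forall v : 'rV[R]_n, `|v| <= 2 * `|v *m A|) ->
  A \in unitmx.
Proof.
move=> eA; rewrite -row_free_unit; apply: inj_row_free => v vA.
by apply/eqP; rewrite -normr_le0 (le_trans (eA v))// vA normr0 mulr0.
Qed.

Lemma near_id_expanding n (A : 'M[R]_n) : n%:R * `|A - 1%:M| <= 2^-1 ->
  forall v : 'rV[R]_n, `|v| <= 2 * `|v *m A|.
Proof.
move=> A1 v; have : `|v *m (A - 1%:M)| <= 2^-1 * `|v|.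
  by apply: (le_trans (norm_mulmx _ _)); rewrite mulrAC ler_wpM2r.
rewrite mulmxBr mulmx1 distrC => vA.
have := ler_normD (v - v *m A) (v *m A); rewrite subrK; lra.
Qed.

Lemma norm_invmx_le n (A : 'M[R]_n) : (forall v : 'rV[R]_n, `|v| <= 2 * `|v *m A|) ->
  `|invmx A| <= 2.
Proof.
move=> eA; apply: mx_norm_le => // i j; pose v : 'rV[R]_n := delta_mx 0 i.
have v1 : `|v| <= 1.
  apply: row_norm_le => // k; rewrite mxE eqxx/=.
  by case: eqP => _; rewrite ?normr1 ?normr0.
have -> : invmx A i j = (v *m invmx A) ord0 j by rewrite -rowE [RHS]mxE.
apply: (le_trans (mx_entry_le_norm _ _ _)); apply: (le_trans (eA _)).
by rewrite mulmxKV ?expanding_unitmx// -[leRHS]mulr1 ler_pM2l.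
Qed.

Lemma cont_at_invmx p n (f : 'rV[R]_p -> 'M[R]_n) x d : 0 < d ->
  (forall y, `|y - x| < d -> forall v : 'rV[R]_n, `|v| <= 2 * `|v *m f y|) ->
  cont_at f x -> cont_at (fun y => invmx (f y)) x.
Proof.
move=> d0 fe fc e e0; pose c : R := 4 * n%:R * n%:R + 1.
have c0 : 0 < c by rewrite ltr_wpDl ?mulr_ge0.
have ec : 0 < e / c by rewrite divr_gt0.
have [d' d'0 d'P] := fc _ ec.
exists (Num.min d d'); first by rewrite lt_min d0.
move=> y; rewrite lt_min => /andP[yd /d'P yx].
have xd : `|x - x| < d by rewrite subrr normr0.
have uy := expanding_unitmx (fe _ yd); have ux := expanding_unitmx (fe _ xd).
have -> : invmx (f y) - invmx (f x) = invmx (f y) *m ((f x - f y) *m invmx (f x)).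
  by rewrite mulmxBl mulmxBr mulmxV// mulmx1 mulKmx.
apply: (le_trans (norm_mulmx _ _)).
apply: (@le_trans _ _ (n%:R * 2 * (n%:R * (e / c) * 2))).
  apply: ler_pM; rewrite ?mulr_ge0//.
    by rewrite ler_wpM2l// norm_invmx_le//; exact: fe.
  apply: (le_trans (norm_mulmx _ _)); apply: ler_pM; rewrite ?mulr_ge0//.
    by rewrite ler_wpM2l// distrC.
  by rewrite norm_invmx_le//; exact: fe.
have -> : n%:R * 2 * (n%:R * (e / c) * 2) = e * (4 * n%:R * n%:R / c) by ring.
rewrite -[leRHS]mulr1 ler_wpM2l ?(ltW e0)//.
by rewrite ler_pdivrMr// mul1r lerDl.
Qed.

(** Only x is confined to the compact set; y is any nearby point. *)
Lemma uniform_cont p q r (f : 'rV[R]_p -> 'M[R]_(q, r)) (A : set 'rV[R]_p) :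
  compact A -> (forall x, A x -> cont_at f x) ->
  forall e, 0 < e -> exists2 d, 0 < d &
    forall x y, A x -> `|y - x| < d -> `|f y - f x| <= e.
Proof.
move=> cA fc e e0.
pose G l := [set x | exists2 s, l.+1%:R^-1 < s &
  forall y z, `|y - x| < s -> `|z - x| < s -> `|f y - f z| <= e].
have oG l : open (G l).
  apply/open_nballP => x [s ls sP]; exists (s - l.+1%:R^-1); first by rewrite subr_gt0.
  move=> x'; rewrite /nball/= => xx'; exists (s - `|x' - x|); first by rewrite ltrBrDl -ltrBrDr.
  have H y : `|y - x'| < s - `|x' - x| -> `|y - x| < s.
    have := ler_distD x' y x; lra.
  by move=> y z /H yx /H zx; exact: sP.
have AG : A `<=` \bigcup_l G l.
  move=> x /fc fx; have e2 : 0 < e / 2 by rewrite divr_gt0.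
  have [d d0 dP] := fx _ e2; have [l] := ltr_add_invr d0; rewrite add0r => ld.
  exists l => //; exists d => // y z /dP fy /dP fz.
  by have := ler_distD (f x) (f y) (f z); rewrite (distrC (f x)); lra.
have [N AN] := finite_open_cover cA oG AG.
exists N.+1%:R^-1; first by rewrite invr_gt0.
move=> x y /AN[l /= lN [s ls sP]] yx; apply: sP; last first.
  by rewrite subrr normr0; apply: lt_trans ls; rewrite invr_gt0.
apply: lt_trans yx (le_lt_trans _ ls).
by rewrite lef_pV2 ?posrE ?ltr0n// ler_nat ltnS ltnW.
Qed.

Lemma compact_cont_bounded p q r (f : 'rV[R]_p -> 'M[R]_(q, r)) (A : set 'rV[R]_p) :
  compact A -> (forall x, A x -> cont_at f x) ->
  exists2 M, 0 < M & forall x, A x -> `|f x| <= M.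
Proof.
move=> cA fc.
pose G (l : nat) := [set x | exists2 s, 0 < s & forall y, `|y - x| < s -> `|f y| <= l%:R].
have oG l : open (G l).
  apply/open_nballP => x [s s0 sP]; exists (s / 2); first by rewrite divr_gt0.
  move=> x'; rewrite /nball/= => xx'; exists (s / 2); first by rewrite divr_gt0.
  by move=> y yx; apply: sP; have := ler_distD x' y x; lra.
have AG : A `<=` \bigcup_l G l.
  move=> x /fc /(_ 1 ltr01)[d d0 dP]; exists (Num.bound (`|f x| + 1)) => //.
  exists d => // y /dP fy; apply: ltW; apply: le_lt_trans (archi_boundP _); last by rewrite addr_ge0.
  by rewrite -(subrK (f x) (f y)) addrC (le_trans (ler_normD _ _))// lerD2l.
have [N AN] := finite_open_cover cA oG AG.
exists N.+1%:R; first by rewrite ltr0n.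
move=> x /AN[l /= lN [s s0 sP]]; apply: le_trans (sP x _) _; first by rewrite subrr normr0.
by rewrite ler_nat; apply: leq_trans (ltnW lN) _.
Qed.

End continuity.

(** * Deformations along the fibres of a constant rank map *)

(** In A = col_base * row_base, S is a left inverse of the first factor and P a right inverse of the
    second. *)
Lemma rank_factorization (F : fieldType) n (A : 'M[F]_n) m : \rank A = m ->
  exists (P : 'M[F]_(n, m)) (S : 'M[F]_(m, n)), S *m (A *m P) = 1%:M.
Proof.
move=> <-; have /row_fullP[S SB] := col_base_full A.
have /row_freeP[P BP] := row_base_free A.
by exists P, S; rewrite -[X in S *m (X *m P)](mulmx_base A) mulmxA mulmxA SB mul1mx.
Qed.

(** The kernel of A is contained in that of A P; equal ranks make them equal. *)
Lemma kernel_of_rank (F : fieldType) n m (A : 'M[F]_n) (P : 'M[F]_(n, m)) (v : 'rV[F]_n) :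
  \rank (A *m P) = \rank A -> v *m (A *m P) = 0 -> v *m A = 0.
Proof.
move=> rk vAP; apply/sub_kermxP.
suff : (kermx (A *m P) <= kermx A)%MS.
  by apply: submx_trans; apply/sub_kermxP.
have ke : (kermx A <= kermx (A *m P))%MS.
  by apply/sub_kermxP; rewrite mulmxA mulmx_ker mul0mx.
by rewrite -(geq_leqif (mxrank_leqif_sup ke)) !mxrank_ker rk.
Qed.

Section deformations.
Context {R : realType} (m n : nat).

(* Deformations x |-> X x w of the identity on B which shift F by w, where f is a
   Lipschitz function of F; D x w W is the Jacobian of x |-> f (X x (w x)) when w has
   Jacobian W. *)
Record deformation (f : 'rV[R]_n -> 'rV[R]_n) (J : 'rV[R]_n -> 'M[R]_n) (B : set 'rV[R]_n)
    (F : 'rV[R]_n -> 'rV[R]_m) (X : 'rV[R]_n -> 'rV[R]_m -> 'rV[R]_n)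
    (D : 'rV[R]_n -> 'rV[R]_m -> 'M[R]_(n, m) -> 'M[R]_n) (C s0 : R) : Prop := Deformation {
  deformation_lip : forall x y, B x -> B y -> `|F x - F y| <= C * `|x - y|;
  deformation_factor : forall x y w v, B x -> B y -> `|w| <= s0 -> `|v| <= s0 ->
    `|f (X x w) - f (X y v)| <= C * `|(F x + w) - (F y + v)|;
  deformation_close : forall x w, B x -> `|w| <= s0 -> `|f (X x w) - f x| <= C * `|w|;
  deformation_jac : forall (w : 'rV[R]_n -> 'rV[R]_m) x W, B x ->
    (forall y, `|w y| <= s0) -> has_jac w x W ->
    has_jac (fun y => f (X y (w y))) x (D x (w x) W);
  deformation_rank : forall x w W, B x -> `|w| <= s0 -> `|W| <= s0 -> \rank (D x w W) = m;
  deformation_cont : forall (w : 'rV[R]_n -> 'rV[R]_m) W x, B x ->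
    (forall y, `|w y| <= s0) -> cont_at w x -> cont_at W x ->
    cont_at (fun y => D y (w y) (W y)) x;
  deformation_near : forall t, 0 < t -> exists2 s, 0 < s & forall x w W, B x ->
    `|w| <= s -> `|W| <= s -> `|D x w W - J x| <= t }.

End deformations.

(* The displacement of a contraction of a compact set attains its minimum, which
   must then be 0. *)
Lemma contraction_fixpoint {R : realType} n (A : set 'rV[R]_n) (phi : 'rV[R]_n -> 'rV[R]_n) :
  compact A -> A !=set0 -> (forall x, A x -> A (phi x)) ->
  (forall x y, A x -> A y -> `|phi x - phi y| <= 2^-1 * `|x - y|) ->
  exists2 x, A x & phi x = x.
Proof.
move=> cA A0 Aphi phiL.
have [g [gL gphi]] := @lipschitz_extension R n n A phi 2^-1 (ltac:(by [])) phiL.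
have gc : continuous (fun x => `|g x - x| : R).
  move=> x B /nbhs_ballP[e /= e0 eB]; apply/nbhs_ballP.
  exists (e / 2) => /=; first by rewrite divr_gt0.
  move=> y; rewrite mx_norm_ball /ball_/= => xy; apply: eB; rewrite -ball_normE /ball_/=.
  apply: (le_lt_trans (ler_dist_dist _ _)).
  rewrite (_ : g x - x - (g y - y) = (g x - g y) - (x - y)); last first.
    by apply/rowP => i; rewrite !mxE; ring.
  apply: (le_lt_trans (ler_normB _ _)); have := gL x y; lra.
have [x xA xmin] := EVT_min_rV A0 cA (continuous_subspaceT gc).
rewrite inE in xA; exists x => //.
have := xmin (phi x); rewrite inE => /(_ (Aphi _ xA)); rewrite !gphi//; last exact: Aphi.
have := phiL _ _ (Aphi _ xA) xA => h1 h2; apply/eqP; rewrite -subr_eq0 -normr_le0; lra.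
Qed.

(** * The chart that straightens the fibres *)

Section local_chart.
Context {R : realType} (m n : nat).
Variables (f : 'rV[R]_n -> 'rV[R]_n) (J : 'rV[R]_n -> 'M[R]_n) (x0 : 'rV[R]_n) (r0 M0 c0 : R).
Variables (P : 'M[R]_(n, m)) (S : 'M[R]_(m, n)).
Let V := nball x0 r0.
Hypotheses (r0_gt0 : 0 < r0) (M0_gt0 : 0 < M0).
Hypothesis fJ : forall x, V x -> has_jac f x (J x).
Hypothesis Jc : forall x, V x -> cont_at J x.
Hypothesis Jm : forall x, V x -> \rank (J x) = m.
Hypothesis JM : forall x, V x -> `|J x| <= M0.
Hypothesis SJP : S *m (J x0 *m P) = 1%:M.

Let F x := f x *m P.
Let T := J x0 *m P.
(** Tangent to the identity at [x0]. Since [S *m T] is the identity, [Psi x *m T] is [F x] up to a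
    constant: in the chart [Psi] the map [F] becomes the linear map [T]. *)
Let Psi x := x + (F x - F x0 - (x - x0) *m T) *m S.
Let JPsi x := 1%:M + (J x *m P - T) *m S.

Hypotheses (c0_ge0 : 0 <= c0) (c0_le : n%:R * c0 <= 2^-1).
Hypothesis JPsi_near1 : forall x, V x -> `|JPsi x - 1%:M| <= c0.

Let V_segment x y (t : R) : V x -> V y -> 0 <= t <= 1 -> V (x + t *: (y - x)).
Proof.
rewrite /V /nball/= => xV yV /andP[t0 t1].
have -> : x + t *: (y - x) - x0 = (1 - t) *: (x - x0) + t *: (y - x0).
  by apply/rowP => i; rewrite !mxE; ring.
apply: (le_lt_trans (ler_normD _ _)); rewrite !normrZ ger0_norm ?subr_ge0// (ger0_norm t0).
set a := `|x - x0| in xV *; set b := `|y - x0| in yV *.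
have Mr : Num.max a b < r0 by rewrite gt_max xV.
apply: le_lt_trans Mr; set M := Num.max a b.
have aM : a <= M by rewrite le_max lexx.
have bM : b <= M by rewrite le_max lexx orbT.
nra.
Qed.

Let f_lip x y : V x -> V y -> `|f y - f x| <= n%:R * M0 * `|y - x|.
Proof.
move=> xV yV; have := @mean_value_le R n n f J 0 M0 x y (ltW M0_gt0).
rewrite mulmx0 subr0; apply => t t01; first by apply: fJ; exact: V_segment.
by rewrite subr0; apply: JM; exact: V_segment.
Qed.

Let Psi_jac x : V x -> has_jac Psi x (JPsi x).
Proof.
move=> xV; rewrite /JPsi.
have idj : has_jac (fun y : 'rV[R]_n => y) x 1%:M.
  by move=> e e0; exists 1 => // y _; rewrite mulmx1 subrr normr0 mulr_ge0// ltW.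
apply: has_jacD => //; apply: has_jac_mulmx.
have -> : J x *m P - T = J x *m P + (0 + 1%:M *m (- T)) by rewrite mul1mx add0r.
have -> : (fun y => F y - F x0 - (y - x0) *m T) =
  (fun y => f y *m P + (x0 *m T - F x0 + y *m (- T))).
  by apply/funext => y; rewrite /F mulmxBl mulmxN; apply/rowP => i; rewrite !mxE; ring.
apply: has_jacD; first by apply: has_jac_mulmx; exact: fJ.
by apply: has_jacD; [exact: has_jac_cst|exact: has_jac_mulmx].
Qed.

Let JPsi_cont x : V x -> cont_at JPsi x.
Proof.
move=> xV; apply: cont_atD; first exact: cont_at_cst.
apply: cont_at_mulmx; last exact: cont_at_cst.
apply: cont_atD; last exact: cont_at_cst.
by apply: cont_at_mulmx; [exact: Jc|exact: cont_at_cst].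
Qed.

Let JPsi_expanding x : V x -> forall v : 'rV[R]_n, `|v| <= 2 * `|v *m JPsi x|.
Proof.
move=> /JPsi_near1 h; apply: near_id_expanding; apply: le_trans c0_le.
by rewrite ler_wpM2l.
Qed.

Let Psi_near_id x y : V x -> V y -> `|Psi y - Psi x - (y - x)| <= 2^-1 * `|y - x|.
Proof.
move=> xV yV; rewrite -[y - x]mulmx1.
apply: le_trans (_ : n%:R * c0 * `|y - x| <= _); last by rewrite mulmx1 ler_wpM2r.
apply: (@mean_value_le R n n Psi JPsi) => // t t01.
  by apply: Psi_jac; exact: V_segment.
by apply: JPsi_near1; exact: V_segment.
Qed.

Let Psi_expanding x y : V x -> V y -> `|y - x| <= 2 * `|Psi y - Psi x|.
Proof.
move=> xV yV; have := Psi_near_id xV yV; rewrite distrC.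
have := ler_normD (y - x - (Psi y - Psi x)) (Psi y - Psi x); rewrite subrK; lra.
Qed.

Let Psi_lip x y : V x -> V y -> `|Psi y - Psi x| <= 2 * `|y - x|.
Proof.
move=> xV yV; have := Psi_near_id xV yV.
have := ler_normD (Psi y - Psi x - (y - x)) (y - x); rewrite subrK.
have := normr_ge0 (y - x); lra.
Qed.

Let PsiT x : Psi x *m T = x0 *m T + F x - F x0.
Proof.
rewrite /Psi [LHS]mulmxDl -mulmxA SJP mulmx1 mulmxBl.
by apply/rowP => i; rewrite !mxE; ring.
Qed.

Let JPsiT x : JPsi x *m T = J x *m P.
Proof. by rewrite /JPsi [LHS]mulmxDl mul1mx -mulmxA SJP mulmx1 addrC subrK. Qed.

(** J P = JPsi T with JPsi invertible, so composing with [P] loses no rank on [V], not just at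
    [x0]. *)
Let rank_JP x : V x -> \rank (J x *m P) = \rank (J x).
Proof.
move=> xV; rewrite Jm// -JPsiT.
have /eqmxMfull-> : row_full (JPsi x).
  by rewrite row_full_unit; apply: expanding_unitmx; exact: JPsi_expanding.
apply/eqP; rewrite eqn_leq rank_leq_col /=.
by rewrite -[X in (X <= _)%N](mxrank1 R m) -SJP mxrankM_maxr.
Qed.

Let r1 := r0 / 4.

(** A fixed point of z |-> z + (Psi x + v - Psi z), a contraction by 1/2 as [Psi] is close to the
    identity; it preserves the ball of radius [r1] around x because |v| <= r1/2. *)
Let solve x v : `|x - x0| <= r1 -> `|v| <= r1 / 2 ->
  exists2 z, `|z - x| <= r1 & Psi z = Psi x + v.
Proof.
move=> xr vr; pose A := [set z | `|z - x| <= r1].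
have AV z : A z -> V z.
  rewrite /A /V /nball/= => zx; have := ler_distD x z x0; have := r0_gt0.
  by move: zx xr; rewrite /r1; lra.
have xA : A x by rewrite /A/= subrr normr0 /r1 divr_ge0// ltW.
pose phi z := z + (Psi x + v - Psi z).
have phiE z w : phi z - phi w = - (Psi z - Psi w - (z - w)).
  by rewrite /phi; apply/rowP => i; rewrite !mxE; ring.
have cA : compact A.
  apply: (@compact_row _ _ _ (`|x| + r1)); first exact: closed_norm_le.
  move=> z zx; rewrite -(subrK x z) addrC (le_trans (ler_normD _ _))// lerD2l.
  exact: zx.
have phi_near z : A z -> A (phi z).
  move=> Az; have Vx := AV _ xA; have Vz := AV _ Az.
  rewrite /A/= (_ : phi z - x = v - (Psi z - Psi x - (z - x))); last first.
    by rewrite /phi; apply/rowP => i; rewrite !mxE; ring.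
  apply: (le_trans (ler_normB _ _)); have := Psi_near_id Vx Vz; move: Az; rewrite /A/=; lra.
have [z w Az Aw|z Az zE] := contraction_fixpoint cA (ex_intro _ x xA) phi_near.
  by rewrite phiE normrN; apply: Psi_near_id; exact: AV.
exists z => //; move/(congr1 (fun u => u - z)): zE.
by rewrite /phi subrr [z + _]addrC addrK => /subr0_eq.
Qed.

Let Z_ex : exists Z : 'rV[R]_n -> 'rV[R]_n -> 'rV[R]_n, forall x v,
  `|x - x0| <= r1 -> `|v| <= r1 / 2 -> `|Z x v - x| <= r1 /\ Psi (Z x v) = Psi x + v.
Proof.
have [Z ZP] := @choice ('rV[R]_n * 'rV[R]_n)%type 'rV[R]_n (fun xv z =>
  `|xv.1 - x0| <= r1 -> `|xv.2| <= r1 / 2 -> `|z - xv.1| <= r1 /\ Psi z = Psi xv.1 + xv.2)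
  ltac:(move=> [x v]; have [xr|] := pselect (`|x - x0| <= r1);
    [have [vr|] := pselect (`|v| <= r1 / 2); [by have [z zx zE] := solve xr vr; exists z|by exists 0]
    |by exists 0]).
by exists (fun x v => Z (x, v)) => x v; exact: (ZP (x, v)).
Qed.

Let Z := projT1 (cid Z_ex).

Let ZP x v : `|x - x0| <= r1 -> `|v| <= r1 / 2 ->
  [/\ `|Z x v - x0| <= r0 / 2, V x, V (Z x v) & Psi (Z x v) = Psi x + v].
Proof.
move=> xr vr; have [zr zE] := projT2 (cid Z_ex) x v xr vr.
have := ler_distD x (Z x v) x0 => zx.
have zr0 : `|Z x v - x0| <= r0 / 2 by move: xr zr zx; rewrite /r1; lra.
by split => //; rewrite /V /nball/=; move: xr zr0 r0_gt0; rewrite /r1; lra.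
Qed.

Let Z_near x v : `|x - x0| <= r1 -> `|v| <= r1 / 2 -> `|Z x v - x| <= 2 * `|v|.
Proof.
move=> xr vr; have [_ Vx Vz zE] := ZP xr vr.
by have := Psi_expanding Vx Vz; rewrite zE [Psi x + v]addrC addrK.
Qed.

Let Z_lip x v x' v' : `|x - x0| <= r1 -> `|v| <= r1 / 2 -> `|x' - x0| <= r1 -> `|v'| <= r1 / 2 ->
  `|Z x' v' - Z x v| <= 2 * `|(Psi x' + v') - (Psi x + v)|.
Proof.
move=> xr vr xr' vr'; have [_ Vx Vz zE] := ZP xr vr; have [_ Vx' Vz' zE'] := ZP xr' vr'.
by rewrite -zE -zE'; exact: Psi_expanding.
Qed.

Let JPsi_unit x : V x -> JPsi x \in unitmx.
Proof. by move=> xV; apply: expanding_unitmx; exact: JPsi_expanding. Qed.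

Let F_Z x (w : 'rV[R]_m) : `|x - x0| <= r1 -> `|w *m S| <= r1 / 2 ->
  F (Z x (w *m S)) = F x + w.
Proof.
move=> xr wr; have [_ _ _ zE] := ZP xr wr.
have := congr1 (mulmx^~ T) zE; rewrite /= [in RHS]mulmxDl -mulmxA SJP mulmx1 !PsiT.
move=> h; have : F (Z x (w *m S)) = x0 *m T + F (Z x (w *m S)) - F x0 + (F x0 - x0 *m T).
  by apply/rowP => i; rewrite !mxE; ring.
by rewrite h => ->; apply/rowP => i; rewrite !mxE; ring.
Qed.

(* f is constant along the fibres of F, which Psi straightens. *)
Let fibre_constant y z : `|y - x0| <= r1 -> V z -> `|Psi z - Psi y| < r1 / 2 ->
  F z = F y -> f z = f y.
Proof.
move=> yr Vz; set v := Psi z - Psi y => vr Fzy.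
have vT : v *m T = 0 by rewrite /v [LHS]mulmxBl !PsiT Fzy subrr.
have ZyE v' : V v' -> `|Psi v' - Psi y| <= r1 / 2 -> Z y (Psi v' - Psi y) = v'.
  move=> Vv' vr'; have [_ _ Vz' zE] := ZP yr vr'.
  apply/eqP; rewrite -subr_eq0 -normr_le0; have := Psi_expanding Vv' Vz'.
  rewrite zE (_ : Psi y + (Psi v' - Psi y) = Psi v') ?subrr ?normr0 ?mulr0//.
  by move: (Psi v') (Psi y) => a b; rewrite addrC subrK.
have r10 : 0 < r1 by rewrite /r1 divr_gt0.
have Vy : V y by rewrite /V /nball/=; move: yr r0_gt0; rewrite /r1; lra.
have Z0 : Z y 0 = y by rewrite -{2}(ZyE y) ?subrr ?normr0// divr_ge0// ltW.
rewrite -(ZyE z) ?(ltW vr)// -/v -{2}Z0; apply/eqP; rewrite -subr_eq0; apply/eqP/rowP => j.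
have [|t t01 ->] := @mean_value R n n (f \o Z y)
  (fun u => 1%:M *m invmx (JPsi (Z y u)) *m J (Z y u)) 0 v j.
  move=> t /andP[t0 t1]; rewrite subr0 add0r.
  have tv : `|t *: v| < r1 / 2.
    rewrite normrZ (ger0_norm t0); apply: le_lt_trans vr.
    by rewrite -[leRHS]mul1r ler_wpM2r.
  have [_ _ Vzt zE] := ZP yr (ltW tv).
  apply: has_jac_comp; last exact: fJ.
  apply: (@has_jac_lift _ _ _ Psi (Z y) (fun u => Psi y + u) _ (JPsi (Z y (t *: v))) 1%:M 2
    (r1 / 2 - `|t *: v|)) => //.
  - by rewrite subr_gt0.
  - move=> u ut; have ur : `|u| <= r1 / 2 by have := ler_normD (u - t *: v) (t *: v); rewrite subrK; lra.
    by have [] := ZP yr ur.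
  - move=> u ut; have ur : `|u| <= r1 / 2 by have := ler_normD (u - t *: v) (t *: v); rewrite subrK; lra.
    exact: (Z_lip yr (ltW tv) yr ur).
  - exact: Psi_jac.
  - exact: JPsi_unit.
  - move=> e e0; exists 1 => // u _.
    by rewrite mulmx1 opprD addrACA subrr add0r subrr normr0 mulr_ge0// ltW.
rewrite subr0 add0r mul1mx mulmxA; set A := JPsi _; set B := J _.
have tv : `|t *: v| <= r1 / 2.
  case/andP: t01 => t0 t1; rewrite normrZ (ger0_norm t0); apply: le_trans (ltW vr).
  by rewrite -[leRHS]mul1r ler_wpM2r.
have [_ _ Vzt _] := ZP yr tv.
(* The velocity along the path is v JPsi^-1. From J P = JPsi T follows v JPsi^-1 J P = v T = 0, and
   then v JPsi^-1 J = 0 because [P] loses no rank. *)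
rewrite (@kernel_of_rank _ _ _ B P) ?mxE//; first exact: rank_JP.
by rewrite -JPsiT mulmxA mulmxKV ?vT//; exact: JPsi_unit.
Qed.

Let sS := m%:R * `|S| + 1.
Let LF := n%:R * (n%:R * M0) * `|P|.
Let kappa := m%:R * LF * `|S| + 1.
(** For points within 4 r of each other the correction in [fibre_lip] is then at most 4 kappa r =
    r1/24. In [s0], the bound r keeps displacements below r/2, and the bound 1 keeps
    [JPsi x + W *m S] invertible. *)
Let r := r1 / (96 * kappa).
Let s0 := Num.min r 1 / (4 * (n%:R + 1) * sS).
Let CC := n%:R * M0 * (2 * sS) + LF + 1.
Let X x (w : 'rV[R]_m) := Z x (w *m S).
(** From Psi (X y (w y)) = Psi y + w y S, [has_jac_lift] gives the first two factors as the Jacobian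
    of y |-> X y (w y); [J] follows by the chain rule. *)
Let D x (w : 'rV[R]_m) (W : 'M[R]_(n, m)) :=
  (JPsi x + W *m S) *m invmx (JPsi (X x w)) *m J (X x w).

Let sS_ge1 : 1 <= sS.
Proof. by rewrite lerDr mulr_ge0. Qed.

Let sS_gt0 : 0 < sS.
Proof. exact: lt_le_trans sS_ge1. Qed.

Let c4_gt0 : 0 < 4 * (n%:R + 1) * sS.
Proof. by rewrite mulr_gt0// mulr_gt0// ltr_wpDl. Qed.

Let LF_ge0 : 0 <= LF.
Proof. by rewrite /LF !mulr_ge0// ltW. Qed.

Let kappa_ge1 : 1 <= kappa.
Proof. by rewrite /kappa lerDr mulr_ge0// mulr_ge0. Qed.

Let r1_gt0 : 0 < r1.
Proof. by rewrite divr_gt0. Qed.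

Let r_gt0 : 0 < r.
Proof. by rewrite divr_gt0// mulr_gt0// (lt_le_trans ltr01). Qed.

Let r_kappa : 96 * kappa * r = r1.
Proof. by rewrite mulrC divfK// gt_eqF// mulr_gt0// (lt_le_trans ltr01). Qed.

Let r_r1 : 96 * r <= r1.
Proof. by rewrite -r_kappa -mulrA ler_pM2l// ler_peMl// ltW. Qed.

Let s0_gt0 : 0 < s0.
Proof. by rewrite /s0 divr_gt0 ?lt_min ?r_gt0 ?ltr01. Qed.

Let s0_sS : 4 * (n%:R + 1) * (sS * s0) <= Num.min r 1.
Proof.
by rewrite mulrA mulrC divfK// gt_eqF.
Qed.

Let wS (w : 'rV[R]_m) : `|w *m S| <= sS * `|w|.
Proof. by apply: (le_trans (norm_mulmx _ _)); rewrite mulrAC ler_wpM2r// lerDl. Qed.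

Let WS (W : 'M[R]_(n, m)) : `|W *m S| <= sS * `|W|.
Proof. by apply: (le_trans (norm_mulmx _ _)); rewrite mulrAC ler_wpM2r// lerDl. Qed.

Let s0_bounds (t : R) : t <= s0 -> 4 * (sS * t) <= r /\ 4 * n%:R * (sS * t) <= 1.
Proof.
move=> ts; have : sS * t <= sS * s0 by rewrite ler_wpM2l// (le_trans ler01).
have : 0 <= sS * s0 by rewrite mulr_ge0 ?(ltW s0_gt0)// (le_trans ler01).
have : 0 <= n%:R :> R by [].
have := s0_sS; rewrite le_min => /andP[]; move: (n%:R) (sS * s0) (sS * t) => a b c *.
by split; nra.
Qed.

Let w_small (w : 'rV[R]_m) : `|w| <= s0 -> 4 * `|w *m S| <= r /\ `|w *m S| <= r1 / 2.
Proof.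
move=> /s0_bounds[h _]; have := wS w; have := r_r1; have := r_gt0.
by move: (sS * _) h => b h *; split; lra.
Qed.

Let x_near x : nball x0 r x -> `|x - x0| <= r1.
Proof. by rewrite /nball/= => xr; have := r_r1; have := r_gt0; lra. Qed.

Let B_V x : nball x0 r x -> V x.
Proof.
by move=> /x_near xr; rewrite /V /nball/=; apply: (le_lt_trans xr); rewrite ltr_pdivrMr// ltr_pMr// ltr1n.
Qed.

Let X_near x w : nball x0 r x -> `|w| <= s0 -> `|X x w - x| <= 2 * `|w *m S|.
Proof. by move=> /x_near xr /w_small[_ wr]; exact: Z_near. Qed.

Let F_lip x y : V x -> V y -> `|F y - F x| <= LF * `|y - x|.
Proof.
move=> xV yV; rewrite /F -mulmxBl; apply: (le_trans (norm_mulmx _ _)).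
rewrite /LF (_ : _ * `|y - x| = n%:R * (n%:R * M0 * `|y - x|) * `|P|); last by ring.
by rewrite ler_wpM2r// ler_wpM2l//; exact: f_lip.
Qed.

(** Lift y' by [Z] to a point z on the fibre of y, at distance at most 2 |u S|. There f z = f y, and
    f is Lipschitz between y' and z. *)
Let fibre_lip y y' : `|y - x0| <= r1 -> `|y' - x0| <= r1 -> `|y - y'| <= 4 * r ->
  `|f y - f y'| <= CC * `|F y - F y'|.
Proof.
move=> yr yr' yy; set u := F y - F y'.
have ball_V v : `|v - x0| <= r1 -> V v.
  by move=> vr; rewrite /V /nball/=; move: vr r0_gt0; rewrite /r1; lra.
have uS : `|u *m S| <= r1 / 24.
  apply: (le_trans (norm_mulmx _ _)).
  apply: (@le_trans _ _ (kappa * (4 * r))); last by rewrite -r_kappa; lra.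
  apply: (@le_trans _ _ (m%:R * (LF * (4 * r)) * `|S|)).
    rewrite ler_wpM2r// ler_wpM2l//; apply: (le_trans (F_lip (ball_V _ yr') (ball_V _ yr))).
    by rewrite ler_wpM2l.
  have -> : m%:R * (LF * (4 * r)) * `|S| = m%:R * LF * `|S| * (4 * r) by ring.
  by rewrite ler_wpM2r ?lerDl// mulr_ge0// ltW.
have uS2 : `|u *m S| <= r1 / 2 by have := r1_gt0; lra.
have [_ _ Vz zE] := ZP yr' uS2; have Fz := F_Z yr' uS2; have zn := Z_near yr' uS2.
set z := Z y' (u *m S) in Vz zE Fz zn.
have fz : f z = f y.
  apply: fibre_constant => //; last by rewrite Fz /u addrC subrK.
  apply: (le_lt_trans (Psi_lip (ball_V _ yr) Vz)).
  have := ler_distD y' z y; rewrite (distrC y'); have := r_r1; have := r1_gt0; lra.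
rewrite -fz; apply: (le_trans (f_lip (ball_V _ yr') Vz)).
apply: (@le_trans _ _ (n%:R * M0 * (2 * sS) * `|u|)).
  rewrite -[leRHS]mulrA ler_wpM2l ?mulr_ge0 ?(ltW M0_gt0)//.
  by apply: (le_trans zn); rewrite -mulrA ler_wpM2l.
by rewrite ler_wpM2r// /CC -addrA lerDl addr_ge0.
Qed.

Let XP x w : nball x0 r x -> `|w| <= s0 ->
  [/\ `|X x w - x0| <= r0 / 2, V x, V (X x w) & Psi (X x w) = Psi x + w *m S].
Proof. by move=> /x_near xr /w_small[_ wr]; exact: ZP. Qed.

Let X_cont (w : 'rV[R]_n -> 'rV[R]_m) x : nball x0 r x ->
  (forall y, `|w y| <= s0) -> cont_at w x -> cont_at (fun y => X y (w y)) x.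
Proof.
move=> Bx ws wc.
have yc : cont_at (fun y => Psi y + w y *m S) x.
  apply: cont_atD; first exact: has_jac_cont (Psi_jac (B_V Bx)).
  by apply: cont_at_mulmx => //; exact: cont_at_cst.
have /open_nballP/(_ _ Bx)[d1 d10 d1B] := @open_nball R n x0 r.
move=> e e0; have e2 : 0 < e / 2 by rewrite divr_gt0.
have [d d0 dP] := yc _ e2; exists (Num.min d1 d); first by rewrite lt_min d10.
move=> y; rewrite lt_min => /andP[/d1B By /dP yx].
have [_ wr] := w_small (ws x); have [_ wr'] := w_small (ws y).
have := Z_lip (x_near Bx) wr (x_near By) wr'; rewrite -!/(X _ _); lra.
Qed.

Let cB : compact [set z : 'rV[R]_n | `|z - x0| <= r0 / 2].
Proof.
apply: (@compact_row _ _ _ (`|x0| + r0 / 2)); first exact: closed_norm_le.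
move=> z zx; rewrite -(subrK x0 z) addrC (le_trans (ler_normD _ _))// lerD2l.
exact: zx.
Qed.

Let cB_V z : `|z - x0| <= r0 / 2 -> V z.
Proof. by move=> zr; rewrite /V /nball/=; have := r0_gt0; lra. Qed.

Let CC_gt0 : 0 < CC.
Proof. by rewrite /CC ltr_wpDl// addr_ge0// !mulr_ge0// ltW. Qed.

Let r_le : r <= r0.
Proof. by have := r_r1; have := r_gt0; have := r0_gt0; rewrite /r1; lra. Qed.

Lemma chart_deformation : exists r F (X : 'rV[R]_n -> 'rV[R]_m -> 'rV[R]_n) D C s0,
  [/\ 0 < r, r <= r0, 0 < C, 0 < s0 & deformation f J (nball x0 r) F X D C s0].
Proof.
exists r, F, X, D, CC, s0; split; [exact: r_gt0|exact: r_le|exact: CC_gt0|exact: s0_gt0|].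
have CC_LF : LF <= CC by rewrite /CC -addrA addrCA lerDl addr_ge0// !mulr_ge0// ltW.
split.
- move=> x y Bx By; apply: (le_trans (F_lip (B_V By) (B_V Bx))).
  by rewrite ler_wpM2r.
- move=> x y w v Bx By ws vs; have [w4 wr] := w_small ws; have [v4 vr] := w_small vs.
  have Fx := F_Z (x_near Bx) wr; have Fy := F_Z (x_near By) vr.
  rewrite -Fx -Fy; have := X_near Bx ws; have := X_near By vs; move: Bx By; rewrite /nball/=.
  rewrite -!/(X _ _) => Bx By Xy Xx; have := r_r1; have := r_gt0 => h1 h2.
  apply: fibre_lip.
  + by have := ler_distD x (X x w) x0; lra.
  + by have := ler_distD y (X y v) x0; lra.
  + have := ler_distD x (X x w) (X y v); have := ler_distD y x (X y v).
    by have := ler_distD x0 x y; rewrite (distrC x0) (distrC y (X _ _)); lra.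
- move=> x w Bx ws; have [_ Vx Vz _] := XP Bx ws.
  apply: (le_trans (f_lip Vx Vz)); apply: (@le_trans _ _ (n%:R * M0 * (2 * sS) * `|w|)).
    rewrite -[leRHS]mulrA ler_wpM2l ?mulr_ge0 ?(ltW M0_gt0)//.
    by apply: (le_trans (X_near Bx ws)); rewrite -mulrA ler_wpM2l.
  by rewrite ler_wpM2r// /CC -addrA lerDl addr_ge0.
- move=> w x W Bx ws wW; have [_ Vx Vz _] := XP Bx (ws x).
  apply: has_jac_comp; last exact: fJ.
  have /open_nballP/(_ _ Bx)[d1 d10 d1B] := @open_nball R n x0 r.
  apply: (@has_jac_lift _ _ _ Psi (fun y => X y (w y)) (fun y => Psi y + w y *m S) _ _ _ 2 d1) => //.
  + by move=> y /d1B By; have [] := XP By (ws y).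
  + move=> y /d1B By; have [_ wr] := w_small (ws x); have [_ wr'] := w_small (ws y).
    exact: (Z_lip (x_near Bx) wr (x_near By) wr').
  + exact: Psi_jac.
  + exact: JPsi_unit.
  + by apply: has_jacD; [exact: Psi_jac|exact: has_jac_mulmx].
- move=> x w W Bx ws Ws; have [_ Vx Vz _] := XP Bx ws; have [_ Ws4] := s0_bounds Ws.
  (* JPsi x shrinks a vector v at most to |v|/2, while |v W S| <= |v|/4 by the choice of [s0]. *)
  have uA : JPsi x + W *m S \in unitmx.
    rewrite -row_free_unit; apply: inj_row_free => v vA; apply/eqP; rewrite -normr_le0.
    have := JPsi_expanding Vx v.
    have -> : v *m JPsi x = - (v *m (W *m S)) by apply/eqP; rewrite -addr_eq0 -mulmxDr vA.
    rewrite normrN; have := norm_mulmx v (W *m S).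
    have : n%:R * `|v| * `|W *m S| <= n%:R * `|v| * (sS * `|W|) by rewrite ler_wpM2l ?mulr_ge0.
    have := ler_wpM2r (normr_ge0 v) Ws4.
    have := normr_ge0 v; move: (sS * `|W|) (n%:R) => a b; move: `|v| `|v *m _| `|_ *m _| => c d e.
    nra.
  rewrite /D; have /eqmxMfull-> : row_full ((JPsi x + W *m S) *m invmx (JPsi (X x w))).
    by rewrite row_full_unit unitmx_mul uA unitmx_inv JPsi_unit.
  exact: Jm.
- move=> w W x Bx ws wc Wc; have [_ Vx Vz _] := XP Bx (ws x).
  have Xc := X_cont Bx ws wc.
  have /open_nballP/(_ _ Bx)[d1 d10 d1B] := @open_nball R n x0 r.
  apply: cont_at_mulmx; last by apply: (cont_at_comp Xc); exact: Jc.
  apply: cont_at_mulmx.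
    apply: cont_atD; first exact: JPsi_cont.
    by apply: cont_at_mulmx => //; exact: cont_at_cst.
  apply: (@cont_at_invmx _ _ _ _ _ d1) => //.
    by move=> y /d1B By; have [_ _ Vzy _] := XP By (ws y); exact: JPsi_expanding.
  by apply: (cont_at_comp Xc); exact: JPsi_cont.
- move=> t t0; pose K : R := 2 * n%:R * n%:R * M0 + 1.
  have K1 : 1 <= K by rewrite lerDr !mulr_ge0// ltW.
  have K0 : 0 < K by apply: lt_le_trans K1.
  have t3 : 0 < t / 3 / K by rewrite !divr_gt0.
  have sS0 : 0 < sS by apply: lt_le_trans sS_ge1.
  have [d1 d10 d1P] := uniform_cont cB (fun z zr => Jc (cB_V zr)) t3.
  have [d2 d20 d2P] := uniform_cont cB (fun z zr => JPsi_cont (cB_V zr)) t3.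
  exists (Num.min (Num.min s0 (t / 3 / K / sS)) (Num.min (d1 / (4 * sS)) (d2 / (4 * sS)))).
    by rewrite !lt_min s0_gt0 !divr_gt0 ?mulr_gt0.
  move=> x w W Bx; rewrite !le_min -!andbA => /and4P[ws _ wd1 wd2] /and4P[_ Wt _ _].
  rewrite ler_pdivlMr ?mulr_gt0// in wd1; rewrite ler_pdivlMr ?mulr_gt0// in wd2.
  rewrite ler_pdivlMr// in Wt.
  have [_ Vx Vz _] := XP Bx ws; have Xw := X_near Bx ws; have wSw := wS w.
  set z := X x w in Vz Xw *.
  have xr : `|x - x0| <= r0 / 2 by have := x_near Bx; have := r0_gt0; rewrite /r1; lra.
  have zd1 : `|z - x| < d1 by have := normr_ge0 w; nra.
  have zd2 : `|z - x| < d2 by have := normr_ge0 w; nra.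
  have J1 := d1P _ _ xr zd1; have J2 := d2P _ _ xr zd2.
  rewrite /D -/z; set A := _ *m invmx _.
  have -> : A *m J z - J x = (A - 1%:M) *m J z + (J z - J x).
    by rewrite mulmxBl mul1mx addrA subrK.
  have AE : A - 1%:M = (JPsi x - JPsi z + W *m S) *m invmx (JPsi z).
    by rewrite -(mulmxV (JPsi_unit Vz)) -mulmxBl addrAC.
  have A1 : `|A - 1%:M| <= n%:R * (t / 3 / K + t / 3 / K) * 2.
    rewrite AE; apply: (le_trans (norm_mulmx _ _)); apply: ler_pM; rewrite ?mulr_ge0//.
      rewrite ler_wpM2l//; apply: (le_trans (ler_normD _ _)); rewrite distrC lerD//.
      by apply: (le_trans (WS W)); rewrite mulrC.
    by apply: norm_invmx_le; exact: JPsi_expanding.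
  apply: (le_trans (ler_normD _ _)); apply: (@le_trans _ _ (2 * (t / 3) + t / 3)); last lra.
  apply: lerD; last first.
    by apply: (le_trans J1); rewrite ler_pdivrMr// ler_peMr// divr_ge0// ltW.
  apply: (le_trans (norm_mulmx _ _)).
  apply: (@le_trans _ _ (n%:R * (n%:R * (t / 3 / K + t / 3 / K) * 2) * M0)).
    by apply: ler_pM; rewrite ?mulr_ge0 ?ler_wpM2l//; exact: JM.
  have -> : n%:R * (n%:R * (t / 3 / K + t / 3 / K) * 2) * M0 = 2 * n%:R * n%:R * M0 * (2 * (t / 3 / K)).
    by ring.
  apply: (@le_trans _ _ (K * (2 * (t / 3 / K)))).
    by rewrite ler_wpM2r ?lerDl// mulr_ge0// ltW.
  by rewrite mulrCA [K * _]mulrC divfK// gt_eqF.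
Qed.

End local_chart.

Lemma local_deformation {R : realType} (m n : nat) (f : 'rV[R]_n -> 'rV[R]_n)
    (J : 'rV[R]_n -> 'M[R]_n) (U : set 'rV[R]_n) x0 :
  open U -> U x0 -> (forall x, U x -> has_jac f x (J x)) ->
  (forall x, U x -> cont_at J x) -> (forall x, U x -> \rank (J x) = m) ->
  exists r F (X : 'rV[R]_n -> 'rV[R]_m -> 'rV[R]_n) D C s0,
  [/\ 0 < r, nball x0 r `<=` U, 0 < C, 0 < s0 & deformation f J (nball x0 r) F X D C s0].
Proof.
move=> oU Ux0 fJ Jc Jm; have [P [S SJP]] := rank_factorization (Jm _ Ux0).
(* [k] bounds the passage from J to JPsi, so it is enough to have J within c0 / k of [J x0]; [c0]
   provides the contraction margin n * c0 <= 1/2. *)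
pose k : R := n%:R * (m%:R * `|P| * `|S|) + 1.
have k0 : 0 < k by rewrite ltr_wpDl// !mulr_ge0.
pose c0 : R := (2 * (n%:R + 1))^-1.
have c00 : 0 < c0 by rewrite invr_gt0 mulr_gt0// ltr_wpDl.
have c0n : n%:R * c0 <= 2^-1.
  by rewrite /c0 invfM mulrCA -[leRHS]mulr1 ler_pM2l// ler_pdivrMr ?mul1r ?lerDl// ltr_wpDl.
have e0 : 0 < Num.min 1 (c0 / k) by rewrite lt_min ltr01 divr_gt0.
have [d d0 dP] := Jc _ Ux0 _ e0.
have [d1 d10 d1U] := (open_nballP U).1 oU _ Ux0.
pose r0 := Num.min d d1; have r00 : 0 < r0 by rewrite lt_min d0.
have VU : nball x0 r0 `<=` U.
  by move=> x xr; apply: d1U; move: xr; rewrite /nball/= lt_min => /andP[].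
have Jd x : nball x0 r0 x -> `|J x - J x0| <= Num.min 1 (c0 / k).
  by rewrite /nball/= lt_min => /andP[xd _]; exact: dP.
have J1 x : nball x0 r0 x -> `|J x - J x0| <= 1 by move=> /Jd; rewrite le_min => /andP[].
have J2 x : nball x0 r0 x -> `|J x - J x0| <= c0 / k by move=> /Jd; rewrite le_min => /andP[].
have [|||||||||r [F [X [D [C [s0 [r_gt0 rr C0 s00 H]]]]]]] :=
    @chart_deformation R m n f J x0 r0 (`|J x0| + 1) c0 P S r00.
- by rewrite ltr_wpDl.
- by move=> x /VU; exact: fJ.
- by move=> x /VU; exact: Jc.
- by move=> x /VU; exact: Jm.
- by move=> x xV; rewrite -[J x](subrK (J x0)) addrC (le_trans (ler_normD _ _))// lerD2l J1.
- exact: SJP.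
- exact: ltW.
- exact: c0n.
- move=> x xV; rewrite addrC addKr -mulmxBl -mulmxA.
  apply: (le_trans (norm_mulmx _ _)); apply: (@le_trans _ _ (k * (c0 / k))); last first.
    by rewrite mulrC divfK// gt_eqF.
  apply: (@le_trans _ _ (n%:R * (m%:R * `|P| * `|S|) * (c0 / k))); last first.
    by rewrite ler_wpM2r ?lerDl// divr_ge0// ltW.
  rewrite mulrAC; apply: ler_pM; rewrite ?mulr_ge0//; last exact: J2.
  by rewrite ler_wpM2l// norm_mulmx.
exists r, F, X, D, C, s0; split=> // x xr; apply: VU; move: xr; rewrite /nball/= => xr.
exact: lt_le_trans rr.
Qed.

(** * Local perturbations *)

Section bumps.
Context {R : realType} (n : nat).
Implicit Types (u v : 'rV[R]_n -> R) (x y : 'rV[R]_n).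

Definition scal u : 'rV[R]_n -> 'rV[R]_1 := fun y => (u y)%:M.

Definition gradient u (G : 'rV[R]_n -> 'cV[R]_n) :=
  forall x, has_jac (scal u) x (G x) /\ cont_at G x.

(* Products with such a u extend by 0 across {u = 0} in a C^1 way. *)
Definition flat u := exists2 G, gradient u G & forall x, u x = 0 -> G x = 0.

Lemma norm_scalar (a : R) : `|a%:M : 'rV[R]_1| = `|a|.
Proof.
apply/le_anti/andP; split.
  by apply: row_norm_le => // i; rewrite mxE (ord1 i) mulr1n.
by have := coord_le_norm (a%:M : 'rV[R]_1) 0; rewrite mxE mulr1n.
Qed.

Lemma scalar_sub (a b : R) : (a%:M - b%:M : 'rV[R]_1) = (a - b)%:M.
Proof. by apply/rowP => i; rewrite !mxE (ord1 i) !mulr1n. Qed.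

Lemma norm_scalar_sub (a b : R) : `|(a%:M : 'rV[R]_1) - b%:M| = `|a - b|.
Proof. by rewrite scalar_sub norm_scalar. Qed.

Lemma flat1 : flat (fun=> 1).
Proof.
exists (fun=> 0) => // x; split; last exact: cont_at_cst.
exact: has_jac_cst.
Qed.

Lemma flatM u v : flat u -> flat v -> flat (fun y => u y * v y).
Proof.
move=> [G uG G0] [H vH H0].
exists (fun x => G x *m (v x)%:M + u x *: H x) => [x|x].
  have [uGx Gc] := uG x; have [vHx Hc] := vH x; split.
    have -> : scal (fun y => u y * v y) = (fun y => u y *: scal v y).
      by apply/funext => y; apply/rowP => i; rewrite !mxE (ord1 i) !mulr1n.
    exact: has_jac_scale.
  apply: cont_atD; first by apply: cont_at_mulmx => //; exact: has_jac_cont vHx.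
  by apply: cont_at_scale => //; exact: has_jac_cont uGx.
move=> /eqP; rewrite mulf_eq0 => /orP[/eqP u0|/eqP v0].
  by rewrite G0// u0 mul0mx scale0r addr0.
by rewrite v0 H0// scaler0 addr0 (_ : 0%:M = 0) ?mulmx0//; apply/rowP => i; rewrite !mxE mul0rn.
Qed.

(** The simplest C^1 profile that vanishes on the negative half-line together with its
    derivative. *)
Definition pos_sq (t : R) : R := Num.max t 0 ^+ 2.

Lemma pos_sq_ge0 t : 0 <= pos_sq t.
Proof. exact: sqr_ge0. Qed.

Lemma pos_sq_eq0 t : (pos_sq t == 0) = (t <= 0).
Proof. by rewrite sqrf_eq0; apply/eqP/idP => [<-|/max_idPr//]; rewrite le_max lexx. Qed.

Lemma pos_sq_taylor (s t : R) : `|pos_sq s - pos_sq t - 2 * Num.max t 0 * (s - t)| <= (s - t) ^+ 2.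
Proof.
have sq := sqr_ge0 (s - t); rewrite /pos_sq.
have [s0|s0] := leP s 0; have [t0|t0] := leP t 0.
- by rewrite !(mulr0, mul0r, expr0n, subr0)/= normr0.
- rewrite expr0n/= sub0r ler_norml; apply/andP; split; nra.
- rewrite !(mulr0, mul0r, expr0n, subr0)/= ger0_norm ?sqr_ge0//; nra.
- rewrite (_ : _ - _ = (s - t) ^+ 2); last by ring.
  by rewrite ger0_norm.
Qed.

Lemma flat_pos_sq u G : gradient u G -> flat (fun y => pos_sq (u y)).
Proof.
move=> uG; exists (fun x => (2 * Num.max (u x) 0) *: G x) => [x|x /eqP]; last first.
  by rewrite pos_sq_eq0 => /max_idPr ->; rewrite mulr0 scale0r.
have [uGx Gc] := uG x; split.
  pose g (z : 'rV[R]_1) : 'rV[R]_1 := (pos_sq (z ord0 ord0))%:M.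
  have gA : has_jac g (scal u x) ((2 * Num.max (u x) 0)%:M).
    move=> e e0; exists e => // z.
    have [s ->] : exists s : R, z = s%:M.
      by exists (z ord0 ord0); apply/rowP => i; rewrite mxE (ord1 i) mulr1n.
    rewrite /g /scal [X in _ -> _ <= _ * X]norm_scalar_sub => su.
    rewrite norm_scalar_sub in su.
    rewrite (_ : _ - _ - _ = (pos_sq s - pos_sq (u x) - 2 * Num.max (u x) 0 * (s - u x))%:M); last first.
      by apply/rowP => i; rewrite (ord1 i) !mxE big_ord1 !mxE !mulr1n; ring.
    rewrite norm_scalar.
    apply: (le_trans (pos_sq_taylor _ _)).
    by rewrite -(real_normK (num_real _)) expr2 ler_wpM2r// ltW.
  have -> : scal (fun y => pos_sq (u y)) = g \o scal u.
    by apply/funext => y; rewrite /g /scal /= mxE mulr1n.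
  by rewrite -mul_mx_scalar; exact: has_jac_comp.
apply: cont_at_scale => //; have uc := has_jac_cont uGx.
move=> e e0; have e2 : 0 < e / 2 by rewrite divr_gt0.
have [d d0 dP] := uc _ e2; exists d => // y /dP; rewrite /scal !norm_scalar_sub => yx.
rewrite -mulrBr normrM (ger0_norm (ler0n R 2)) mulrC -ler_pdivlMr ?ltr0n//.
apply: le_trans yx.
have h1 := ler_norm (u y - u x); have h2 := ler_norm (u x - u y); rewrite distrC in h2.
rewrite ler_norml; have [y0|y0] := leP (u y) 0; have [x0|x0] := leP (u x) 0;
  apply/andP; split; lra.
Qed.

Lemma gradientN u G : gradient u G -> gradient (fun y => - u y) (fun x => - G x).
Proof.
move=> uG x; have [uGx Gc] := uG x; split.
  have -> : scal (fun y => - u y) = (fun y => scal u y *m (- 1)%:M).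
    by apply/funext => y; apply/rowP => i; rewrite mul_mx_scalar (ord1 i) !mxE !mulr1n mulN1r.
  rewrite -[- G x]scaleN1r -mul_mx_scalar; exact: has_jac_mulmx.
have -> : (fun x => - G x) = (fun x => G x *m (- 1)%:M).
  by apply/funext => y; rewrite mul_mx_scalar scaleN1r.
by apply: cont_at_mulmx => //; exact: cont_at_cst.
Qed.

(** Positive inside the Euclidean ball of squared radius [a]; Euclidean because the sup norm is not
    differentiable. A negative [a] encodes the empty ball. *)
Definition quadric (a : R) (c : 'rV[R]_n) : 'rV[R]_n -> R :=
  fun y => a - \sum_(j < n) (y ord0 j - c ord0 j) ^+ 2.

Lemma gradient_quadric a c : gradient (quadric a c) (fun x => - 2 *: (x - c)^T).
Proof.
move=> x; split; last first.
  move=> e e0; exists (e / 2) => [|y]; first by rewrite divr_gt0.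
  rewrite ltr_pdivlMr// mulrC => yx.
  rewrite -scalerBr normrZ normrN (ger0_norm (ler0n R 2)); apply: le_trans (ltW yx).
  rewrite ler_pM2l//; apply: mx_norm_le => // i j; rewrite !mxE opprB addrA subrK.
  by have := coord_le_norm (y - x) i; rewrite (ord1 j) !mxE.
move=> e e0; exists (e / (n%:R + 1)) => [|y]; first by rewrite divr_gt0// ltr_wpDl.
rewrite ltr_pdivlMr ?ltr_wpDl// => yx; rewrite /scal.
rewrite (_ : _ - _ - _ = (- \sum_(j < n) (y ord0 j - x ord0 j) ^+ 2)%:M); last first.
  pose T := \sum_(j < n) (y ord0 j - x ord0 j) * (- 2 * (x ord0 j - c ord0 j)).
  have -> : (y - x) *m (- 2 *: (x - c)^T) = T%:M.
    by apply/rowP => i; rewrite (ord1 i) !mxE mulr1n; apply: eq_bigr => j _; rewrite !mxE.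
  rewrite (_ : \sum_(j < n) (y ord0 j - x ord0 j) ^+ 2 =
    \sum_(j < n) (y ord0 j - c ord0 j) ^+ 2 - \sum_(j < n) (x ord0 j - c ord0 j) ^+ 2 + T); last first.
    by rewrite -sumrB -big_split/=; apply: eq_bigr => j _; ring.
  by apply/rowP => i; rewrite (ord1 i) /quadric !mxE !mulr1n; ring.
rewrite norm_scalar normrN; apply: (le_trans (ler_norm_sum _ _ _)).
apply: (@le_trans _ _ (\sum_(j < n) `|y - x| ^+ 2)).
  apply: ler_sum => j _; rewrite normrX lerXn2r ?nnegrE//.
  by have := coord_le_norm (y - x) j; rewrite !mxE.
rewrite sumr_const card_ord -[leLHS]mulr_natl expr2 mulrA ler_wpM2r//.
apply: le_trans (ltW yx); rewrite [leRHS]mulrC ler_wpM2r// lerDl//.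
Qed.

Lemma flat_cont u : flat u -> forall x, cont_at (scal u) x.
Proof. by move=> [G uG _] x; apply: has_jac_cont (uG x).1. Qed.

Lemma flat_open u : flat u -> (forall x, 0 <= u x) -> open [set x | u x != 0].
Proof.
move=> fu u0; apply/open_nballP => x /= ux.
have e0 : 0 < u x / 2 by rewrite divr_gt0// lt0r ux u0.
have [d d0 dP] := flat_cont fu x e0; exists d => // y /dP /=.
rewrite /scal norm_scalar_sub ler_norml => /andP[h _]; apply: lt0r_neq0; lra.
Qed.

(* Realized by Q x = (u x, u x *: x). *)
Record localizer u (Q : 'rV[R]_n -> 'rV[R]_(1 + n)) (JQ : 'rV[R]_n -> 'M[R]_(n, 1 + n))
    (C : R) : Prop := Localizer {
  localizer_jac : forall x, has_jac Q x (JQ x);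
  localizer_cont : forall x, cont_at JQ x;
  localizer_bound : forall x, `|Q x| <= C;
  localizer_jac_bound : forall x, `|JQ x| <= C;
  localizer_lip : forall x y, `|Q x - Q y| <= C * `|x - y|;
  localizer_zero : forall x, u x = 0 -> Q x = 0 /\ JQ x = 0;
  localizer_colip : forall d, 0 < d -> exists c, forall x y, d <= u x -> d <= u y ->
    `|x - y| <= c * `|Q x - Q y| }.

Lemma has_localizer u (M : R) : flat u -> 0 < M -> (forall x, M < `|x| -> u x = 0) ->
  exists Q JQ C, 0 < C /\ localizer u Q JQ C.
Proof.
move=> fu M0 uM; have uc := flat_cont fu; have [G uG G0] := fu.
pose Q x : 'rV[R]_(1 + n) := row_mx (scal u x) (u x *: x).
pose JQ x : 'M[R]_(n, 1 + n) := row_mx (G x) (G x *m x + u x *: 1%:M).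
have idj x : has_jac (fun y : 'rV[R]_n => y) x 1%:M.
  by move=> e e0; exists 1 => // y _; rewrite mulmx1 subrr normr0 mulr_ge0// ltW.
have QJ x : has_jac Q x (JQ x).
  have [uGx _] := uG x; apply: has_jac_row_mx => //.
  exact: has_jac_scale.
have Jc x : cont_at JQ x.
  have [uGx Gc] := uG x; apply: cont_at_row_mx => //.
  apply: cont_atD; first by apply: cont_at_mulmx => //; exact: has_jac_cont (idj x).
  by apply: cont_at_scale => //; exact: cont_at_cst.
have Q0 x : u x = 0 -> Q x = 0 /\ JQ x = 0.
  move=> ux; rewrite /Q /JQ /scal ux G0// mul0mx !scale0r addr0; split; last exact: row_mx0.
  by rewrite (_ : 0%:M = 0) ?row_mx0//; apply/rowP => i; rewrite !mxE mul0rn.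
have cB : compact [set x : 'rV[R]_n | `|x - 0| <= M].
  apply: (@compact_row _ _ _ M); first exact: closed_norm_le.
  by move=> x /=; rewrite subr0.
have [C1 C10 C1P] := compact_cont_bounded cB (fun x _ => has_jac_cont (QJ x)).
have [C2 C20 C2P] := compact_cont_bounded cB (fun x _ => Jc x).
have C1b x : `|Q x| <= C1.
  have [xM|/uM/Q0[-> _]] := leP `|x| M; first by apply: C1P; rewrite /= subr0.
  by rewrite normr0 ltW.
have C2b x : `|JQ x| <= C2.
  have [xM|/uM/Q0[_ ->]] := leP `|x| M; first by apply: C2P; rewrite /= subr0.
  by rewrite normr0 ltW.
exists Q, JQ, (C1 + C2 + n%:R * C2); split; first by rewrite ltr_wpDr ?mulr_ge0 ?addr_gt0// ltW.
have nC2 : 0 <= n%:R * C2 by rewrite mulr_ge0// ltW.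
split=> // [x|x|x y|d d0].
- by apply: (le_trans (C1b x)); rewrite -addrA lerDl addr_ge0// ltW.
- by apply: (le_trans (C2b x)); lra.
- have := @mean_value_le R n _ Q JQ 0 C2 y x (ltW C20).
  rewrite mulmx0 subr0 => H; apply: (le_trans (H _ _)) => [t _|t _|].
  + exact: QJ.
  + by rewrite subr0.
  + by rewrite ler_wpM2r// lerDr addr_ge0// ltW.
(* From u(x) (x - y) = (u(x) x - u(y) y) - (u(x) - u(y)) y, with |y| <= M because u(y) > 0. *)
exists ((1 + M) / d) => x y dx dy.
have yM : `|y| <= M by rewrite leNgt; apply/negP => /uM uy; move: dy; rewrite uy leNgt d0.
have QE : Q x - Q y = row_mx ((u x - u y)%:M) (u x *: x - u y *: y).
  by rewrite /Q sub_row_mx /scal scalar_sub.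
have E1 : `|u x - u y| <= `|Q x - Q y|.
  rewrite QE -norm_scalar; apply: mx_norm_le => // i j.
  have := mx_entry_le_norm (row_mx ((u x - u y)%:M) (u x *: x - u y *: y)) i (lshift n j).
  by rewrite row_mxEl.
have E2 : `|u x *: x - u y *: y| <= `|Q x - Q y|.
  rewrite QE; apply: mx_norm_le => // i j.
  have := mx_entry_le_norm (row_mx ((u x - u y)%:M) (u x *: x - u y *: y)) i (rshift 1 j).
  by rewrite row_mxEr.
rewrite mulrAC ler_pdivlMr// mulrC.
apply: (@le_trans _ _ `|u x *: (x - y)|).
  by rewrite normrZ ler_wpM2r// (le_trans dx)// ler_norm.
have -> : u x *: (x - y) = (u x *: x - u y *: y) - (u x - u y) *: y.
  by apply/rowP => i; rewrite !mxE; ring.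
apply: (le_trans (ler_normB _ _)); rewrite mulrDl mul1r normrZ; apply: lerD => //.
by rewrite mulrC; apply: ler_pM.
Qed.

End bumps.

(** On [E] the map [g] is a Lipschitz function of [P]: compose it with any section of [P]. *)
Lemma factor_null {R : realType} (m n p : nat) (m_gt0 : (0 < m)%N) (E : set 'rV[R]_n)
    (g : 'rV[R]_n -> 'rV[R]_p) (P : 'rV[R]_n -> 'rV[R]_m) (C : R) :
  (forall x y, E x -> E y -> `|g x - g y| <= C * `|P x - P y|) ->
  hausdorff m (P @` E) = 0%E -> hausdorff m (g @` E) = 0%E.
Proof.
move=> gP PE0.
have [s sP] : exists s : 'rV[R]_m -> 'rV[R]_n, forall u, (P @` E) u -> E (s u) /\ P (s u) = u.
  have [s sP] := @choice _ _ (fun u x => (P @` E) u -> E x /\ P x = u)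
    ltac:(move=> u; have [[x Ex Px]|] := pselect ((P @` E) u); [by exists x|by exists 0]).
  by exists s.
apply/le_anti; rewrite [X in _ && X]outer_measure_ge0 andbT.
rewrite -(@hausdorff_image0 R m m_gt0 m p (P @` E) (g \o s) C _ PE0); last first.
  move=> u v Eu Ev; have [su Pu] := sP _ Eu; have [sv Pv] := sP _ Ev.
  by apply: (le_trans (gP _ _ su sv)); rewrite Pu Pv.
apply: le_outer_measure => _ [x Ex <-]; exists (P x); first by exists x.
have PEx : (P @` E) (P x) by exists x.
have [sx Px] := sP _ PEx; apply/eqP; rewrite -subr_eq0 -normr_le0 /=.
by apply: (le_trans (gP _ _ sx Ex)); rewrite Px subrr normr0 mulr0.
Qed.

Lemma has_jacB {R : realType} p q (f g : 'rV[R]_p -> 'rV[R]_q) x A B :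
  has_jac f x A -> has_jac g x B -> has_jac (fun y => f y - g y) x (A - B).
Proof.
move=> fA gB; have -> : (fun y => f y - g y) = (fun y => f y + g y *m (- 1)%:M).
  by apply/funext => y; rewrite mul_mx_scalar scaleN1r.
rewrite -[- B]scaleN1r -mul_mx_scalar.
by apply: has_jacD => //; exact: has_jac_mulmx.
Qed.

Lemma cont_atB {R : realType} p q r (f g : 'rV[R]_p -> 'M[R]_(q, r)) x :
  cont_at f x -> cont_at g x -> cont_at (fun y => f y - g y) x.
Proof.
move=> fc gc; have -> : (fun y => f y - g y) = (fun y => f y + g y *m (- 1)%:M).
  by apply/funext => y; rewrite mul_mx_scalar scaleN1r.
apply: cont_atD => //; apply: cont_at_mulmx => //; exact: cont_at_cst.
Qed.

(** * Perturbation supported in one piece *)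

Section pieces.
Context {R : realType} (m n : nat) (m_gt0 : (0 < m)%N).
Variables (f : 'rV[R]_n -> 'rV[R]_n) (J : 'rV[R]_n -> 'M[R]_n) (U : set 'rV[R]_n).
Hypotheses (fJ : forall x, U x -> has_jac f x (J x)) (Jc : forall x, U x -> cont_at J x).

Definition deformable (B : set 'rV[R]_n) := exists F (X : 'rV[R]_n -> 'rV[R]_m -> 'rV[R]_n) D C s0,
  [/\ 0 < C, 0 < s0 & deformation f J B F X D C s0].

Lemma deformable_sub A B : A `<=` B -> deformable B -> deformable A.
Proof.
move=> AB [F [X [D [C [s0 [C0 s00 [d1 d2 d3 d4 d5 d6 d7]]]]]]].
exists F, X, D, C, s0; split=> //; split.
- by move=> x y /AB Bx /AB; exact: d1.
- by move=> x y w v /AB Bx /AB; exact: d2.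
- by move=> x w /AB; exact: d3.
- by move=> w x W /AB; exact: d4.
- by move=> x w W /AB; exact: d5.
- by move=> w W x /AB; exact: d6.
- by move=> t /d7[s s0' sP]; exists s => // x w W /AB; exact: sP.
Qed.

Lemma deformable_set0 : deformable set0.
Proof.
exists (fun=> 0), (fun=> fun=> 0), (fun=> fun=> fun=> 0), 1, 1; split=> //; split=> //.
by move=> t t0; exists 1.
Qed.

Variables (Ks : (set 'rV[R]_n)^nat).
Let K := \bigcup_l Ks l.
Hypotheses (Kcompact : forall l, compact (Ks l)) (Kincr : forall i j, (i <= j)%N -> Ks i `<=` Ks j).
Hypotheses (Koo : (hausdorff m K < +oo)%E) (Knull : graph_null m K).

Record perturbation (u : 'rV[R]_n -> R) (t : R) (d : 'rV[R]_n -> 'rV[R]_n)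
    (Dd : 'rV[R]_n -> 'M[R]_n) : Prop := Perturbation {
  perturbation_jac : forall x, has_jac d x (Dd x);
  perturbation_cont : forall x, cont_at Dd x;
  perturbation_le : forall x, `|d x| <= t;
  perturbation_jac_le : forall x, `|Dd x| <= t;
  perturbation_zero : forall x, u x = 0 -> d x = 0 /\ Dd x = 0;
  perturbation_rank : forall x, u x != 0 -> \rank (J x + Dd x)%R = m;
  perturbation_null :
    hausdorff m ((fun x => f x + d x) @` (K `&` [set x | u x != 0])) = 0%E }.

Lemma has_perturbation u (M t : R) : flat u -> (forall x, 0 <= u x) ->
  0 < M -> (forall x, M < `|x| -> u x = 0) ->
  [set x | u x != 0] `<=` U -> deformable [set x | u x != 0] -> 0 < t ->
  exists d Dd, perturbation u t d Dd.
Proof.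
move=> fu u0 M0 uM; set B := [set x | u x != 0] => BU.
move=> [F [X [D [C [s0 [C0 s00 defm]]]]]] t0.
have [Q [JQ [CQ [CQ0 loc]]]] := has_localizer fu M0 uM.
have oB : open B by exact: flat_open.
(* [shear_null] asks for maps defined and Lipschitz on all of R^n. *)
have [p [pC pF]] := @lipschitz_extension R n m B F C (ltW C0) (deformation_lip defm).
have [s1 s10 s1P] := deformation_near defm t0.
(* The three bounds keep the shift in the domain of the deformation, the Jacobian within t of J, and
   the values within t of f. *)
pose s := Num.min (Num.min s0 s1) (t / C).
have s_gt0 : 0 < s by rewrite !lt_min s00 s10 divr_gt0.
pose eps := s / ((1 + n)%:R * CQ).
have eps0 : 0 < eps by rewrite divr_gt0// mulr_gt0// ltr0n.
(* [Q] is co-Lipschitz only where u is bounded below, so {u != 0} is exhausted by compact sets with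
   u >= 1/(l+1). *)
pose Ks' l := Ks l `&` [set x | l.+1%:R^-1 <= u x].
have K'K : \bigcup_l Ks' l `<=` K by move=> x [l _ [Kx _]]; exists l.
have K'E : K `&` B `<=` \bigcup_l Ks' l.
  move=> x [[l1 _ Kx] Bx]; have ux : 0 < u x by rewrite lt0r Bx u0.
  have [l2] := ltr_add_invr ux; rewrite add0r => /ltW ul2.
  exists (maxn l1 l2) => //; split; first by apply: Kincr Kx; exact: leq_maxl.
  apply: le_trans ul2; rewrite lef_pV2 ?posrE ?ltr0n// ler_nat ltnS; exact: leq_maxr.
have K'c l : compact (Ks' l).
  have [M' M'0 M'P] := compact_row_bounded (@Kcompact l).
  apply: (@compact_row _ _ _ M'); last by move=> x [/M'P].
  apply: closedI; first exact: compact_row_closed.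
  apply/closed_nballP => x xu; apply/ler_addgt0Pr => e e0.
  have [dd dd0 ddP] := flat_cont fu x e0; have [y yu yx] := xu _ dd0.
  have := ddP _ yx; rewrite /scal norm_scalar_sub ler_norml => /andP[_ h].
  by apply: (le_trans yu); lra.
have K'oo : (hausdorff m (\bigcup_l Ks' l) < +oo)%E.
  by apply: le_lt_trans Koo; exact: le_outer_measure.
have K'null : graph_null m (\bigcup_l Ks' l).
  by move=> A P C' AK'; apply: Knull => x /AK'; exact: K'K.
have [b [beps bnull]] := @shear_null R m n (1 + n) m_gt0 Ks' p Q (C + CQ) K'c K'oo K'null
  ltac:(by rewrite addr_gt0)
  ltac:(by move=> x y; apply: (le_trans (pC x y)); rewrite ler_wpM2r// lerDl ltW)
  ltac:(by move=> x y; apply: (le_trans (localizer_lip loc x y)); rewrite ler_wpM2r// lerDr ltW)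
  ltac:(move=> l; have [|c cP] := @localizer_colip _ _ _ _ _ _ loc l.+1%:R^-1; [by rewrite invr_gt0|
    by exists c => x y [_ xl] [_ yl]; exact: cP]) eps eps0.
pose Lam : 'M[R]_(1 + n, m) := - \matrix_(j < 1 + n) b j.
pose w x := Q x *m Lam; pose W x := JQ x *m Lam.
have Lam_eps : `|Lam| <= eps.
  apply: mx_norm_le => [|i j]; first exact: ltW.
  rewrite !mxE normrN; apply: (le_trans (coord_le_norm _ _)); apply: ltW; exact: beps.
have sE : (1 + n)%:R * CQ * eps = s.
  by rewrite mulrC divfK// gt_eqF// mulr_gt0// ltr0n.
have small k (A : 'M[R]_(k, 1 + n)) : `|A| <= CQ -> `|A *m Lam| <= s.
  move=> AC; apply: (le_trans (norm_mulmx _ _)); rewrite -sE.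
  by apply: ler_pM; rewrite ?mulr_ge0// ler_wpM2l.
have ws x : `|w x| <= s by apply: small; exact: localizer_bound loc x.
have Ws x : `|W x| <= s by apply: small; exact: localizer_jac_bound loc x.
have ss0 : s <= s0 by rewrite /s !ge_min lexx.
have ss1 : s <= s1 by rewrite /s !ge_min lexx orbT.
have Cs : C * s <= t by rewrite mulrC -ler_pdivlMr// /s ge_min lexx orbT.
have ws0 x : `|w x| <= s0 by apply: le_trans ss0.
have wJ x : has_jac w x (W x) by apply: has_jac_mulmx; exact: localizer_jac loc x.
have Wc x : cont_at W x.
  by apply: cont_at_mulmx; [exact: localizer_cont loc x|exact: cont_at_cst].
have w0 x : u x = 0 -> w x = 0 /\ W x = 0.
  by move=> /(localizer_zero loc)[Qx JQx]; rewrite /w /W Qx JQx !mul0mx.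
have wE x : B x -> F x + w x = shear p Q b x.
  move=> Bx; rewrite -pF// /shear /w mulmx_sum_row; congr (_ + _).
  rewrite -sumrN; apply: eq_bigr => j _; rewrite -scalerN; congr (_ *: _).
  by apply/rowP => i; rewrite !mxE.
(* The extension by 0 is C^1: at a zero of u both w and W vanish, |d| <= C |w| makes d negligible to
   first order, and Dd is small wherever w and W are. *)
pose d x := if u x == 0 then 0 else f (X x (w x)) - f x.
pose Dd x := if u x == 0 then 0 else D x (w x) (W x) - J x.
have dB x : B x -> d x = f (X x (w x)) - f x by rewrite /d => /negbTE ->.
have DdB x : B x -> Dd x = D x (w x) (W x) - J x by rewrite /Dd => /negbTE ->.
have d0 x : u x = 0 -> d x = 0 by rewrite /d => ->; rewrite eqxx.
have Dd0 x : u x = 0 -> Dd x = 0 by rewrite /Dd => ->; rewrite eqxx.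
have dw x : `|d x| <= C * `|w x|.
  have [ux|Bx] := eqVneq (u x) 0; first by rewrite d0// normr0 mulr_ge0// ltW.
  by rewrite dB//; apply: (deformation_close defm).
have Dd_near e : 0 < e -> exists2 s', 0 < s' & forall x, `|w x| <= s' -> `|W x| <= s' -> `|Dd x| <= e.
  move=> e0; have [s' s'0 s'P] := deformation_near defm e0; exists s' => // x wx Wx.
  have [ux|Bx] := eqVneq (u x) 0; first by rewrite Dd0// normr0 ltW.
  by rewrite DdB//; exact: s'P.
exists d, Dd; split.
- move=> x; have [ux|Bx] := eqVneq (u x) 0.
    rewrite (Dd0 x ux) => e e0; have eC : 0 < e / C by rewrite divr_gt0.
    have [wx Wx] := w0 _ ux; have [dd dd0 ddP] := wJ x _ eC; exists dd => // y /ddP.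
    rewrite wx Wx mulmx0 !subr0 (d0 x ux) ?mulmx0 !subr0 => wy.
    by apply: (le_trans (dw y)); rewrite mulrC -ler_pdivlMr// mulrAC.
  have [dd dd0 ddB] := (open_nballP B).1 oB _ Bx.
  rewrite DdB//; apply: (has_jac_near dd0 (f := fun y => f (X y (w y)) - f y)).
    by move=> y /ddB By; rewrite dB.
  apply: has_jacB; last by apply: fJ; exact: BU.
  exact: (deformation_jac defm).
- move=> x; have [ux|Bx] := eqVneq (u x) 0.
    move=> e e0; have [s' s'0 s'P] := Dd_near _ e0; have [wx Wx] := w0 _ ux.
    have [d1 d10 d1P] := has_jac_cont (wJ x) s'0; have [d2 d20 d2P] := Wc x _ s'0.
    exists (Num.min d1 d2); first by rewrite lt_min d10.
    move=> y; rewrite lt_min => /andP[/d1P + /d2P]; rewrite wx Wx (Dd0 x ux) !subr0.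
    exact: s'P.
  have [dd dd0 ddB] := (open_nballP B).1 oB _ Bx.
  apply: (cont_at_near dd0 (f := fun y => D y (w y) (W y) - J y)).
    by move=> y /ddB By; rewrite DdB.
  apply: cont_atB; last by apply: Jc; exact: BU.
  apply: (deformation_cont defm) => //; exact: has_jac_cont (wJ x).
- by move=> x; apply: (le_trans (dw x)); apply: le_trans Cs; rewrite ler_wpM2l// ltW.
- move=> x; have [ux|Bx] := eqVneq (u x) 0; first by rewrite Dd0// normr0 ltW.
  by rewrite DdB//; apply: s1P => //; apply: le_trans ss1.
- by move=> x ux; rewrite d0// Dd0.
- move=> x Bx; rewrite DdB// addrC subrK.
  by apply: (deformation_rank defm) => //; apply: le_trans ss0.
- apply: (@factor_null R m n n m_gt0 _ _ (shear p Q b) C).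
    move=> x y [_ Bx] [_ By]; rewrite !dB// [f x + _]addrC [f y + _]addrC !subrK -!wE//.
    by apply: (deformation_factor defm).
  apply/le_anti; rewrite [X in _ && X]outer_measure_ge0 andbT -bnull.
  by apply: le_outer_measure => _ [x Kx <-]; exists x => //; exact: K'E.
Qed.

End pieces.

(** * Gluing *)

Section null_levels.
Context {R : realType} (m n : nat) (m_gt0 : (0 < m)%N).
Local Notation H := (@hausdorff R n m).

(* Finitely many levels carry mass at least 1/j: distinct levels are disjoint. *)
Lemma null_level (g : 'rV[R]_n -> R) (K : set 'rV[R]_n) (a b : R) :
  (forall t, closed [set x | g x = t]) -> (H K < +oo)%E -> a < b ->
  exists2 t, a < t < b & H (K `&` [set x | g x = t]) = 0%E.
Proof.
move=> gc Koo ab; apply: contrapT => nt.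
pose A (j : nat) := [set t | (j.+1%:R^-1%:E < H (K `&` [set x | g x = t]))%E].
have Afin j : finite_set (A j).
  apply: contrapT => /infiniteP/ppcard_leP[f].
  pose F i := [set x : 'rV[R]_n | g x = f i].
  have finj i k : f i = f k -> i = k by move=> e; apply: (inj (f := f)); rewrite ?inE.
  have tF : trivIset setT F.
    apply/trivIsetP => i k _ _ ik; apply/seteqP; split=> // x [/= gi gk].
    by move: (finj _ _ (etrans (esym gi) gk)) ik => ->; rewrite eqxx.
  have := @hausdorff_disjoint_le R n m F K (fun i => closed_caratheodory m_gt0 (gc (f i))) tF.
  have Kfin : H K \is a fin_num by rewrite ge0_fin_numE ?outer_measure_ge0.
  apply/negP; rewrite -ltNge -(fineK Kfin).
  pose N := Num.bound (fine (H K) * j.+1%:R).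
  apply: (@lt_le_trans _ _ (\sum_(0 <= i < N) (j.+1%:R^-1%:E : \bar R))%E).
    rewrite sumEFin lte_fin big_const_nat subn0 iter_addr_0 -[ltRHS]mulr_natl ltr_pdivlMr//.
    by apply: archi_boundP; rewrite mulr_ge0// fine_ge0 ?outer_measure_ge0.
  apply: le_trans (nneseries_lim_ge _ _); last by move=> i _ _; exact: outer_measure_ge0.
  by apply: lee_sum => i _; apply: ltW; exact: (@funS _ _ _ _ f i I).
have cA : countable (\bigcup_j A j).
  by apply: bigcup_countable => // j _; exact: finite_set_countable.
(* The interval is uncountable because its Lebesgue measure is positive. *)
have := countable_lebesgue_measure0 cA; apply/eqP; rewrite gt_eqF//.
have := lebesgue_measure_itv `]a, b[; rewrite /= lte_fin ab => mab.
apply: (@lt_le_trans _ _ (lebesgue_measure (`]a, b[%classic : set R))).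
  by rewrite mab -EFinD lte_fin subr_gt0.
apply: le_outer_measure => t /=; rewrite in_itv/= => tab.
have Ht : (0 < H (K `&` [set x | g x = t]))%E.
  rewrite lt0e outer_measure_ge0 andbT; apply/eqP => H0; apply: nt; by exists t.
have [e e0 eH] : exists2 e : R, 0 < e & (e%:E < H (K `&` [set x | g x = t]))%E.
  have Kfin : H (K `&` [set x | g x = t]) \is a fin_num.
    rewrite ge0_fin_numE ?outer_measure_ge0//; apply: le_lt_trans Koo.
    by apply: le_outer_measure => x [].
  exists (fine (H (K `&` [set x | g x = t])) / 2); first by rewrite divr_gt0// fine_gt0// Ht ltey_eq Kfin.
  rewrite -[ltRHS](fineK Kfin) lte_fin ltr_pdivrMr// ltr_pMr ?ltr1n//.
  by rewrite fine_gt0// Ht ltey_eq Kfin.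
have [j] := ltr_add_invr e0; rewrite add0r => je; exists j => //.
by apply: lt_trans eH; rewrite lte_fin.
Qed.

End null_levels.

Section gluing.
Context {R : realType} (n : nat).
Variables (u : nat -> 'rV[R]_n -> R) (d : nat -> 'rV[R]_n -> 'rV[R]_n).
Variable Dd : nat -> 'rV[R]_n -> 'M[R]_n.
Hypotheses (fu : forall i, flat (u i)) (u_ge0 : forall i x, 0 <= u i x).
Hypothesis u_disj : forall i j x, u i x != 0 -> u j x != 0 -> i = j.
Hypothesis dJ : forall i x, has_jac (d i) x (Dd i x).
Hypothesis Dc : forall i x, cont_at (Dd i) x.
Hypothesis D_le : forall i x, `|Dd i x| <= dyad i.
Hypothesis d0 : forall i x, u i x = 0 -> d i x = 0 /\ Dd i x = 0.

(** The delicate points are those where all u i vanish: infinitely many supports may accumulate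
    there. Finitely many d i are small to first order individually; for the others [D_le] and the
    mean value inequality give |d i y| <= n * dyad i * |y - x|. *)
Lemma glue : exists (g : 'rV[R]_n -> 'rV[R]_n) (Dg : 'rV[R]_n -> 'M[R]_n),
  [/\ forall x, has_jac g x (Dg x), forall x, cont_at Dg x,
      forall i x, u i x != 0 -> g x = d i x /\ Dg x = Dd i x &
      forall x, (forall i, u i x = 0) -> g x = 0 /\ Dg x = 0].
Proof.
have [idx idxP] : exists idx : 'rV[R]_n -> nat, forall i x, u i x != 0 -> idx x = i.
  have [idx P] := @choice _ _ (fun x j => forall i, u i x != 0 -> j = i)
    ltac:(move=> x; have [[i ux]|nu] := pselect (exists i, u i x != 0);
      [by exists i => j ux'; exact: u_disj ux ux'|by exists 0%N => i ux; exfalso; apply: nu; exists i]).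
  by exists idx => i x; exact: P.
pose g x := d (idx x) x; pose Dg x := Dd (idx x) x.
have gE i x : u i x != 0 -> g x = d i x /\ Dg x = Dd i x by rewrite /g /Dg => /idxP ->.
have g0 x : (forall i, u i x = 0) -> g x = 0 /\ Dg x = 0 by move=> ux; exact: d0.
have gcase y : (exists2 i, u i y != 0 & g y = d i y /\ Dg y = Dd i y) \/ (g y = 0 /\ Dg y = 0).
  have [uy|uy] := eqVneq (u (idx y) y) 0; first by right; exact: d0.
  by left; exists (idx y).
have loc i x : u i x != 0 -> exists2 r, 0 < r & forall y, `|y - x| < r -> u i y != 0.
  by move=> ux; have [r r0 rP] := (open_nballP _).1 (flat_open (fu i) (u_ge0 i)) _ ux; exists r.
have case0 x : (exists i, u i x != 0) \/ forall i, u i x = 0.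
  have [[i ui]|nu] := pselect (exists i, u i x != 0); [by left; exists i|right => i].
  by apply/eqP/negPn/negP => ui; apply: nu; exists i.
exists g, Dg; split=> // x; have [[i ux]|ux] := case0 x.
- have [r r0 rP] := loc _ _ ux; rewrite (gE _ _ ux).2.
  by apply: (has_jac_near r0 (f := d i)) => // y /rP /gE[].
- move=> e e0; have [gx Dgx] := g0 _ ux; rewrite gx Dgx.
  have en : 0 < e / (n%:R + 1) by rewrite divr_gt0// ltr_wpDl.
  have [N Ne] := dyad_small en.
  have [ds dsP] := @choice nat R (fun i r => 0 < r /\ forall y, `|y - x| < r -> `|d i y| <= e * `|y - x|)
    ltac:(move=> i; have [dx Dx] := d0 (ux i); have [r r0 rP] := dJ i x e0; exists r; split=> // y /rP;
      by rewrite dx Dx mulmx0 !subr0).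
  have [r r0 rP] := @finite_min_gt0 R ds N (fun i _ => (dsP i).1).
  exists r => // y yx; rewrite mulmx0 !subr0.
  have [[i uy [-> _]]|[-> _]] := gcase y; last by rewrite normr0 mulr_ge0// ltW.
  have [iN|Ni] := ltnP i N; first by apply: (dsP i).2; apply: lt_le_trans (rP i iN).
  have [dx Dx] := d0 (ux i).
  have := @mean_value_le R n n (d i) (Dd i) 0 (dyad i) x y (ltW (dyad_gt0 i)).
  rewrite dx mulmx0 !subr0 => H; apply: (le_trans (H _ _)) => [t _|t _|].
  + exact: dJ.
  + by rewrite subr0.
  rewrite ler_wpM2r//; apply: (@le_trans _ _ (n%:R * dyad N)).
    by rewrite ler_wpM2l// dyad_le.
  apply: (@le_trans _ _ ((n%:R + 1) * (e / (n%:R + 1)))).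
    by apply: ler_pM; rewrite ?(ltW (dyad_gt0 _)) ?lerDl// ltW.
  by rewrite mulrC divfK// gt_eqF// ltr_wpDl.
- have [r r0 rP] := loc _ _ ux.
  by apply: (cont_at_near r0 (f := Dd i)) => // y /rP /gE[].
- move=> e e0; have [gx Dgx] := g0 _ ux; rewrite Dgx.
  have [N Ne] := dyad_small e0.
  have [ds dsP] := @choice nat R (fun i r => 0 < r /\ forall y, `|y - x| < r -> `|Dd i y| <= e)
    ltac:(move=> i; have [dx Dx] := d0 (ux i); have [r r0 rP] := Dc i x e0; exists r; split=> // y /rP;
      by rewrite Dx !subr0).
  have [r r0 rP] := @finite_min_gt0 R ds N (fun i _ => (dsP i).1).
  exists r => // y yx; rewrite subr0.
  have [[i uy [_ ->]]|[_ ->]] := gcase y; last by rewrite normr0 ltW.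
  have [iN|Ni] := ltnP i N; first by apply: (dsP i).2; apply: lt_le_trans (rP i iN).
  by apply: (le_trans (D_le i y)); apply: (le_trans (dyad_le Ni)); exact: ltW.
Qed.

End gluing.

(** No Lipschitz bound is uniform on [N], but [N] is a countable union of sets of diameter below
    1/(l+1) on which the difference quotients of [g] at that scale are at most l+1. *)
Lemma differentiable_image_null {R : realType} (m n p : nat) (m_gt0 : (0 < m)%N)
    (g : 'rV[R]_n -> 'rV[R]_p) (N : set 'rV[R]_n) :
  (forall x, N x -> exists A, has_jac g x A) -> hausdorff m N = 0%E ->
  hausdorff m (g @` N) = 0%E.
Proof.
move=> gJ N0.
pose S (i : nat) := if unpickle i is Some (l, v) then
  [set x | [/\ N x, `|x - map_mx ratr (v : 'rV[rat]_n)| < (2 * l.+1%:R)^-1 &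
    forall y, `|y - x| < l.+1%:R^-1 -> `|g y - g x| <= l.+1%:R * `|y - x|]] else set0.
have NS : N `<=` \bigcup_i S i.
  move=> x Nx; have [A gA] := gJ _ Nx; have [c [d [c0 d0 dP]]] := has_jac_lip gA.
  have dc : 0 < Num.min d c^-1 by rewrite lt_min d0 invr_gt0.
  have [l] := ltr_add_invr dc; rewrite add0r lt_min => /andP[ld lc].
  have l0 : 0 < (2 * l.+1%:R)^-1 :> R by rewrite invr_gt0 mulr_gt0.
  have [v vx] := rational_row x l0.
  exists (pickle (l, v)) => //; rewrite /S pickleK; split=> //; first by rewrite distrC.
  move=> y yx; apply: (le_trans (dP _ (lt_trans yx ld))); rewrite ler_wpM2r// ltW//.
  by rewrite -ltf_pV2 ?posrE ?ltr0n.
apply/le_anti; rewrite [X in _ && X]outer_measure_ge0 andbT.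
apply: (@le_trans _ _ (hausdorff m (\bigcup_i (g @` S i)))).
  by apply: le_outer_measure => _ [x /NS[i _ Sx] <-]; exists i => //; exists x.
apply: (le_trans (outer_measure_sigma_subadditive _ _)); rewrite eseries0// => i _ _.
have SN : hausdorff m (S i) = 0%E.
  apply/le_anti; rewrite [X in _ && X]outer_measure_ge0 andbT -N0; apply: le_outer_measure.
  by rewrite /S; case: (unpickle i) => [[l v]|] x //= [].
rewrite /S in SN *; case: (unpickle i) SN => [[l v]|] SN; last by rewrite image_set0 outer_measure0.
apply: (@hausdorff_image0 R m m_gt0 n p _ g l.+1%:R _ SN) => x y [_ xv _] [_ yv]; apply.
have := ler_distD (map_mx ratr v) x y; rewrite (distrC (map_mx ratr v) y).
move: xv yv; rewrite invfM; move: l.+1%:R^-1 => k; lra.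
Qed.

Section spherical_cover.
Context {R : realType} (m n : nat) (m_gt0 : (0 < m)%N).
Local Notation H := (@hausdorff R n m).
Variables (U K : set 'rV[R]_n) (good : set 'rV[R]_n -> Prop).
Hypotheses (Koo : (H K < +oo)%E) (good0 : good set0).
Hypothesis good_sub : forall A B, A `<=` B -> good B -> good A.
Hypothesis good_loc : forall x, U x -> exists2 r, 0 < r & good (nball x r).

Lemma closed_sphere (c : 'rV[R]_n) (t : R) :
  closed [set x : 'rV[R]_n | \sum_(j < n) (x ord0 j - c ord0 j) ^+ 2 = t].
Proof.
apply/closed_nballP => x xt; apply/eqP; rewrite -subr_eq0 -normr_le0.
apply/ler_addgt0Pr => e e0; rewrite add0r.
have [d d0 dP] := has_jac_cont (gradient_quadric t c x).1 e0.
have [y yt yx] := xt _ d0; have := dP _ yx; rewrite /scal norm_scalar_sub /quadric [\sum_(_ < _) _]yt.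
by rewrite subrr sub0r opprB.
Qed.

(** Balls with rational centres, one for each dyadic range of radii, the radius being moved within
    its range until the sphere is null. A ball that is not good is discarded by setting its squared
    radius to -1. *)
Lemma spherical_cover : exists (a : nat -> R) (c : nat -> 'rV[R]_n),
  [/\ forall i, good [set x | 0 < quadric (a i) (c i) x],
      forall i, H (K `&` [set x | quadric (a i) (c i) x = 0]) = 0%E &
      U `<=` \bigcup_i [set x | 0 < quadric (a i) (c i) x]].
Proof.
pose cen i : 'rV[R]_n := if (unpickle i : option ('rV[rat]_n * nat)) is Some (v, _) then map_mx ratr v else 0.
pose lev i : nat := if (unpickle i : option ('rV[rat]_n * nat)) is Some (_, l) then l else 0%N.
have [rho rhoP] := @choice nat R (fun i t => dyad (lev i).+1 ^+ 2 < t < dyad (lev i) ^+ 2 /\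
    H (K `&` [set x : 'rV[R]_n | \sum_(j < n) (x ord0 j - cen i ord0 j) ^+ 2 = t]) = 0%E)
  ltac:(move=> i; have [|t t1 t2] := @null_level R m n m_gt0 _ K (dyad (lev i).+1 ^+ 2)
    (dyad (lev i) ^+ 2) (fun t => @closed_sphere (cen i) t) Koo; [|by exists t];
    by rewrite dyadS; have := @dyad_gt0 R (lev i); nra).
pose a i := if pselect (good [set x | 0 < quadric (rho i) (cen i) x]) then rho i else - 1.
have neg (c x : 'rV[R]_n) : quadric (- 1) c x < 0.
  have : 0 <= \sum_(j < n) (x ord0 j - c ord0 j) ^+ 2 by apply: sumr_ge0 => j _; exact: sqr_ge0.
  by rewrite /quadric; lra.
exists a, cen; split=> [i|i|x Ux].
- rewrite /a; case: pselect => [//|_] /=; apply: good_sub good0 => x /=.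
  by rewrite ltNge (ltW (neg _ _)).
- rewrite /a; case: pselect => [_|_] /=.
    rewrite -[RHS](rhoP i).2; congr (H (_ `&` _)); apply/seteqP; split=> x /=; rewrite /quadric.
      by move/eqP; rewrite subr_eq0 => /eqP.
    by move=> ->; rewrite subrr.
  rewrite (_ : [set x | _] = set0) ?setI0 ?outer_measure0//.
  by apply/seteqP; split=> // x /= x0; have := neg (cen i) x; rewrite x0 ltxx.
have [r r0 gr] := good_loc Ux; have r2 : 0 < r / 2 by rewrite divr_gt0.
have [l lr] := dyad_small r2.
have n1 : 0 < n%:R + 1 :> R by rewrite ltr_wpDl.
(* Closeness [del] in each coordinate gives squared Euclidean distance at most n * del^2 <= (dyad
   l.+1)^2, below the squared radius. *)
have [del del0 dE] : exists2 del : R, 0 < del & dyad l.+1 = (n%:R + 1) * del.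
  by exists (dyad l.+1 / (n%:R + 1)); rewrite ?divr_gt0 ?dyad_gt0// mulrC divfK// gt_eqF.
have [v vx] := rational_row x del0.
pose i := pickle (v, l); have ceni : cen i = map_mx ratr v by rewrite /cen /i pickleK.
have levi : lev i = l by rewrite /lev /i pickleK.
have [/andP[rho1 rho2] _] := rhoP i; rewrite levi in rho1 rho2.
exists i => //=; rewrite /a; case: pselect => [_|ng] /=.
  rewrite /quadric subr_gt0; apply: le_lt_trans rho1.
  apply: (@le_trans _ _ (\sum_(j < n) del ^+ 2)).
    apply: ler_sum => j _; rewrite -real_normK ?num_real// lerXn2r ?nnegrE// ?(ltW del0)//.
    apply: le_trans (ltW vx); rewrite ceni distrC.
    by have := coord_le_norm (map_mx ratr v - x) j; rewrite !mxE.
  rewrite sumr_const card_ord -[leLHS]mulr_natl.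
  rewrite dE exprMn ler_wpM2r ?sqr_ge0//.
  by have : 0 <= n%:R :> R by []; move: (n%:R) => k; nra.
exfalso; apply: ng; apply: good_sub gr => y /=; rewrite /quadric subr_gt0 /nball/= => yr.
have yc : `|y - cen i| < dyad l.
  apply: row_norm_lt => [|j]; first exact: dyad_gt0.
  rewrite -(@ltr_pXn2r _ 2)// ?nnegrE// ?(ltW (dyad_gt0 _))// real_normK ?num_real// !mxE.
  apply: le_lt_trans rho2; apply: le_trans (ltW yr); rewrite [leRHS](bigD1 j)//= lerDl.
  by apply: sumr_ge0 => k _; exact: sqr_ge0.
have cx : `|cen i - x| < dyad l.
  rewrite ceni; apply: (lt_le_trans vx); move: dE; rewrite dyadS.
  have : 0 <= n%:R :> R by []; move: (n%:R) => k; nra.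
by have := ler_distD (cen i) y x; lra.
Qed.

End spherical_cover.

Section generic_perturbation.
Context {R : realType} (m n : nat) (m_gt0 : (0 < m)%N).
Local Notation H := (@hausdorff R n m).
Variables (f : 'rV[R]_n -> 'rV[R]_n) (J : 'rV[R]_n -> 'M[R]_n) (U S : set 'rV[R]_n).
Hypotheses (oU : open U) (SU : S `<=` U) (Spu : purely_unrectifiable m S) (Soo : (H S < +oo)%E).
Hypotheses (fJ : forall x, U x -> has_jac f x (J x)) (Jc : forall x, U x -> cont_at J x).
Hypothesis Jm : forall x, U x -> \rank (J x) = m.

Theorem generic_perturbation (t : R) : 0 < t -> exists d Dd,
  [/\ forall x, has_jac d x (Dd x) /\ cont_at Dd x,
      forall x, `|d x| <= t /\ `|Dd x| <= t,
      forall x, ~ U x -> d x = 0,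
      forall x, U x -> \rank (J x + Dd x)%R = m &
      H ((fun x => f x + d x) @` S) = 0%E].
Proof.
move=> t0; have [Ks [Kc Ki KU Koo [Kn SK]]] := unrectifiable_sigma_compact m_gt0 oU SU Spu Soo.
set K := \bigcup_i Ks i in KU Koo Kn SK.
pose good B := B `<=` U /\ deformable m f J B.
have [|A B AB [BU dB]|x Ux|a [c [ggood gnull gcov]]] := @spherical_cover R m n m_gt0 U K good Koo.
- by split=> //; exact: deformable_set0.
- by split; [exact: subset_trans AB BU|exact: deformable_sub AB dB].
- have [r [F [X [D [C [s0 [r0 rU C0 s00 H]]]]]]] := local_deformation oU Ux fJ Jc Jm.
  by exists r => //; split=> //; exists F, X, D, C, s0.
pose phi i := quadric (a i) (c i).
(* Positive exactly inside ball i and outside the closed balls of smaller index. These regions are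
   disjoint, and those points of [U] that avoid all the spheres are covered, by the first ball that
   contains them. *)
pose u i y := pos_sq (phi i y) * \prod_(l < i) pos_sq (- phi l y).
have fu i : flat (u i).
  apply: flatM; first exact: flat_pos_sq (gradient_quadric _ _).
  rewrite (_ : (fun y => _) = (fun y => \prod_(l <- index_enum 'I_i) pos_sq (- phi l y)))//.
  elim: (index_enum 'I_i) => [|l s IH].
    by rewrite (_ : (fun y => _) = fun=> 1); [exact: flat1|apply/funext => y; rewrite big_nil].
  rewrite (_ : (fun y => _) = fun y => pos_sq (- phi l y) * \prod_(l <- s) pos_sq (- phi l y)).
    by apply: flatM => //; exact: flat_pos_sq (gradientN (gradient_quadric _ _)).
  by apply/funext => y; rewrite big_cons.
have u_ge0 i x : 0 <= u i x.
  by rewrite mulr_ge0 ?pos_sq_ge0// prodr_ge0// => l _; exact: pos_sq_ge0.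
have uP i x : u i x != 0 <-> 0 < phi i x /\ forall l, (l < i)%N -> phi l x < 0.
  rewrite mulf_eq0 negb_or pos_sq_eq0 -ltNge; split=> [/andP[-> /prodf_neq0 pl]|[-> pl]].
    split=> // l li; have := pl (Ordinal li) isT.
    by rewrite pos_sq_eq0 -ltNge oppr_gt0.
  by apply/prodf_neq0 => l _; rewrite pos_sq_eq0 -ltNge oppr_gt0 pl.
have u_disj i j x : u i x != 0 -> u j x != 0 -> i = j.
  move=> /uP[i0 il] /uP[j0 jl]; case: (ltngtP i j) => // [/jl|/il] pl; exfalso; lra.
have uB i : [set x | u i x != 0] `<=` [set x | 0 < phi i x] by move=> x /uP[].
pose M i := `|c i| + (`|a i| + 1).
have M0 i : 0 < M i by rewrite ltr_wpDl// ltr_wpDl.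
have uM i x : M i < `|x| -> u i x = 0.
  move=> Mx; apply/eqP/negPn/negP => /uP[px _]; move: Mx; apply/negP; rewrite -leNgt.
  rewrite -(subrK (c i) x) addrC (le_trans (ler_normD _ _))// lerD2l.
  apply: row_norm_le => [|j]; first by rewrite addr_ge0.
  rewrite -(@ler_pXn2r _ 2)// ?nnegrE ?addr_ge0// real_normK ?num_real// !mxE.
  apply: (@le_trans _ _ (a i)).
    apply: le_trans (ltW _); last by rewrite -subr_gt0; exact: px.
    by rewrite (bigD1 j)//= lerDl; apply: sumr_ge0 => k _; exact: sqr_ge0.
  have := ler_norm (a i); have := normr_ge0 (a i); nra.
(* The bound [dyad i] is the summability that [glue] requires. *)
pose ti i := Num.min t (dyad i).
have ti0 i : 0 < ti i by rewrite lt_min t0 dyad_gt0.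
have [dD dDP] := @choice nat (('rV[R]_n -> 'rV[R]_n) * ('rV[R]_n -> 'M[R]_n))%type
  (fun i p => perturbation m f J Ks (u i) (ti i) p.1 p.2)
  ltac:(move=> i; have [d [Dd dP]] := has_perturbation m_gt0 fJ Jc Kc Ki Koo Kn (fu i) (u_ge0 i)
    (M0 i) (@uM i) (subset_trans (@uB i) (ggood i).1) (deformable_sub (@uB i) (ggood i).2) (ti0 i);
    by exists (d, Dd)).
have ti_le i : ti i <= t /\ ti i <= dyad i by rewrite /ti !ge_min !lexx orbT.
have [d [Dd [dJ Dc dE d0]]] := @glue R n u (fun i => (dD i).1) (fun i => (dD i).2) fu u_ge0 u_disj
  (fun i => perturbation_jac (dDP i)) (fun i => perturbation_cont (dDP i))
  (fun i x => le_trans (perturbation_jac_le (dDP i) x) (ti_le i).2)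
  (fun i x => @perturbation_zero _ _ _ _ _ _ _ _ _ _ (dDP i) x).
have case0 x : (exists i, u i x != 0) \/ forall i, u i x = 0.
  have [[i ui]|nu] := pselect (exists i, u i x != 0); [by left; exists i|right => i].
  by apply/eqP/negPn/negP => ui; apply: nu; exists i.
exists d, Dd; split=> //.
- move=> x; have [[i ui]|/d0[-> ->]] := case0 x; last by rewrite !normr0 ltW.
  have [-> ->] := dE _ _ ui; split; apply: le_trans (ti_le i).1.
    exact: perturbation_le (dDP i) x.
  exact: perturbation_jac_le (dDP i) x.
- move=> x nU; have [[i ui]|/d0[]//] := case0 x.
  by exfalso; apply: nU; apply: (ggood i).1; exact: uB.
- move=> x Ux; have [[i ui]|/d0[_ ->]] := case0 x; last by rewrite addr0; exact: Jm.
  by rewrite (dE _ _ ui).2; exact: (perturbation_rank (dDP i)).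
(* Every point of [S] that no [u i] reaches is in this null set. *)
pose N := (S `\` K) `|` \bigcup_i (K `&` [set x | phi i x = 0]).
have N0 : H (S `&` N) = 0%E.
  apply/le_anti; rewrite [X in _ && X]outer_measure_ge0 andbT.
  apply: (@le_trans _ _ (H N)); first by apply: le_outer_measure => x [].
  apply: (le_trans (outer_measureU2 _ _ _)); rewrite [X in (X + _ <= _)%E]SK add0e.
  by apply: (le_trans (outer_measure_sigma_subadditive _ _)); rewrite eseries0// => i _ _; exact: gnull.
pose g x := f x + d x.
have gN0 : H (g @` (S `&` N)) = 0%E.
  apply: (differentiable_image_null m_gt0 _ N0) => x [Sx _]; exists (J x + Dd x).
  by apply: has_jacD; [apply: fJ; exact: SU|exact: dJ].
apply/le_anti; rewrite [X in _ && X]outer_measure_ge0 andbT.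
apply: (@le_trans _ _ (H (g @` (S `&` N) `|` \bigcup_i (g @` (K `&` [set x | u i x != 0]))))).
  apply: le_outer_measure => _ [x Sx <-].
  have [Nx|nN] := pselect (N x); first by left; exists x.
  right; have Kx : K x by apply: contrapT => nK; apply: nN; left.
  have ex : exists i, 0 < phi i x by have [i _ ix] := gcov _ (SU Sx); exists i.
  have [i ix imin] := ex_minnP ex; exists i => //; exists x => //; split=> //.
  apply/uP; split=> // l li; rewrite lt_neqAle; apply/andP; split.
    by apply/eqP => px; apply: nN; right; exists l.
  by rewrite leNgt; apply/negP => /imin; rewrite leqNgt li.
apply: (le_trans (outer_measureU2 _ _ _)); rewrite [X in (X + _ <= _)%E]gN0 add0e.
apply: (le_trans (outer_measure_sigma_subadditive _ _)); rewrite eseries0// => i _ _.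
rewrite -[RHS](perturbation_null (dDP i)); congr (H _).
by apply/seteqP; split=> _ [x [Kx ux] <-]; exists x => //; rewrite /g (dE _ _ ux).1.
Qed.

End generic_perturbation.

(** A point is 0-rectifiable, as the range of a constant map, and has positive 0-dimensional
    measure. *)
Lemma purely_unrectifiable0 {R : realType} (n : nat) (S : set 'rV[R]_n) :
  purely_unrectifiable 0 S -> S = set0.
Proof.
move=> Su; apply/seteqP; split=> // x Sx; exfalso.
have rx : rectifiable 0 [set x].
  exists (fun=> fun=> x); split=> [i|].
    by exists 0 => y z; rewrite subrr enorm0 mul0r.
  rewrite (_ : _ `\` _ = set0) ?outer_measure0//.
  by apply/seteqP; split=> // y [-> nx]; apply: nx; exists 0%N => //; exists 0.
have : (1 <= hausdorff 0 (S `&` [set x]))%E; last by rewrite (Su _ rx) lee_fin ler10.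
apply: (@le_trans _ _ (hausdorff_delta 0 1 (S `&` [set x]))); last first.
  by apply: ereal_sup_ubound; exists 1 => /=.
apply: le_ereal_inf_tmp => _ [F [SF _] <-].
have [i _ Fx] := SF x (conj Sx erefl).
have w1 k : (0 <= hausdorff_weight 0 (F k))%E by rewrite /hausdorff_weight; case: ifP => // _; rewrite expe0.
apply: le_trans (nneseries_lim_ge i.+1 _); last by move=> k _ _; exact: w1.
rewrite big_nat_recr//= {2}/hausdorff_weight ifF ?expe0; last first.
  by apply/negbTE/set0P; exists x.
by rewrite leeDr// sume_ge0.
Qed.

Theorem theorem3p1 (R : realType) (m n : nat) (U Sigma : set 'rV[R]_n) :
  (m < n)%N -> open U -> Sigma `<=` U ->
  purely_unrectifiable m Sigma -> (hausdorff m Sigma < +oo)%E ->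
  interior [set f : C1rank m U | (0 < hausdorff m (f @` Sigma))%E] = set0.
Proof.
move=> _ oU SU Spu Soo; apply/seteqP; split=> // f; rewrite /interior /=.
(* In dimension 0 [Sigma] is empty, so f itself, the centre of the ball, violates the condition. *)
move=> [e /= e0 eA]; case: m f Spu Soo e0 eA => [|m'] f Spu Soo e0 eA.
  have := eA f (C1ball_center f e0); rewrite /= (purely_unrectifiable0 Spu) image_set0.
  by rewrite outer_measure0 ltxx.
set m := m'.+1 in f Spu Soo eA.
have m_gt0 : (0 < m)%N by [].
have fJ x : U x -> has_jac f x ('J f x).
  by move=> Ux; apply: has_jac_jacobian; exact: (C1rank_C1 f).1.
have Jc x : U x -> cont_at (fun y => 'J f y) x.
  move=> Ux; apply/cont_atP; have := (C1rank_C1 f).2.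
  by rewrite continuous_open_subspace// => /(_ x); apply; rewrite inE.
(* Sup-norm bounds t on d and Dd give the Euclidean bounds n t and n * n * t; the factor 2 and the
   summand 1 make the final inequality strict. *)
have [t t0 eE] : exists2 t : R, 0 < t & e = 2 * (n%:R + n%:R * n%:R + 1) * t.
  have N0 : 0 < 2 * (n%:R + n%:R * n%:R + 1) :> R by rewrite mulr_gt0// ltr_wpDl// addr_ge0// mulr_ge0.
  exists (e / (2 * (n%:R + n%:R * n%:R + 1))); first by rewrite divr_gt0.
  by rewrite mulrC divfK// gt_eqF.
have [d [Dd [dJ d_le d_out d_rank d_null]]] :=
  generic_perturbation m_gt0 oU SU Spu Soo fJ Jc (@C1rank_rank _ _ _ _ f) t0.
pose g y := f y + d y.
have gJ x : U x -> has_jac g x ('J f x + Dd x).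
  by move=> Ux; apply: has_jacD; [exact: fJ|exact: (dJ x).1].
have gE x : U x -> 'J g x = 'J f x + Dd x by move=> /gJ/differentiable_has_jac[].
have gC1 : C1_on U g.
  split=> [x /gJ/differentiable_has_jac[]//|].
  rewrite continuous_open_subspace// => x; rewrite inE => Ux; apply/cont_atP.
  have [r r0 rU] := (open_nballP U).1 oU _ Ux.
  apply: (cont_at_near r0 (f := fun y => 'J f y + Dd y)).
    by move=> y /rU /gE.
  by apply: cont_atD; [exact: Jc|exact: (dJ x).2].
have gr x : U x -> \rank ('J g x) = m by move=> Ux; rewrite gE//; exact: d_rank.
have go x : ~ U x -> g x = 0 by move=> nU; rewrite /g (C1rank_out f) ?d_out ?addr0.
have gf : (MkC1rank gC1 gr go : _ -> _) - (f : _ -> _) = d.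
  by apply/funext => x; rewrite !fctE /= /g addrC addKr.
suff /eA : C1ball f e (MkC1rank gC1 gr go) by rewrite /= [X in (0 < X)%E]d_null ltxx.
rewrite /C1ball /= gf.
apply: (@le_lt_trans _ _ ((n%:R * t)%:E + (n%:R * n%:R * t)%:E)%E); last first.
  rewrite -EFinD lte_fin eE.
  have : 0 <= n%:R * n%:R :> R by rewrite mulr_ge0.
  have : 0 <= n%:R :> R by []; move: (n%:R) (n%:R * n%:R) => a b; nra.
apply: leeD; rewrite /sup_on ge_max lee_fin !mulr_ge0 ?(ltW t0)//=.
  apply: ge_ereal_sup => _ [x Ux <-]; rewrite lee_fin; apply: (le_trans (enorm_le_norm _)).
  by rewrite ler_wpM2l//; exact: (d_le x).1.
apply: ge_ereal_sup => _ [x Ux <-]; apply: ge_ereal_sup => _ [v /= v1 <-].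
rewrite lee_fin (differentiable_has_jac (dJ x).1).2.
apply: (le_trans (enorm_le_norm _)); rewrite -mulrA ler_wpM2l//.
apply: (le_trans (norm_mulmx _ _)); rewrite -mulrA ler_wpM2l//.
rewrite -[leRHS]mul1r; apply: ler_pM => //; last exact: (d_le x).2.
exact: (le_trans (norm_le_enorm _)).
Qed.
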